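(* Let $T>0$, and consider strong solutions of $\partial_tu=\tfrac12u\,\partial_x^2u$ on the time interval $[0,T)$. (Cut) Suppose $u$ is a strong solution with initial data $u_0=u(0,\cdot)$ satisfying $u_0|_{\partial I}=0$ for some nonempty open interval $I\subset\mathbb{R}$. Then $\mathbf{1}_Iu$ is a strong solution. (Paste) Conversely, let $\mathscr{I}$ be a countable collection of disjoint nonempty open intervals $I\subset\mathbb{R}$. Suppose $(u_I)_{I\in\mathscr{I}}$ is a collection of strong solutions such that $u_I(0,\cdot)|_{I^c}=0$ for each $I\in\mathscr{I}$. If the sum $u:=\sum_{I\in\mathscr{I}}u_I$ satisfies $\partial_x^2u\in L^1([0,T);L^\infty(\mathbb{R}))$, $\partial_xu\in C([0,T);L^\infty_{\mathrm{loc}}(\mathbb{R}))$, and $u\in\langle x\rangle^2L^\infty([0,T)\times\mathbb{R})$, then $u$ is a strong solution.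
   Context: Write $\langle x\rangle=(x^2+1)^{1/2}$; $\langle x\rangle^{\ell}L^\infty$ denotes the space of functions $f$ with $\langle x\rangle^{-\ell}f\in L^\infty$. $(\mathbf{1}_Iu)(t,x)=\mathbf{1}_I(x)u(t,x)$ where $\mathbf{1}_I$ is the indicator function of $I$; its initial data is $\mathbf{1}_Iu_0$. Each solution is understood with its own initial data (its value at $t=0$). Consider the equation $\partial_t u=\tfrac12 u\,\partial_x^2u$, $u(0,\cdot)=u_0$, for $(t,x)\in[0,\infty)\times\mathbb{R}$. Weak solution: given $T>0$, $u\in C([0,T);W^{1,\infty}_{\mathrm{loc}}(\mathbb{R}))$ is a weak solution on $[0,T)$ if $u\ge0$ and for all $\psi\in C_c^\infty([0,T)\times\mathbb{R})$, $$\int_{\mathbb{R}}u_0\,\psi(0,\cdot)+\int_{[0,T)\times\mathbb{R}}\Big[u\,\partial_t\psi-\tfrac12\,\partial_x(\psi u)\,\partial_xu\Big]=0 .$$ Strong solution: given $\bar T>0$, a weak solution $u$ on $[0,\bar T)$ is a strong solution on $[0,\bar T)$ if for all $T\in(0,\bar T)$ we have $u\in\langle x\rangle^2L^\infty([0,T]\times\mathbb{R})$ and $\partial_x^2u\in L^1([0,T];L^\infty(\mathbb{R}))$. *)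

(* Defs.v *)
From mathcomp Require Import all_boot all_order all_algebra.
From mathcomp Require Import all_classical all_reals all_analysis.
Import Order.TTheory GRing.Theory Num.Theory numFieldNormedType.Exports.

Set Implicit Arguments.
Unset Strict Implicit.
Unset Printing Implicit Defensive.

Local Open Scope classical_set_scope.
Local Open Scope ring_scope.

(* A function of time and space is curried, [u : R -> R -> R] with [u t x].
   Values at times outside the interval under consideration are irrelevant. *)

Definition boundary (X : topologicalType) (A : set X) : set X :=
  closure A `\` interior A.

Section TestFunctions.
Context {R : realType}.
Implicit Types (phi : R -> R) (psi : R -> R -> R) (T : R).

Definition test_fun phi : Prop :=
  (forall n x, derivable (derive1n n phi) x 1) /\
  exists K : set R, compact K /\ forall x, ~ K x -> phi x = 0.

Definition partial_t psi : R -> R -> R := fun t x => derive1 (psi ^~ x) t.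
Definition partial_x psi : R -> R -> R := fun t x => derive1 (psi t) x.

Fixpoint class_C (n : nat) psi : Prop :=
  continuous (fun p : R * R => psi p.1 p.2) /\
  (if n is m.+1 then
     [/\ forall t x : R, derivable (psi ^~ x) t 1,
         forall t x : R, derivable (psi t) x 1,
         class_C m (partial_t psi) & class_C m (partial_x psi)]
   else True).

(* [C_c^oo([0, T) x R)]: an element is represented by a smooth extension to
   [R x R]; it need not vanish at [t = 0]. *)
Definition test_fun_tx T psi : Prop :=
  (forall n, class_C n psi) /\
  exists K : set (R * R),
    [/\ compact K, K `<=` `[0, T[ `*` setT &
        forall t x : R, 0 <= t < T -> ~ K (t, x) -> psi t x = 0].

End TestFunctions.

Section FunctionSpaces.
Context {R : realType}.
Implicit Types (f g : R -> R) (u v : R -> R -> R) (J K : set R) (T : R).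

Local Notation mu := (@lebesgue_measure R).

(* The norm of [L^oo(D)], in [[0, +oo]]. *)
Definition Linfty_norm d (X : measurableType d) (m : {measure set X -> \bar R})
    (D : set X) (f : X -> R) : \bar R :=
  ('N[m]_(+oo)[EFin \o (fun x => \1_D x * f x)%R])%E.

(* [g] is the [n]-th distributional derivative of [f]. *)
Definition weak_derivative (n : nat) f g : Prop :=
  [/\ locally_integrable setT f, locally_integrable setT g &
      forall phi, test_fun phi ->
        \int[mu]_x (f x * derive1n n phi x) =
        (-1) ^+ n * \int[mu]_x (g x * phi x)].

(* [v] is a representative, measurable in [(t, x)], of the distributional
   derivative [\partial_x u] over [J x R]. *)
Definition is_dx J u v : Prop :=
  measurable_fun (J `*` setT) (fun p : R * R => v p.1 p.2) /\
  forall t, J t -> weak_derivative 1 (u t) (v t).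

Definition Linfty_loc f : Prop :=
  measurable_fun setT f /\
  forall K, compact K -> (Linfty_norm mu K f < +oo)%E.

(* [C(J; L^oo_loc(R))] *)
Definition C_Linfty_loc J u : Prop :=
  (forall t, J t -> Linfty_loc (u t)) /\
  forall K, compact K -> forall t0, J t0 ->
    Linfty_norm mu K (fun x => u t x - u t0 x)
      @[t --> within J (nbhs t0)] --> (0 : \bar R).

(* [\partial_x u \in C(J; L^oo_loc(R))] *)
Definition dx_C_Linfty_loc J u : Prop :=
  exists v, is_dx J u v /\ C_Linfty_loc J v.

(* [u \in C(J; W^{1,oo}_loc(R))], where each [u t] is the continuous
   representative of its class, so that pointwise values make sense. *)
Definition C_W1infty_loc J u : Prop :=
  [/\ forall t, J t -> continuous (u t),
      C_Linfty_loc J u & dx_C_Linfty_loc J u].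

(* [\partial_x^2 u \in L^1(J; L^oo(R))] *)
Definition dxx_L1_Linfty J u : Prop :=
  exists w : R -> R -> R,
    [/\ measurable_fun (J `*` setT) (fun p : R * R => w p.1 p.2),
        {ae mu, forall t, J t -> weak_derivative 2 (u t) (w t)} &
        (\int[mu]_(t in J) Linfty_norm mu setT (w t) < +oo)%E].

Definition japanese_bracket (x : R) : R := Num.sqrt (x ^+ 2 + 1).

(* [u \in <x>^l L^oo(J x R)] *)
Definition weighted_Linfty (l : nat) J u : Prop :=
  measurable_fun (J `*` setT) (fun p : R * R => u p.1 p.2) /\
  (Linfty_norm (mu \x mu) (J `*` setT)
     (fun p : R * R => japanese_bracket p.2 ^- l * u p.1 p.2)%R < +oo)%E.

End FunctionSpaces.

Section Solutions.
Context {R : realType}.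
Implicit Types (u v z psi : R -> R -> R) (T : R).

Local Notation mu := (@lebesgue_measure R).

(* In the integral identity [v] stands for [\partial_x u] and [z] for
   [\partial_x (psi u)]; such [v] and [z] exist and are unique up to null sets,
   so the identity does not depend on the representatives. *)
Definition weak_solution T (u0 : R -> R) u : Prop :=
  [/\ C_W1infty_loc `[0, T[ u,
      forall t x : R, 0 <= t < T -> 0 <= u t x &
      forall psi v z, test_fun_tx T psi ->
        is_dx `[0, T[ u v ->
        is_dx `[0, T[ (fun t x => psi t x * u t x) z ->
        \int[mu]_x (u0 x * psi 0 x) +
        \int[(mu \x mu)%E]_(p in `[0, T[ `*` setT)
          (u p.1 p.2 * partial_t psi p.1 p.2 -
           2^-1 * (z p.1 p.2 * v p.1 p.2)) = 0].

Definition strong_solution T u : Prop :=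
  weak_solution T (u 0) u /\
  forall T', 0 < T' < T ->
    weighted_Linfty 2 `[0, T'] u /\ dxx_L1_Linfty `[0, T'] u.

Definition open_interval (I : set R) : Prop :=
  [/\ is_interval I, open I & I !=set0].

(* The sum of a family of functions that are nonnegative at the times of
   interest. The sum is computed in [\bar R]; [fine] only changes the value of
   an infinite sum, which does not occur for the families considered here: at
   every point at most one term is nonzero. *)
Definition family_sum (F : set (set R)) (u_ : set R -> R -> R -> R) :
    R -> R -> R :=
  fun t x => fine (\esum_(I in F) (u_ I t x)%:E)%E.

End Solutions.

(* Main.v *)
(** Let [w] be [\partial_x^2 u], a function for almost every time.  Integrating
    by parts on time slices turns the weak identity into
    [\int u_0 psi(0, x) dx + \iint u (\partial_t psi + psi w / 2) = 0], which
    contains no derivative of [psi] in [x].  By the fundamental lemma it holds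
    pointwise: for a.e. [x] the integral over time alone, plus the initial term,
    vanishes.  The equation is therefore local in [x], and a sufficiently regular
    function that coincides with strong solutions on countably many open sets and
    vanishes elsewhere is again a strong solution.  What remains is regularity.
    If [u(0, x0) = 0], then [y t = u(t, x0)] satisfies
    [y t <= 1/2 \int_0^t ||w s||_oo y s ds] and so vanishes identically.  Cutting
    at such a zero is harmless, since [u >= 0] makes [\partial_x u] vanish there
    as well, so that multiplication by the indicator commutes with both weak
    derivatives.  For a pasted sum, each slice is a.e. equal to the continuous
    primitive of its weak derivative, and the zeros at the endpoints of the
    intervals identify the two everywhere. *)

Require Import Defs.
From mathcomp Require Import all_boot all_order all_algebra.
From mathcomp Require Import all_classical all_reals all_analysis.
From mathcomp Require Import measurable_realfun ess_sup_inf ring lra.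
Import Order.TTheory GRing.Theory Num.Theory numFieldNormedType.Exports.

Set Implicit Arguments.
Unset Strict Implicit.
Unset Printing Implicit Defensive.

Local Open Scope classical_set_scope.
Local Open Scope ring_scope.

(** * Smooth functions and cut-offs *)

(** Three obstacles shape the proof. The second derivative [w] is controlled only for almost every
    time and then almost every point, so estimates and identities are obtained on time slices and
    assembled by Fubini's theorem. The set outside all the intervals may have positive measure; it
    contributes nothing because [u] itself is a factor of the integrand with [w], whatever [w] is
    there. Finally, [u] is never differentiated in time: the inequality for [y] comes from testing
    with a cut-off in time times an approximate identity in space, the error being O(1/n) thanks to
    a Lipschitz bound in space that is uniform in time. The test functions constructed for all this
    come from a single smooth step. Its rescalings approximate indicators of half-open intervals,
    and Lebesgue's differentiation theorem then gives both the fundamental lemma and the absolute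
    continuity of functions with a weak derivative. *)

Section Smooth.
Context {R : realType}.
Implicit Types (f g h : R -> R) (x a c : R).

(* A record rather than a bare quantification, which keeps unification from
   unfolding it. *)
Record smooth f : Prop := Smooth {
  smooth_derive1n : forall n x, derivable (derive1n n f) x 1 }.

(** Smoothness is the largest property of differentiable functions stable under [derive1].
    Exhibiting a stable class that contains the function avoids formulas for the n-th derivative of
    products, quotients and composites. *)
Lemma smooth_coind (P : (R -> R) -> Prop) :
  (forall f, P f -> (forall x, derivable f x 1) /\ P (derive1 f)) ->
  forall f, P f -> smooth f.
Proof.
move=> step f Pf; constructor=> n; elim: n f Pf => [|n IH] f Pf x.
  exact: (step f Pf).1.
by rewrite derive1Sn; apply: IH; exact: (step f Pf).2.
Qed.

Lemma smooth_derivable f : smooth f -> forall x, derivable f x 1.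
Proof. by move=> [sf] x; exact: (sf 0%N). Qed.

Lemma smooth_derive f : smooth f -> smooth (derive1 f).
Proof. by move=> [sf]; split=> n x; rewrite -derive1Sn; exact: sf. Qed.

Lemma smooth_is_derive f : smooth f -> forall x, is_derive x 1 f (derive1 f x).
Proof.
move=> sf x; apply: DeriveDef; first exact: smooth_derivable.
by rewrite derive1E.
Qed.

Lemma smooth_continuous f : smooth f -> continuous f.
Proof.
by move=> sf x; apply: differentiable_continuous;
  apply/derivable1_diffP; exact: smooth_derivable.
Qed.

Lemma is_derive_derive1 f (f' : R -> R) :
  (forall x, is_derive x 1 f (f' x)) -> derive1 f = f'.
Proof.
by move=> df; apply/funext => x; rewrite derive1E; exact: derive_val.
Qed.

Lemma is_derive_add f g x a c :
  is_derive x 1 f a -> is_derive x 1 g c ->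
  is_derive x 1 (fun y => f y + g y) (a + c).
Proof. by move=> df dg; exact: (@is_deriveD _ _ _ f g). Qed.

Lemma is_derive_mul f g x a c :
  is_derive x 1 f a -> is_derive x 1 g c ->
  is_derive x 1 (fun y => f y * g y) (f x * c + g x * a).
Proof. by move=> df dg; exact: (@is_deriveM _ _ f g). Qed.

Lemma smooth_cst c : smooth (fun=> c).
Proof.
apply: (@smooth_coind (fun f => exists c, f = fun=> c)); last by exists c.
move=> _ [d ->]; split; first by move=> x; exact: derivable_cst.
by exists 0; apply: is_derive_derive1 => x; exact: is_derive_cst.
Qed.

(** A product differentiates to a sum of two products, so products alone are not a stable class for
    [smooth_coind]; their finite sums are. *)
Inductive product_sum : (R -> R) -> Prop :=
| PSmul f g : smooth f -> smooth g -> product_sum (fun x => f x * g x)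
| PSadd f g : product_sum f -> product_sum g ->
    product_sum (fun x => f x + g x).

Lemma product_sum_smooth f : product_sum f -> smooth f.
Proof.
apply: smooth_coind => h ps.
suff [h' [dh' psh']] : exists h',
    (forall x, is_derive x 1 h (h' x)) /\ product_sum h'.
  split; last by rewrite (is_derive_derive1 dh').
  by move=> x; case: (dh' x).
elim: ps => {h} [f0 g sf sg|f0 g _ [f' [df pf]] _ [g' [dg pg]]].
  exists (fun x => f0 x * derive1 g x + g x * derive1 f0 x); split.
    move=> x; have df := smooth_is_derive sf x.
    by have dg := smooth_is_derive sg x; exact: is_derive_mul.
  exact (PSadd (PSmul sf (smooth_derive sg)) (PSmul sg (smooth_derive sf))).
exists (fun x => f' x + g' x); split; last exact: PSadd.
by move=> x; exact: is_derive_add (df x) (dg x).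
Qed.

Lemma smoothM f g : smooth f -> smooth g -> smooth (fun x => f x * g x).
Proof. by move=> sf sg; exact (product_sum_smooth (PSmul sf sg)). Qed.

Lemma smoothD f g : smooth f -> smooth g -> smooth (fun x => f x + g x).
Proof.
move=> sf sg; rewrite (_ : (fun x => _) = (fun x => f x * 1 + g x * 1)).
  exact (product_sum_smooth
    (PSadd (PSmul sf (smooth_cst 1)) (PSmul sg (smooth_cst 1)))).
by apply/funext => x; rewrite !mulr1.
Qed.

Lemma smoothZ c f : smooth f -> smooth (fun x => c * f x).
Proof. by move=> sf; exact (smoothM (smooth_cst c) sf). Qed.

Lemma smoothN f : smooth f -> smooth (fun x => - f x).
Proof.
move=> /(@smoothZ (-1)); congr smooth.
by apply/funext => x; rewrite mulN1r.
Qed.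

Lemma smoothB f g : smooth f -> smooth g -> smooth (fun x => f x - g x).
Proof. by move=> sf sg; exact (smoothD sf (smoothN sg)). Qed.

Lemma is_derive_affine a c x : is_derive x 1 (fun y => a * y + c) a.
Proof.
have := is_derive_add (is_derive_mul (is_derive_cst a x 1)
  (is_derive_id x 1)) (is_derive_cst c x 1).
by rewrite /= mulr1 mulr0 !addr0.
Qed.

Lemma is_derive_comp_affine f a c : smooth f ->
  forall x, is_derive x 1 (fun y => f (a * y + c)) (derive1 f (a * x + c) * a).
Proof.
move=> sf x; apply: (@is_derive1_comp _ f (fun y => a * y + c)).
  exact: smooth_is_derive.
exact: is_derive_affine.
Qed.

Lemma smooth_comp_affine f a c : smooth f -> smooth (fun x => f (a * x + c)).
Proof.
move=> sf; apply: (@smooth_coind (fun h => exists g b,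
    smooth g /\ h = fun x => b * g (a * x + c))); last first.
  by exists f, 1; split => //; apply/funext => x; rewrite mul1r.
move=> _ [g [b [sg ->]]].
have dg x : is_derive x 1 (fun x => b * g (a * x + c))
    ((b * a) * derive1 g (a * x + c)).
  have dgx := is_derive_comp_affine a c sg x.
  have := is_derive_mul (is_derive_cst b x 1) dgx.
  by rewrite mulr0 addr0 /cst mulrCA mulrC (mulrC a).
split; first by move=> x; case: (dg x).
exists (derive1 g), (b * a); split; first exact: smooth_derive.
exact: is_derive_derive1.
Qed.

(** The stable class consists of the quotients g / f^n with g smooth: the derivative of such a
    quotient is (g' f - n g f') / f^(n+1). *)
Lemma smoothV f : (forall x, f x != 0) -> smooth f ->
  smooth (fun x => (f x)^-1).
Proof.
move=> f0 sf; apply: (@smooth_coind (fun h => exists g n,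
    smooth g /\ h = fun x => g x * ((f x)^-1) ^+ n)); last first.
  exists (cst 1), 1%N; split; first exact: smooth_cst.
  by apply/funext => x; rewrite mul1r expr1.
move=> _ [g [n [sg ->]]].
have dg x : is_derive x 1 (fun x => g x * ((f x)^-1) ^+ n)
    ((derive1 g x * f x - n%:R * g x * derive1 f x) * ((f x)^-1) ^+ n.+1).
  have dgx := smooth_is_derive sg x; have dfx := smooth_is_derive sf x.
  have dV := is_deriveV (f0 x) dfx.
  have := @is_deriveX _ _ (fun y => (f y)^-1) n x 1 _ dV.
  rewrite exprfctE => /(is_derive_mul dgx) /is_derive_eq; apply.
  rewrite /GRing.scale /= exprS.
  case: n => [|n]; first by rewrite expr0 /=; field; exact: f0.
  by rewrite /= !exprS; field; rewrite ?f0.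
split; first by move=> x; case: (dg x).
exists (fun x => derive1 g x * f x - n%:R * g x * derive1 f x), n.+1; split.
  exact (smoothB (smoothM (smooth_derive sg) sf)
    (smoothM (smoothZ _ sg) (smooth_derive sf))).
exact: is_derive_derive1.
Qed.

(** The classical smooth function exp(-1/x), flat at 0. Carrying a polynomial in 1/x along makes the
    family stable under differentiation, through p -> X^2 (p - p'). *)
Definition flat (p : {poly R}) x : R :=
  if 0 < x then p.[x^-1] * expR (- x^-1) else 0.

(** From t/n <= 1 + t/n <= exp(t/n), raised to the power n. *)
Lemma exprn_le_expR n (t : R) : 0 <= t -> t ^+ n <= n%:R ^+ n * expR t.
Proof.
move=> t0; case: n => [|n]; first by rewrite !expr0 mul1r -expR0 ler_expR.
have n0 : (n.+1%:R : R) != 0 by [].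
rewrite -{1}(mulrVK (unitf_gt0 (ltr0Sn R n)) t) mulrC exprMn.
rewrite ler_wpM2l// ?exprn_ge0//.
have -> : expR t = expR (t / n.+1%:R) ^+ n.+1.
  by rewrite -expRM_natl mulrC divfK.
rewrite lerXn2r ?nnegrE ?expR_ge0 ?divr_ge0//.
by apply: le_trans (expR_ge1Dx _); rewrite lerDr.
Qed.

Lemma horner_le_expR (p : {poly R}) :
  exists C, forall t, 0 <= t -> `|p.[t]| <= C * expR t.
Proof.
exists (\sum_(i < size p) `|p`_i| * i%:R ^+ i) => t t0.
rewrite horner_coef mulr_suml; apply: le_trans (ler_norm_sum _ _ _) _.
apply: ler_sum => i _; rewrite normrM -mulrA ler_wpM2l//.
by rewrite ger0_norm ?exprn_ge0//; exact: exprn_le_expR.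
Qed.

Lemma is_derive_flat p x :
  is_derive x 1 (flat p) (flat ('X ^+ 2 * (p - p^`())) x).
Proof.
have [x0|x0|<-] := ltgtP 0 x.
- rewrite {2}/flat x0.
  have x0' : x != 0 by rewrite gt_eqF.
  have dV := is_deriveV x0' (@is_derive_id _ _ x 1).
  have dp : is_derive x 1 (fun y => p.[y^-1]) ((p^`()).[x^-1] * (- x ^- 2)).
    apply: (@is_derive1_comp _ (horner p) (fun y : R => y^-1)).
    by apply: is_derive_eq; rewrite /GRing.scale /= mulr1.
  have de : is_derive x 1 (fun y => expR (- y^-1))
      (expR (- x^-1) * x ^- 2).
    apply: (@is_derive1_comp _ expR (fun y : R => - y^-1)).
    by apply: is_derive_eq; rewrite /GRing.scale /= mulr1 opprK.
  apply: near_eq_is_derive; last first.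
    have /is_derive_eq := is_derive_mul dp de; apply.
    rewrite hornerM hornerXn hornerD hornerN.
    by move: (p.[x^-1]) (p^`().[x^-1]) (expR (- x^-1)) => a b c; field.
  near=> y; rewrite /flat ifT//; near: y.
  exact: lt_nbhsr.
- rewrite {2}/flat ltNge (ltW x0) /=.
  have : is_derive x 1 (cst 0 : R -> R) 0 by exact: is_derive_cst.
  apply: near_eq_is_derive.
  near=> y; rewrite /flat ltNge /cst ifF//; apply/negbF/ltW; near: y.
  exact: lt_nbhsl.
(* At 0 the extra factor X^2 gives |p(1/h)| exp(-1/h) <= C h^2, so the difference quotient is at
   most C h; [C + 1] only provides a positive divisor. *)
- have [C hC] := horner_le_expR (p * 'X ^+ 2).
  rewrite {2}/flat ltxx.
  have C0 : 0 <= C.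
    have := hC 0 (lexx _); rewrite expR0 mulr1; exact: le_trans.
  have lim : h^-1 *: (flat p (h *: 1 + 0) - flat p 0) @[h --> 0^'] --> (0:R).
    apply/cvgrPdist_le => e e0; near=> h.
    rewrite sub0r normrN addr0 [flat p 0]/flat ltxx subr0 /GRing.scale /= mulr1.
    rewrite /flat; case: ifPn => h0; last by rewrite mulr0 normr0 ltW.
    have hi : 0 <= h^-1 by rewrite invr_ge0 ltW.
    have := hC _ hi; rewrite hornerM hornerXn exprVn => H.
    apply: (@le_trans _ _ ((C + 1) * h)); last first.
      rewrite -ler_pdivlMl ?ltr_wpDl// mulrC -[h]gtr0_norm//; near: h.
      by apply: dnbhs0_le; rewrite divr_gt0// ltr_wpDl.
    have h1 : h != 0 by rewrite gt_eqF.
    have hh : 0 < h ^+ 2 by rewrite exprn_gt0.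
    rewrite normrM gtr0_norm ?invr_gt0// ler_pdivrMl// normrM.
    rewrite [X in _ * X]gtr0_norm ?expR_gt0// expRN ler_pdivrMr ?expR_gt0//.
    move: H; rewrite normrM [X in _ * X]gtr0_norm ?invr_gt0//.
    rewrite ler_pdivrMr// => /le_trans; apply.
    rewrite [leRHS](_ : _ = (C + 1) * (expR h^-1 * h ^+ 2)); last by ring.
    by rewrite -mulrA ler_wpM2r ?lerDl// mulr_ge0 ?expR_ge0// ltW.
  apply: DeriveDef; first by apply/cvg_ex; exists 0.
  by apply: cvg_lim.
Unshelve. all: by end_near. Qed.

Lemma smooth_flat p : smooth (flat p).
Proof.
apply: (@smooth_coind (fun f => exists q, f = flat q)); last by exists p.
move=> _ [q ->]; split; first by move=> x; case: (is_derive_flat q x).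
by exists ('X ^+ 2 * (q - q^`())); apply: is_derive_derive1 => x;
  exact: is_derive_flat.
Qed.

Lemma flat1_ge0 x : 0 <= flat 1 x.
Proof. by rewrite /flat; case: ifP => // _; rewrite hornerC mul1r expR_ge0. Qed.

Lemma derive_flat1_ge0 x : 0 <= derive1 (flat 1) x.
Proof.
rewrite derive1E; have [_ ->] := is_derive_flat 1 x.
rewrite /flat; case: ifP => // x0.
by rewrite derivC subr0 mulr1 hornerXn mulr_ge0 ?expR_ge0// exprn_ge0// invr_ge0 ltW.
Qed.

(** The denominator of the usual smooth step e(x) / (e(x) + e(1 - x)), where e = [flat 1]; it is
    positive because x and 1 - x are never both nonpositive. *)
Definition step_den x := flat 1 x + flat 1 (-1 * x + 1).

Lemma step_den_gt0 x : 0 < step_den x.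
Proof.
have flat_gt0 y : 0 < y -> 0 < flat 1 y.
  by move=> y0; rewrite /flat y0 hornerC mul1r expR_gt0.
rewrite /step_den; have [x0|x0] := ltP 0 x.
  by rewrite ltr_pwDl ?flat_gt0 ?flat1_ge0.
apply: ltr_wpDl; [exact: flat1_ge0|apply: flat_gt0].
by rewrite mulN1r addrC subr_gt0 (le_lt_trans x0).
Qed.

Definition step x := flat 1 x * (step_den x)^-1.

Lemma smooth_step_den : smooth step_den.
Proof.
exact: smoothD (smooth_flat 1) (smooth_comp_affine (-1) 1 (smooth_flat 1)).
Qed.

Lemma smooth_step : smooth step.
Proof.
apply: smoothM; first exact: smooth_flat.
by apply: smoothV; [move=> x; rewrite gt_eqF// step_den_gt0
                   |exact: smooth_step_den].
Qed.

Lemma step_le0 x : x <= 0 -> step x = 0.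
Proof. by move=> x0; rewrite /step /flat ltNge x0 mul0r. Qed.

Lemma step_ge1 x : 1 <= x -> step x = 1.
Proof.
move=> x1; have := step_den_gt0 x; rewrite /step /step_den.
rewrite [flat 1 (-1 * x + 1)]/flat ifF; last by apply/negbTE; rewrite -leNgt; lra.
by rewrite addr0 => h; rewrite divff// gt_eqF.
Qed.

Definition bump : R -> R := derive1 step.

Lemma smooth_bump : smooth bump.
Proof. exact/smooth_derive/smooth_step. Qed.

(** In the quotient rule the products e(x) e'(x) cancel, and the numerator becomes e'(x) e(1 - x) +
    e(x) e'(1 - x), a sum of nonnegative terms. *)
Lemma bump_ge0 x : 0 <= bump x.
Proof.
pose e1 y := flat 1 (-1 * y + 1).
have de := smooth_is_derive (smooth_flat 1) x.
have de1 : is_derive x 1 e1 (derive1 (flat 1) (-1 * x + 1) * -1).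
  exact: is_derive_comp_affine (smooth_flat 1) _.
have dd := is_derive_add de de1.
have d0 : step_den x != 0 by rewrite gt_eqF// step_den_gt0.
have dstep : is_derive x 1 step _ := is_derive_mul de (is_deriveV d0 dd).
rewrite /bump derive1E (@derive_val _ _ _ _ _ _ _ dstep).
rewrite /GRing.scale /=; set D := step_den x.
rewrite [leRHS](_ : _ = (derive1 (flat 1) x * e1 x +
   flat 1 x * derive1 (flat 1) (-1 * x + 1)) / D ^+ 2).
  rewrite divr_ge0 ?exprn_ge0 ?(ltW (step_den_gt0 x))//.
  by rewrite addr_ge0// mulr_ge0 ?derive_flat1_ge0 ?flat1_ge0.
have De : D = flat 1 x + e1 x by [].
have -> : e1 x = D - flat 1 x by rewrite De addrC addKr.
by move: (derive1 _ _) (derive1 _ _) (flat 1 x) => a b c; field.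
Qed.

Lemma bump_eq0 x : x < 0 \/ 1 < x -> bump x = 0.
Proof.
move=> x01; rewrite /bump derive1E; apply: derive_val.
case: x01 => [y0|y0].
  have : is_derive x 1 (cst 0 : R -> R) 0 by exact: is_derive_cst.
  apply: near_eq_is_derive; near=> z; rewrite step_le0//; apply: ltW; near: z.
  exact: lt_nbhsl.
have : is_derive x 1 (cst 1 : R -> R) 0 by exact: is_derive_cst.
apply: near_eq_is_derive; near=> z; rewrite step_ge1//; apply: ltW; near: z.
exact: lt_nbhsr.
Unshelve. all: by end_near. Qed.

Lemma step_ge0 x : 0 <= step x.
Proof. by rewrite /step divr_ge0 ?flat1_ge0// ltW// step_den_gt0. Qed.

Lemma step_le1 x : step x <= 1.
Proof.
by rewrite /step ler_pdivrMr ?step_den_gt0// mul1r lerDl flat1_ge0.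
Qed.

(* [trapezoid n a b] and [spike n a] tend to the indicator of [`]a, b]] and to
   the Dirac mass at [a]; the support of [spike n a] lies to the right of [a]. *)
Definition trapezoid (n : nat) (a b : R) x : R :=
  step (n.+1%:R * (x - a)) - step (n.+1%:R * (x - b)).

Definition spike (n : nat) (a : R) x : R := n.+1%:R * bump (n.+1%:R * (x - a)).

Lemma smooth_step_scaled (n : nat) a :
  smooth (fun x => step (n.+1%:R * (x - a))).
Proof.
have := smooth_comp_affine n.+1%:R (- (n.+1%:R * a)) smooth_step.
by congr smooth; apply/funext => x; rewrite mulrBr.
Qed.

Lemma derive_step_scaled (n : nat) a :
  derive1 (fun x => step (n.+1%:R * (x - a))) = spike n a.
Proof.
apply: is_derive_derive1 => x.
have := is_derive_comp_affine n.+1%:R (- (n.+1%:R * a)) smooth_step x.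
rewrite /spike (mulrC _ (bump _)) /bump mulrBr.
by congr is_derive; apply/funext => y; rewrite mulrBr.
Qed.

Lemma smooth_spike (n : nat) a : smooth (spike n a).
Proof.
by rewrite -derive_step_scaled; exact/smooth_derive/smooth_step_scaled.
Qed.

Lemma smooth_trapezoid (n : nat) a b : smooth (trapezoid n a b).
Proof. exact: smoothB (smooth_step_scaled n a) (smooth_step_scaled n b). Qed.

Lemma derive_trapezoid (n : nat) a b :
  derive1 (trapezoid n a b) = fun x => spike n a x - spike n b x.
Proof.
apply: is_derive_derive1 => x.
have da := smooth_is_derive (smooth_step_scaled n a) x.
have db := smooth_is_derive (smooth_step_scaled n b) x.
by have := is_deriveB da db; rewrite !derive_step_scaled.
Qed.

Lemma spike_ge0 (n : nat) a x : 0 <= spike n a x.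
Proof. by rewrite mulr_ge0 ?bump_ge0. Qed.

Lemma spike_eq0 (n : nat) a x : x < a \/ a + n.+1%:R^-1 < x -> spike n a x = 0.
Proof.
move=> xa; rewrite /spike bump_eq0 ?mulr0//; case: xa => xa; [left|right].
  by rewrite pmulr_rlt0// subr_lt0.
by rewrite -ltr_pdivrMl// mulr1 ltrBrDl.
Qed.

Lemma trapezoid_eq0 (n : nat) a b x : a <= b ->
  x < a \/ b + n.+1%:R^-1 < x -> trapezoid n a b x = 0.
Proof.
move=> ab [xa|xb]; rewrite /trapezoid.
  by rewrite !step_le0 ?subr0// pmulr_rle0// subr_le0 ltW// (lt_le_trans xa).
rewrite !step_ge1 ?subrr// -ler_pdivrMl// mulr1 lerBrDl ltW//.
by rewrite (le_lt_trans _ xb)// lerD2r.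
Qed.

Lemma trapezoid_bound (n : nat) a b x : `|trapezoid n a b x| <= 1.
Proof.
rewrite /trapezoid ler_norml.
have := step_ge0 (n.+1%:R * (x - a)); have := step_ge0 (n.+1%:R * (x - b)).
have := step_le1 (n.+1%:R * (x - a)); have := step_le1 (n.+1%:R * (x - b)).
lra.
Qed.

(** The rescaled step vanishes at [a] for every [n], so the limit is a half-open indicator at every
    point, [a] included. *)
Lemma cvg_step_scaled (a x : R) :
  step (n.+1%:R * (x - a)) @[n --> \oo] --> (\1_(`]a, +oo[%classic) x : R).
Proof.
have [xa|xa] := leP x a.
  rewrite indicE memNset; last by rewrite /= in_itv/= ltNge xa.
  rewrite (_ : (fun _ => _) = cst 0); first exact: cvg_cst.
  by apply/funext => n; rewrite step_le0// pmulr_rle0// subr_le0.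
rewrite indicE mem_set; last by rewrite /= in_itv/= xa.
apply: (@cvg_trans _ ((fun=> 1 : R) @ \oo)); last exact: cvg_cst.
apply: near_eq_cvg; near=> n; rewrite step_ge1//.
rewrite -ler_pdivrMr ?subr_gt0// mul1r.
have /(le_trans _) : n%:R <= n.+1%:R :> R by rewrite ler_nat.
apply; near: n; exact: nbhs_infty_ger.
Unshelve. all: by end_near. Qed.

Lemma cvg_trapezoid a b x : a <= b ->
  trapezoid n a b x @[n --> \oo] --> (\1_(`]a, b]%classic) x : R).
Proof.
move=> ab; have -> : \1_(`]a, b]%classic) x =
    \1_(`]a, +oo[%classic) x - \1_(`]b, +oo[%classic) x :> R.
  rewrite !indicE !mem_setE /= !in_itv /= !andbT.
  have [xb|xb] := leP x b; first by rewrite andbT subr0.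
  by rewrite (le_lt_trans ab xb) subrr.
by apply: cvgB; exact: cvg_step_scaled.
Qed.

End Smooth.

(** * Integration of real-valued functions *)

Section RealIntegral.
Context d {X : measurableType d} {R : realType}.
Variable m : {measure set X -> \bar R}.
Implicit Types (D E : set X) (f g : X -> R).

Lemma integrable_meas D f :
  m.-integrable D (EFin \o f) -> measurable_fun D f.
Proof. by move=> /integrableP[/measurable_EFinP]. Qed.

Lemma integrable_le D f g : measurable D -> measurable_fun D f ->
  m.-integrable D (EFin \o g) -> (forall x, D x -> `|f x| <= g x) ->
  m.-integrable D (EFin \o f).
Proof.
move=> mD mf ig fg; apply: (le_integrable mD _ _ ig).
  exact/measurable_EFinP.
by move=> x Dx; rewrite /= lee_fin (le_trans (fg _ Dx))// ler_norm.
Qed.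

Lemma ae_integrable_le D f g : measurable D -> measurable_fun D f ->
  m.-integrable D (EFin \o g) -> {ae m, forall x, D x -> `|f x| <= g x} ->
  m.-integrable D (EFin \o f).
Proof.
move=> mD mf ig fg; apply/integrableP; split; first exact/measurable_EFinP.
have /integrableP[mg] := ig; apply: le_lt_trans.
apply: ae_ge0_le_integral => //.
- by apply: measurableT_comp => //; exact/measurable_EFinP.
- exact: measurableT_comp.
- apply: filterS fg => x fgx Dx; rewrite /= lee_fin.
  by rewrite (le_trans (fgx Dx))// ler_norm.
Qed.

Lemma ae_eq_Rintegral D f g : measurable D -> measurable_fun D f ->
  measurable_fun D g -> {ae m, forall x, D x -> f x = g x} ->
  \int[m]_(x in D) f x = \int[m]_(x in D) g x.
Proof.
move=> mD mf mg fg; rewrite /Rintegral; congr fine.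
apply: ae_eq_integral => //; [exact/measurable_EFinP|exact/measurable_EFinP|].
by apply: filterS fg => x fgx Dx /=; rewrite fgx.
Qed.

Lemma ae_integrable_eq D f g : measurable D -> measurable_fun D f ->
  m.-integrable D (EFin \o g) -> {ae m, forall x, D x -> f x = g x} ->
  m.-integrable D (EFin \o f).
Proof.
move=> mD mf ig fg; apply: (@ae_integrable_le _ _ (Num.norm \o g)) => //.
  exact: integrable_norm.
by apply: filterS fg => x h Dx; rewrite (h Dx).
Qed.

(** The minimum of [f] and [g] is below [g] everywhere and equals [f] almost everywhere, which
    reduces the claim to an everywhere comparison. *)
Lemma ae_le_Rintegral D f g : measurable D -> m.-integrable D (EFin \o f) ->
  m.-integrable D (EFin \o g) -> {ae m, forall x, D x -> f x <= g x} ->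
  \int[m]_(x in D) f x <= \int[m]_(x in D) g x.
Proof.
move=> mD fi gi fg; have mf := integrable_meas fi; have mg := integrable_meas gi.
pose h x := Num.min (f x) (g x).
have mh : measurable_fun D h by exact: measurable_minr.
have hf : {ae m, forall x, D x -> h x = f x}.
  by apply: filterS fg => x fgx /fgx; rewrite /h => /min_idPl.
rewrite -(ae_eq_Rintegral mD mh mf hf); apply: le_Rintegral => //.
  exact: ae_integrable_eq hf.
by move=> x _; rewrite /h ge_min lexx orbT.
Qed.

Lemma Rintegral_supp D E f : measurable D -> measurable E -> E `<=` D ->
  (forall x, D x -> ~ E x -> f x = 0) ->
  \int[m]_(x in D) f x = \int[m]_(x in E) f x.
Proof.
move=> mD mE ED fE; rewrite Rintegral_mkcond [RHS]Rintegral_mkcond.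
apply: eq_Rintegral => x _; rewrite !patchE.
case: ifPn => xD; case: ifPn => xE //; move: xD xE; rewrite ?inE ?notin_setE//.
- by move=> Dx nEx; exact: fE.
- by move=> nDx /ED.
Qed.

Lemma EFin_Rintegral D f : measurable D -> m.-integrable D (EFin \o f) ->
  (\int[m]_(x in D) f x)%:E = (\int[m]_(x in D) (f x)%:E)%E.
Proof. by move=> mD fi; rewrite fineK//; exact: integrable_fin_num. Qed.

Lemma Rdominated_cvg D (f_ : nat -> X -> R) f g : measurable D ->
  (forall n, measurable_fun D (f_ n)) -> measurable_fun D f ->
  (forall x, D x -> f_ n x @[n --> \oo] --> f x) ->
  m.-integrable D (EFin \o g) -> (forall n x, D x -> `|f_ n x| <= g x) ->
  \int[m]_(x in D) f_ n x @[n --> \oo] --> \int[m]_(x in D) f x.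
Proof.
move=> mD mf_ mf cf ig fg.
have [] := @dominated_convergence _ _ _ m D mD (fun n => EFin \o f_ n)
  (EFin \o f) (EFin \o g).
- by move=> n; exact/measurable_EFinP.
- exact/measurable_EFinP.
- by apply: aeW => x Dx; apply: cvg_EFin; [exact: nearW|exact: cf].
- exact: ig.
- by apply: aeW => x n Dx; rewrite /= lee_fin fg.
move=> fi _ cvi; rewrite /Rintegral.
apply: fine_cvg; move: cvi; rewrite /= fineK//.
by apply: (@integrable_fin_num _ _ _ m D).
Unshelve. all: by end_near. Qed.

End RealIntegral.

(** * Locally integrable functions and test functions on the line *)

Section LocallyIntegrable.
Context {R : realType}.
Local Notation mu := (@lebesgue_measure R).
Implicit Types (f g phi : R -> R) (a b c e C M : R).

Lemma locint_itv f (i : interval R) a b : locally_integrable setT f ->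
  [set` i] `<=` `[a, b] -> mu.-integrable [set` i] (EFin \o f).
Proof.
move=> [mf _ lf] iab; apply: (@integrableS _ _ R mu _ _ _ _ _ iab) => //.
apply/integrableP; split; last by apply: lf => //; exact: segment_compact.
by apply/measurable_EFinP; exact: measurable_funTS.
Qed.

Lemma locint_mulr f g C a b : locally_integrable setT f ->
  measurable_fun setT g -> (forall x, `|g x| <= C) ->
  (forall x, x < a \/ b < x -> g x = 0) ->
  mu.-integrable setT (EFin \o (fun x => f x * g x)).
Proof.
move=> lf mg gC g0; have [mf _ _] := lf.
have fi : mu.-integrable setT (EFin \o ((fun x => C * f x) \_ `[a, b])).
  rewrite (_ : EFin \o _ = (fun x => C%:E * (EFin \o f) x)%E \_ `[a, b]).
    apply/(@integrable_mkcond _ _ R mu `[a, b]%classic) => //.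
    apply: (@integrableZl _ _ R mu) => //.
    exact: locint_itv lf (@subset_refl _ _).
  by apply/funext => x; rewrite /= !patchE; case: ifPn.
apply: (le_integrable _ _ _ fi) => //.
  by apply/measurable_EFinP; exact: measurable_funM.
move=> x _; rewrite /= lee_fin patchE mem_setE /= in_itv /=.
case: ifPn => [_|].
  by rewrite mulrC !normrM ler_wpM2r// (le_trans (gC x))// ler_norm.
by rewrite negb_and -!ltNge => /orP/g0 ->; rewrite mulr0.
Qed.

Lemma smooth_measurable f : smooth f -> measurable_fun setT f.
Proof. by move=> /smooth_continuous; exact: continuous_measurable_fun. Qed.

Lemma continuous_locint f : continuous f -> locally_integrable setT f.
Proof.
move=> cf; split; [exact: continuous_measurable_fun|exact: openT|].
move=> K _ cK; have /integrableP[_] : mu.-integrable K (EFin \o f).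
  by apply: continuous_compact_integrable => //; exact: continuous_subspaceT.
exact.
Qed.

Lemma compact_itv (K : set R) : compact K ->
  exists2 M : R, 0 < M & K `<=` `[- M, M].
Proof.
move=> /compact_bounded[M [_ hM]]; exists (`|M| + 1); first by rewrite ltr_wpDl.
move=> x Kx; rewrite /= in_itv /= -ler_norml; apply: (hM (`|M| + 1)) => //.
by rewrite (le_lt_trans (ler_norm _))// ltrDl.
Qed.

Lemma test_funP phi : test_fun phi <->
  smooth phi /\ exists2 M : R, 0 < M & forall x : R, x < - M \/ M < x -> phi x = 0.
Proof.
split=> [[sp [K [cK K0]]]|[[sp] [M M0 phi0]]].
  split; first by split.
  have [M M0 KM] := compact_itv cK; exists M => // x xM; apply: K0 => /KM.
  by rewrite /= in_itv /=; case: xM => xM; rewrite ?(ltNge _ x) => /andP[]; lra.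
split => //; exists `[- M, M]%classic; split; first exact: segment_compact.
move=> x /negP; rewrite in_itv /= negb_and -!ltNge => /orP; exact: phi0.
Qed.

Lemma derive1_supp phi M : (forall x, x < - M \/ M < x -> phi x = 0) ->
  forall x, x < - M \/ M < x -> derive1 phi x = 0.
Proof.
move=> phi0 x xM; rewrite derive1E; apply: derive_val.
have : is_derive x 1 (cst 0 : R -> R) 0 by exact: is_derive_cst.
apply: near_eq_is_derive; case: xM => xM; near=> y; rewrite phi0//;
  [left|right]; near: y; [exact: lt_nbhsl|exact: lt_nbhsr].
Unshelve. all: by end_near. Qed.

Lemma test_fun_derive phi : test_fun phi -> test_fun (derive1 phi).
Proof.
move=> /test_funP[sp [M M0 phi0]]; apply/test_funP; split.
  exact: smooth_derive.
by exists M => //; exact: derive1_supp.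
Qed.

Lemma test_fun_bounded phi : test_fun phi -> exists C, forall x, `|phi x| <= C.
Proof.
move=> /test_funP[sp [M M0 phi0]].
have : compact (phi @` `[- M, M]).
  apply: continuous_compact; last exact: segment_compact.
  exact/continuous_subspaceT/smooth_continuous.
move=> /compact_itv[C C0 hC]; exists C => x.
have [xM|] := boolP (x \in `[- M, M]).
  by rewrite ler_norml; apply: (hC (phi x)); exists x.
rewrite in_itv /= negb_and -!ltNge => /orP/phi0 ->.
by rewrite normr0 ltW.
Qed.

Lemma locint_test f phi : locally_integrable setT f -> test_fun phi ->
  mu.-integrable setT (EFin \o (fun x => f x * phi x)).
Proof.
move=> lf tp; have [C hC] := test_fun_bounded tp.
have /test_funP[sp [M M0 phi0]] := tp.
exact: locint_mulr lf (smooth_measurable sp) hC phi0.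
Qed.

Lemma test_fun_trapezoid n a b : a <= b -> test_fun (trapezoid n a b).
Proof.
move=> ab; apply/test_funP; split; first exact: smooth_trapezoid.
exists (`|a| + `|b| + 1); first by rewrite ltr_wpDl// addr_ge0.
move=> x xM; apply: trapezoid_eq0 => //.
have n1 : n.+1%:R^-1 <= 1 :> R by rewrite invf_le1// ler1n.
have /andP[a1 a2] : - `|a| <= a <= `|a| by rewrite -ler_norml.
have /andP[b1 b2] : - `|b| <= b <= `|b| by rewrite -ler_norml.
have := normr_ge0 a; have := normr_ge0 b; move: (n.+1%:R^-1) n1 => d d1.
by case: xM => xM b0 a0; [left|right]; lra.
Qed.

Lemma cvg_int_trapezoid f a b : locally_integrable setT f -> a <= b ->
  \int[mu]_x (f x * trapezoid n a b x) @[n --> \oo] -->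
  \int[mu]_(x in `]a, b]) f x.
Proof.
move=> lf ab; have [mf _ _] := lf.
rewrite [X in _ --> X](_ : _ = \int[mu]_x (f x * \1_(`]a, b]%classic) x)).
  (* The trapezoid overshoots [b] by 1/(n+1) <= 1, hence a dominating function on [[a, b + 1]]. *)
  apply: (@Rdominated_cvg _ _ _ mu setT _ _ (fun x => `|f x| * \1_(`[a, b + 1]%classic) x)) => //.
  - move=> n; apply: measurable_funM => //.
    exact: smooth_measurable (smooth_trapezoid n a b).
  - by apply: measurable_funM => //; exact: measurable_indic.
  - by move=> x _; apply: cvgM; [exact: cvg_cst|exact: cvg_trapezoid].
  - apply: (@locint_mulr _ _ 1 a (b + 1)).
    + split; [exact: measurableT_comp|exact: openT|].
      by move=> K KT cK; under eq_integral do rewrite /= normr_id;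
        have [_ _ ->] := lf.
    + exact: measurable_indic.
    + by move=> x; rewrite indicE; case: (_ \in _); rewrite ?normr0 ?normr1.
    + move=> x xab; rewrite indicE mem_setE /= in_itv /=.
      by have [/andP[h1 h2]|//] := boolP (a <= x <= b + 1); exfalso;
        case: xab => h; lra.
  - move=> n x _; rewrite normrM ler_wpM2l// indicE mem_setE /= in_itv /=.
    have [h|h] := boolP (a <= x <= b + 1); first exact: trapezoid_bound.
    rewrite trapezoid_eq0 ?normr0//; move: h; rewrite negb_and -!ltNge.
    have n1 : n.+1%:R^-1 <= 1 :> R by rewrite invf_le1// ler1n.
    move: (n.+1%:R^-1) n1 => d d1.
    by move=> /orP[?|?]; [left|right]; lra.
rewrite Rintegral_mkcond; apply: eq_Rintegral => x _.
by rewrite patchE indicE; case: ifPn; rewrite ?mulr1 ?mulr0.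
Qed.

End LocallyIntegrable.

(** * Fubini, distributions and weak derivatives *)

Section RealFubini.
Context d1 d2 {X : measurableType d1} {Y : measurableType d2} {R : realType}.
Variables (m1 : {sigma_finite_measure set X -> \bar R})
  (m2 : {sigma_finite_measure set Y -> \bar R}).
Variable f : X * Y -> R.
Hypothesis fi : (m1 \x m2)%E.-integrable setT (EFin \o f).

(** An inner integral in Fubini's theorem may be infinite or undefined on a null set; [fine]
    replaces it there without changing integrability or the integral. *)
Lemma EFin_fine_ae (d : measure_display) (Z : measurableType d)
  (m : {measure set Z -> \bar R}) (D : set Z) (F : Z -> \bar R) :
  measurable D -> m.-integrable D F ->
  m.-integrable D (EFin \o (fine \o F)) /\
  (\int[m]_(z in D) (fine (F z))%:E = \int[m]_(z in D) F z)%E.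
Proof.
move=> mD Fi; have aeF := integrable_ae mD Fi.
have mF : measurable_fun D F by have /integrableP[] := Fi.
have mf : measurable_fun D (EFin \o (fine \o F)).
  by apply/measurable_EFinP; exact: measurableT_comp.
split; last first.
  apply: ae_eq_integral => //; apply: filterS aeF => z Fz /= /Fz Fz'.
  by rewrite fineK.
apply/integrableP; split => //.
have /integrableP[_] := Fi; apply: le_lt_trans.
apply: ae_ge0_le_integral => //; [exact: measurableT_comp|exact: measurableT_comp|].
by apply: filterS aeF => z Fz /= /Fz Fz'; rewrite -[in leRHS](fineK Fz').
Qed.

Lemma RFubini12 : m1.-integrable setT (EFin \o (fun x => \int[m2]_y f (x, y))) /\
  \int[m1]_x \int[m2]_y f (x, y) = \int[(m1 \x m2)%E]_p f p.
Proof.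
have [iF eF] := EFin_fine_ae measurableT (integrable_fubini_F fi); split; first exact: iF.
by rewrite {1 3}/Rintegral [in LHS]eF integral12_prod_meas1.
Qed.

Lemma RFubini21 : m2.-integrable setT (EFin \o (fun y => \int[m1]_x f (x, y))) /\
  \int[m2]_y \int[m1]_x f (x, y) = \int[(m1 \x m2)%E]_p f p.
Proof.
have iG : m2.-integrable setT (fubini_G m1 (EFin \o f)).
  have /integrable21ltyP h : measurable_fun setT (EFin \o f).
    by have /integrableP[] := fi.
  apply/integrableP; split; first exact: (measurable_fubini_G fi).
  have := (h m1 m2).1 fi; apply: le_lt_trans; apply: ge0_le_integral => //.
  - by apply: measurableT_comp => //; exact: (measurable_fubini_G fi).
  - apply: (measurable_fun_fubini_tonelli_G (abse \o (EFin \o f))) => //=.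
    by apply: measurableT_comp => //; have /integrableP[] := fi.
  - move=> y _; apply: le_abse_integral => //.
    have /integrableP[mf _] := fi; exact: (measurableT_comp mf).
have [iF eF] := EFin_fine_ae measurableT iG; split; first exact: iF.
by rewrite {1 3}/Rintegral [in LHS]eF integral21_prod_meas1.
Qed.

End RealFubini.

(** * The fundamental lemma, absolute continuity and integration by parts *)

Section FundamentalLemma.
Context {R : realType}.
Local Notation mu := (@lebesgue_measure R).
Implicit Types (f g phi : R -> R) (a b c e C M x : R) (I : set R).

Lemma aeS (P Q : R -> Prop) : (forall x, P x -> Q x) ->
  {ae mu, forall x, P x} -> {ae mu, forall x, Q x}.
Proof. exact: (@filterS _ _ (ae_filter_ringOfSetsType mu)). Qed.

Lemma aeS2 (P P' Q : R -> Prop) : (forall x, P x -> P' x -> Q x) ->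
  {ae mu, forall x, P x} -> {ae mu, forall x, P' x} -> {ae mu, forall x, Q x}.
Proof. exact: (@filterS2 _ _ (ae_filter_ringOfSetsType mu)). Qed.

Lemma Rintegral_ball f x (r : R) : locally_integrable setT f -> 0 < r ->
  \int[mu]_(y in ball x r) f y = \int[mu]_(y in `]x - r, x + r]) f y.
Proof.
move=> lf r0; rewrite ball_itv; apply: Rintegral_itv_bndo_bndc.
by apply: (@locint_itv _ f `]x - r, x + r[ (x - r) (x + r)) => //;
  exact: subset_itv_oo_cc.
Qed.

Lemma integrable_ball f x (r : R) : locally_integrable setT f -> 0 < r ->
  [/\ mu.-integrable (ball x r) (EFin \o f),
      mu.-integrable (ball x r) (EFin \o cst (f x)) &
      mu.-integrable (ball x r) (EFin \o (fun y => f y - f x))].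
Proof.
move=> lf r0.
have mb : measurable (ball x r : set (measurableTypeR R)).
  by exact: measurable_ball.
have fi : mu.-integrable (ball x r) (EFin \o f).
  rewrite ball_itv; apply: (@locint_itv _ f `]x - r, x + r[ (x - r) (x + r)) => //.
  exact: subset_itv_oo_cc.
have ci : mu.-integrable (ball x r) (EFin \o cst (f x)).
  apply: measurable_bounded_integrable => //.
    have : (mu (ball x r) < +oo)%E by rewrite lebesgue_measure_ball ?ltry// ltW.
    exact.
  by exists `|f x|; split => // M fM y _ /=; exact: ltW.
by split => //; have := integrableB mb fi ci.
Qed.

Lemma davgE f x (r : R) : locally_integrable setT f -> 0 < r ->
  davg f x r = ((r *+ 2)^-1 * \int[mu]_(y in ball x r) `|f y - f x|)%:E.
Proof.
move=> lf r0; have [_ _ fci] := integrable_ball x lf r0.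
have mb : measurable (ball x r : set (measurableTypeR R)).
  by exact: measurable_ball.
have rr : 0 < r *+ 2 by rewrite pmulrn_lgt0.
rewrite /davg /iavg lebesgue_measure_ball ?(ltW r0)// inver (gt_eqF rr).
have -> : (\int[mu]_(y in ball x r) `|((center (f x) \o f) y)%:E| =
    (\int[mu]_(y in ball x r) `|f y - f x|)%:E)%E.
  by rewrite EFin_Rintegral//; exact: (integrable_norm fci).
by rewrite EFinM.
Qed.

(** At a Lebesgue point x of [I] with f x <> 0, the mean of [f] over small balls is 0 by hypothesis,
    so the mean of |f - f x| is at least |f x| and cannot tend to 0. *)
Lemma ae_eq0_itv f I : locally_integrable setT f -> open I ->
  (forall a b, a <= b -> `[a, b] `<=` I -> \int[mu]_(y in `]a, b]) f y = 0) ->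
  {ae mu, forall x, I x -> f x = 0}.
Proof.
move=> lf oI f0; have := lebesgue_differentiation lf.
apply: aeS => x lx Ix.
apply/eqP/negPn/negP => fx0.
have /nbhs_ballP[e e0 eI] : nbhs x I by exact: open_nbhs_nbhs.
have : \forall r \near (0:R)^'+, (davg f x r < `|f x|%:E)%E.
  have : nbhs (0%E : \bar R) [set y | (y < `|f x|%:E)%E].
    by apply: open_nbhs_nbhs; split; [exact: open_ereal_lt_ereal|
      rewrite /= lte_fin normr_gt0].
  exact: lx.
move=> near_lt.
have [r [r0 re dr]] : exists r : R, [/\ 0 < r, r < e & (davg f x r < `|f x|%:E)%E].
  have : \forall r \near (0:R)^'+, [/\ 0 < r, r < e & (davg f x r < `|f x|%:E)%E].
    near=> r; split; near: r; [exact: nbhs_right_gt|exact: nbhs_right_lt|exact: near_lt].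
  by move=> /filter_ex.
suff : (`|f x|%:E <= davg f x r)%E by rewrite leNgt dr.
have rr : 0 < r *+ 2 by rewrite pmulrn_lgt0.
have mb : measurable (ball x r : set (measurableTypeR R)).
  by exact: measurable_ball.
have [fi ci fci] := integrable_ball x lf r0.
have Eint : \int[mu]_(y in ball x r) (f y - f x) = - (f x * (r *+ 2)).
  rewrite (RintegralB mb fi ci) Rintegral_ball// f0//; last first.
  - move=> y; rewrite /= in_itv/= => /andP[yx xy]; apply: eI.
    by rewrite /ball/= ltr_distl; apply/andP; split; lra.
  - by rewrite lerD2l; lra.
  rewrite sub0r; congr (- _); rewrite (@Rintegral_cst _ _ _ mu _ mb).
  rewrite [X in _ * fine X](_ : _ = (r *+ 2)%:E)//.
  exact: lebesgue_measure_ball (ltW r0).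
rewrite davgE// lee_fin ler_pdivlMl//.
have := le_normr_Rintegral mb fci; apply: le_trans.
by rewrite Eint normrN normrM (gtr0_norm rr) mulrC.
Unshelve. all: by end_near. Qed.

(** Trapezoids suffice as test functions, since they recover the integrals over []a, b]]; openness
    of [I] at [b] absorbs their overshoot. Support in [I] is phrased as vanishing near each outer
    point, so that derivatives of [phi] vanish there as well. *)
Lemma fundamental_lemma f I : locally_integrable setT f -> open I ->
  (forall phi, test_fun phi -> (forall x, ~ I x -> \forall y \near x, phi y = 0) ->
     \int[mu]_x (f x * phi x) = 0) ->
  {ae mu, forall x, I x -> f x = 0}.
Proof.
move=> lf oI f0.
apply: ae_eq0_itv => // a b ab abI.
have [Ia Ib] : I a /\ I b by split; apply: abI; rewrite /= in_itv /= lexx ab.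
have cv := cvg_int_trapezoid lf ab.
have /nbhs_ballP[e /= e0 eI] : nbhs b I by exact: open_nbhs_nbhs.
have cv0 : \int[mu]_x (f x * trapezoid n a b x) @[n --> \oo] --> (0 : R).
  apply: (@cvg_trans _ ((fun=> 0 : R) @ \oo)); last exact: cvg_cst.
  apply: near_eq_cvg; near=> n; rewrite f0//; first exact: test_fun_trapezoid.
  move=> x nIx.
  have ne : n.+1%:R^-1 < e.
    by near: n; exact: near_infty_natSinv_lt (PosNum e0).
  have [xa|ax] := ltP x a.
    have : \forall y \near x, y < a by exact: lt_nbhsl.
    by apply: filterS => y ya; apply: trapezoid_eq0 => //; left.
  have xb : b + n.+1%:R^-1 < x.
    rewrite ltNge; apply/negP => xb; apply: nIx.
    have [xb'|bx] := leP x b; first by apply: abI; rewrite /= in_itv/= ax.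
    have {xb ne} xbe : x < b + e by rewrite (le_lt_trans xb)// ltrD2l.
    by apply: eI; rewrite /ball/= ltr_distl; apply/andP; split; lra.
  have : \forall y \near x, b + n.+1%:R^-1 < y by exact: lt_nbhsr.
  by apply: filterS => y yb; apply: trapezoid_eq0 => //; right.
exact: (cvg_unique _ cv cv0).
Unshelve. all: by end_near. Qed.

Lemma weak_derivative1_unique f g h : weak_derivative 1 f g ->
  weak_derivative 1 f h -> {ae mu, forall x, g x = h x}.
Proof.
move=> [lf lg fg] [_ lh fh].
suff : {ae mu, forall x, setT x -> g x - h x = 0}.
  by apply: aeS => x /(_ Logic.I) /eqP; rewrite subr_eq0 => /eqP.
apply: fundamental_lemma; [exact: locally_integrableB|exact: openT|].
move=> phi tphi _; under eq_Rintegral do rewrite mulrBl.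
rewrite RintegralB//; [|exact: locint_test|exact: locint_test].
have := fh _ tphi; rewrite fg// !expr1 !mulN1r => /oppr_inj ->.
by rewrite subrr.
Qed.

Lemma Rintegral_spike (n : nat) a : \int[mu]_x spike n a x = 1.
Proof.
have n0 : 0 < n.+1%:R^-1 :> R by rewrite invr_gt0.
rewrite (@Rintegral_supp _ _ _ mu _ `[a, a + n.+1%:R^-1]%classic)//; last first.
  move=> x _ /negP; rewrite in_itv /= negb_and -!ltNge => /orP; exact: spike_eq0.
rewrite /Rintegral -derive_step_scaled.
have sm := smooth_step_scaled n a.
rewrite (@continuous_FTC2 _ _ (fun x => step (n.+1%:R * (x - a)))).
- by rewrite /= subrr mulr0 (@step_le0 _ 0)// subr0 [a + _]addrC addrK divff// step_ge1.
- by rewrite ltrDl.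
- exact/continuous_subspaceT/smooth_continuous/smooth_derive.
- split; first by move=> x _; exact: smooth_derivable.
  + apply: cvg_at_right_filter; exact: (smooth_continuous sm).
  + apply: cvg_at_left_filter; exact: (smooth_continuous sm).
- by [].
Qed.

Lemma test_fun_spike (n : nat) a : test_fun (spike n a).
Proof.
apply/test_funP; split; first exact: smooth_spike.
exists (`|a| + 1); first by rewrite ltr_wpDl.
move=> x xM; apply: spike_eq0.
have n1 : n.+1%:R^-1 <= 1 :> R by rewrite invf_le1// ler1n.
have /andP[a1 a2] : - `|a| <= a <= `|a| by rewrite -ler_norml.
move: (n.+1%:R^-1) n1 => d d1.
by case: xM => xM; [left|right]; lra.
Qed.

Lemma spike_integrable (n : nat) a : mu.-integrable setT (EFin \o spike n a).
Proof.
have := locint_test (continuous_locint (@cst_continuous R R 1)) (test_fun_spike n a).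
by congr integrable; apply/funext => x /=; rewrite mul1r.
Qed.

Lemma spike_mean (n : nat) f a c e :
  measurable_fun `[a, a + n.+1%:R^-1] f ->
  (forall x, a <= x <= a + n.+1%:R^-1 -> `|f x - c| <= e) ->
  `|\int[mu]_x (f x * spike n a x) - c| <= e.
Proof.
set E := [set` `[a, _]] => mf fc.
have Enot x : ~ E x -> spike n a x = 0.
  by move=> /negP; rewrite in_itv /= negb_and -!ltNge => /orP; exact: spike_eq0.
have mE : measurable (E : set (measurableTypeR R)) by exact: measurable_itv.
have iS : mu.-integrable E (EFin \o spike n a).
  exact: integrableS (spike_integrable n a).
have mS : measurable_fun E (spike n a) := integrable_meas iS.
have iZ k : mu.-integrable E (EFin \o (fun x => k * spike n a x)).
  have := @integrableZl _ _ R mu E mE k _ iS.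
  by congr integrable.
have ifS : mu.-integrable E (EFin \o (fun x => f x * spike n a x)).
  apply: (integrable_le mE _ (iZ (`|c| + e))); first exact: measurable_funM.
  move=> x Ex; rewrite normrM (ger0_norm (spike_ge0 _ _ _)).
  rewrite ler_wpM2r ?spike_ge0// -(subrK c (f x)) addrC.
  by rewrite (le_trans (ler_normD _ _))// lerD2l fc.
rewrite (@Rintegral_supp _ _ _ mu _ E)//; last first.
  by move=> x _ /Enot ->; rewrite mulr0.
have Ec k : \int[mu]_(x in E) (k * spike n a x) = k.
  rewrite RintegralZl// -(@Rintegral_supp _ _ _ mu setT E)//; last first.
    by move=> x _ /Enot ->.
  by rewrite Rintegral_spike mulr1.
rewrite -{1}(Ec c) -RintegralB//.
have ifc : mu.-integrable E (EFin \o (fun x => f x * spike n a x - c * spike n a x)).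
  exact: (integrableB mE ifS (iZ c)).
rewrite (le_trans (le_normr_Rintegral mE ifc))// -[leRHS]Ec.
apply: le_Rintegral => //; first exact: (integrable_norm ifc).
move=> x Ex; rewrite -mulrBl normrM (ger0_norm (spike_ge0 _ _ _)).
by rewrite ler_wpM2r ?spike_ge0// fc.
Qed.

Lemma bump_bounded : exists C, forall x, `|bump x| <= C :> R.
Proof.
apply: test_fun_bounded; apply/test_funP; split; first exact: smooth_bump.
by exists 1 => // x x01; apply: bump_eq0; case: x01; [left|right]; lra.
Qed.

Lemma cvg_int_spike f a : locally_integrable setT f -> lebesgue_pt f a ->
  \int[mu]_x (f x * spike n a x) @[n --> \oo] --> f a.
Proof.
move=> lf fa; have [C hC] := bump_bounded.
have C0 : 0 <= C by apply: le_trans (hC 0).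
apply/cvgrPdist_le => e e0.
(* The spike is at most (n+1) C and lives in the ball of radius 2/(n+1), whose length 4/(n+1)
   accounts for the 4. The radius is doubled so that the open ball contains the whole support. *)
have e1 : 0 < e / (4 * (C + 1)) by rewrite divr_gt0// mulr_gt0// ltr_wpDl.
have : nbhs (0%E : \bar R) [set y | (y < (e / (4 * (C + 1)))%:E)%E].
  by apply: open_nbhs_nbhs; split; [exact: open_ereal_lt_ereal|rewrite /= lte_fin].
move=> /fa /nbhs_ballP[d /= d0 hd]; near=> n.
pose r : R := 2 * n.+1%:R^-1.
have r0 : 0 < r by rewrite mulr_gt0// invr_gt0.
have : (davg f a r < (e / (4 * (C + 1)))%:E)%E.
  apply: hd => //; rewrite /ball /= sub0r normrN gtr0_norm//.
  rewrite /r -ltr_pdivlMl// mulrC.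
  by near: n; exact: near_infty_natSinv_lt (PosNum (divr_gt0 d0 (ltr0Sn R 1))).
rewrite davgE// lte_fin => davg_lt.
have [fi ci fci] := integrable_ball a lf r0.
have mb : measurable (ball a r : set (measurableTypeR R)) by exact: measurable_ball.
have ifS : mu.-integrable setT (EFin \o (fun x => f x * spike n a x)).
  exact: locint_test lf (test_fun_spike n a).
have icS : mu.-integrable setT (EFin \o (fun x => f a * spike n a x)).
  have := @integrableZl _ _ R mu setT measurableT (f a) _ (spike_integrable n a).
  by congr integrable.
rewrite distrC -[X in _ - X]mulr1 -(Rintegral_spike n a) -RintegralZl//; last first.
  exact: spike_integrable.
rewrite -RintegralB//.
have snot x : ~ ball a r x -> spike n a x = 0.
  move=> nb; apply: spike_eq0; have [xa|ax] := ltP x a; first by left.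
  right; rewrite ltNge; apply/negP => xn; apply: nb.
  rewrite /ball/= ltr_distl; apply/andP; split.
    by rewrite ltrBlDr (le_lt_trans xn)// ltrD2l /r ltr_pMl ?invr_gt0// ltr1n.
  by rewrite (le_lt_trans ax)// ltrDl.
rewrite (@Rintegral_supp _ _ _ mu setT (ball a r))//; last first.
  by move=> x _ /snot ->; rewrite !mulr0 subrr.
have ifaS : mu.-integrable (ball a r) (EFin \o (fun x => f x * spike n a x - f a * spike n a x)).
  by apply: (@integrableS _ _ R mu setT) => //; exact: (integrableB measurableT ifS icS).
rewrite (le_trans (le_normr_Rintegral mb ifaS))//.
have ifaC : mu.-integrable (ball a r) (EFin \o (fun x => (n.+1%:R * C) * `|f x - f a|)).
  have := @integrableZl _ _ R mu _ mb (n.+1%:R * C) _ (integrable_norm fci).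
  by congr integrable.
apply: (@le_trans _ _ (\int[mu]_(x in ball a r) ((n.+1%:R * C) * `|f x - f a|))).
  apply: le_Rintegral => //; first exact: integrable_norm ifaS.
  move=> x _; rewrite -mulrBl normrM mulrC ler_wpM2r// /spike normrM.
  by rewrite ger0_norm// ler_wpM2l.
rewrite RintegralZl//; last exact: integrable_norm fci.
move: davg_lt; set J := \int[mu]_(x in _) _.
have J0 : 0 <= J by apply: Rintegral_ge0.
have -> : (r *+ 2)^-1 = n.+1%:R / 4 by rewrite /r; field.
have C1 : 0 < 4 * (C + 1) by rewrite mulr_gt0// ltr_wpDl.
rewrite ltr_pdivlMr// => hJ; apply: le_trans (ltW hJ).
have NJ : 0 <= n.+1%:R * J by rewrite mulr_ge0.
rewrite [leRHS](_ : _ = n.+1%:R * J * (C + 1)); last by field.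
by rewrite mulrAC ler_wpM2l// lerDl.
Unshelve. all: by end_near. Qed.

(* [g] is the density of an absolutely continuous [f]. *)
Definition primitive_of f g : Prop :=
  forall a b, a <= b -> f b - f a = \int[mu]_(x in `]a, b]) g x.

(** Tested against [trapezoid n a b], whose derivative is a spike at [a] minus a spike at [b], the
    definition of the weak derivative becomes the fundamental theorem of calculus in the limit. *)
Lemma weak_derivative_lebesgue f g a b : weak_derivative 1 f g ->
  lebesgue_pt f a -> lebesgue_pt f b -> a <= b ->
  f b - f a = \int[mu]_(x in `]a, b]) g x.
Proof.
move=> [lf lg fg] fa fb ab.
have cv := cvg_int_trapezoid lg ab.
have cs : (\int[mu]_x (f x * spike n b x) - \int[mu]_x (f x * spike n a x))
    @[n --> \oo] --> f b - f a by apply: cvgB; apply: cvg_int_spike.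
apply: (cvg_unique _ cs) => //; apply: cvg_trans cv.
apply: near_eq_cvg; near=> n => /=.
have := fg _ (test_fun_trapezoid n ab); rewrite expr1 mulN1r.
move=> /(congr1 -%R); rewrite opprK => <-.
rewrite /= derive_trapezoid.
under [X in - X = _]eq_Rintegral do rewrite mulrBr.
have iS c : mu.-integrable setT (EFin \o (fun x => f x * spike n c x)).
  exact: locint_test lf (test_fun_spike n c).
by rewrite RintegralB// opprB.
Unshelve. all: by end_near. Qed.

Lemma weak_derivative_primitive f g : continuous f -> weak_derivative 1 f g ->
  primitive_of f g.
Proof.
move=> cf fg a b ab; have lp x : lebesgue_pt f x.
  apply: (@continuous_lebesgue_pt _ f x setT) => //.
  - by split => //; exact: openT.
  - exact: continuous_measurable_fun.
  - exact: cf.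
exact: weak_derivative_lebesgue.
Qed.

Lemma Rintegral_itv_split g a b c : locally_integrable setT g ->
  a <= b -> b <= c ->
  \int[mu]_(x in `]a, c]) g x =
  \int[mu]_(x in `]a, b]) g x + \int[mu]_(x in `]b, c]) g x.
Proof.
move=> lg ab bc; rewrite -(@Rintegral_itvB _ g (BRight a) (BRight c) b).
- by rewrite addrC subrK.
- by apply: (@locint_itv _ g `]a, c] a c) => //; exact: subset_itv_oc_cc.
- by rewrite bnd_simp.
- by rewrite bnd_simp.
Qed.

Definition primitive g a x : R :=
  if a <= x then \int[mu]_(y in `]a, x]) g y
  else - \int[mu]_(y in `]x, a]) g y.

Lemma primitiveP g a : locally_integrable setT g ->
  primitive_of (primitive g a) g.
Proof.
move=> lg x y xy; rewrite /primitive.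
have [ay|ya] := leP a y; have [ax|xa] := leP a x.
- by rewrite (Rintegral_itv_split lg ax xy) addrC addKr.
- by rewrite opprK addrC -Rintegral_itv_split// ltW.
- by have := lt_le_trans ya (le_trans ax xy); rewrite ltxx.
- by rewrite opprK addrC (Rintegral_itv_split lg xy (ltW ya)) addrK.
Qed.

Lemma primitive_of_addc f g c : primitive_of f g ->
  primitive_of (fun x => f x + c) g.
Proof. by move=> fg a b /fg <-; rewrite opprD addrACA subrr addr0. Qed.

Lemma primitive_of_continuous f g : locally_integrable setT g ->
  primitive_of f g -> continuous f.
Proof.
move=> lg fg; suff cx (x : R) : f y @[y --> x] --> f x by move=> x; exact: cx.
have lt1 : x - 1 < x + 1 by lra.
have gi : mu.-integrable `[x - 1, x + 1] (EFin \o g).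
  exact: (@locint_itv _ g `[x - 1, x + 1] (x - 1) (x + 1)).
have := parameterized_integral_continuous (ltW lt1) gi.
move=> /(continuous_within_itvP _ lt1)[+ _ _].
have xin : x \in `]x - 1, x + 1[ by rewrite in_itv /=; apply/andP; split; lra.
move=> /(_ x xin) cint.
have feq y : x - 1 <= y <= x + 1 ->
    parameterized_integral mu (x - 1) y g + f (x - 1) = f y.
  move=> /andP[y1 y2]; have := fg _ _ y1.
  rewrite /parameterized_integral Rintegral_itv_obnd_cbnd; last first.
    by apply: (@locint_itv _ g `]x - 1, y] (x - 1) y) => //; exact: subset_itv_oc_cc.
  by move=> <-; rewrite subrK.
have : parameterized_integral mu (x - 1) y g + f (x - 1) @[y --> x] --> f x.
  rewrite -(feq x); last by apply/andP; split; lra.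
  by apply: cvgD; [exact: cint|exact: cvg_cst].
apply: cvg_trans; apply: near_eq_cvg; near=> y; rewrite feq//.
near: y; apply: filterS (near_in_itvoo xin) => y.
by rewrite in_itv /= => /andP[/ltW -> /ltW ->].
Unshelve. all: by end_near. Qed.

(** The primitive must be anchored at a Lebesgue point of [f], where the value of [f] is not
    arbitrary. One exists, since otherwise [[0, 1]] would be negligible, and the two functions then
    agree at every other Lebesgue point. *)
Lemma weak_derivative_ae_primitive f g : weak_derivative 1 f g ->
  exists F, [/\ primitive_of F g & {ae mu, forall x, f x = F x}].
Proof.
move=> fg; have [lf lg _] := fg.
have ae_leb := lebesgue_differentiation lf.
have [a fa] : exists a, lebesgue_pt f a.
  apply: contrapT => /forallNP nf.
  have : {ae mu, forall x : R, False} by apply: aeS ae_leb => x /nf.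
  move=> [N [mN N0 /= hN]].
  have : (mu `[0%R, 1%R]%classic <= mu N)%E.
    by apply: le_measure; rewrite ?inE// => x _; apply: hN.
  by rewrite N0 lebesgue_measure_itv/= lte_fin ltr01 oppr0 adde0 lee_fin ler10.
exists (fun x => primitive g a x + f a); split.
  exact/primitive_of_addc/primitiveP.
apply: aeS ae_leb => x fx; rewrite /primitive.
case: leP => [ax|/ltW xa].
  by rewrite -(weak_derivative_lebesgue fg fa fx ax) subrK.
by rewrite -(weak_derivative_lebesgue fg fx fa xa) opprB subrK.
Qed.

Local Notation mu2 := (mu \x mu)%E.

Lemma integrable_prodM f g :
  mu.-integrable setT (EFin \o f) -> mu.-integrable setT (EFin \o g) ->
  mu2.-integrable setT (EFin \o (fun p : R * R => f p.1 * g p.2)).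
Proof.
move=> fi gi; have mf := integrable_meas fi; have mg := integrable_meas gi.
apply/integrable12ltyP.
  apply/measurable_EFinP; apply: measurable_funM.
    exact: (measurableT_comp mf measurable_fst).
  exact: (measurableT_comp mg measurable_snd).
rewrite (_ : (\int[mu]_x _)%E =
    (\int[mu]_x (`|(f x)%:E| * \int[mu]_y `|(g y)%:E|))%E); last first.
  apply: eq_integral => x _; rewrite -ge0_integralZl//; last first.
    by apply: measurableT_comp => //; exact/measurable_EFinP.
  by apply: eq_integral => y _ /=; rewrite normrM EFinM.
have /integrableP[_ gfin] := gi; have /integrableP[_ ffin] := fi.
have g0 : (0 <= \int[mu]_y `|(g y)%:E|)%E by exact: integral_ge0.
rewrite ge0_integralZr//; last first.
  by apply: measurableT_comp => //; exact/measurable_EFinP.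
rewrite lte_mul_pinfty//; first exact: integral_ge0.
by rewrite ge0_fin_numE//; exact: integral_ge0.
Qed.

(** Both sides integrate f(x) g(y) over the triangle a < y <= x <= b; the inner interval []y, b]]
    differs from the slice [[y, b]] by a null set. *)
Lemma Fubini_triangle f g a b :
  mu.-integrable `]a, b] (EFin \o f) -> mu.-integrable `]a, b] (EFin \o g) ->
  \int[mu]_(x in `]a, b]) (f x * \int[mu]_(y in `]a, x]) g y) =
  \int[mu]_(y in `]a, b]) (g y * \int[mu]_(x in `]y, b]) f x).
Proof.
move=> fi gi.
pose f0 x := f x * \1_(`]a, b]%classic) x.
pose g0 x := g x * \1_(`]a, b]%classic) x.
have f0i : mu.-integrable setT (EFin \o f0).
  have /(@integrable_mkcond _ _ R mu `]a, b]%classic) := fi => /(_ (measurable_itv _)).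
  congr integrable; apply/funext => x; rewrite /= patchE /f0 indicE.
  by case: ifPn; rewrite ?mulr1 ?mulr0.
have g0i : mu.-integrable setT (EFin \o g0).
  have /(@integrable_mkcond _ _ R mu `]a, b]%classic) := gi => /(_ (measurable_itv _)).
  congr integrable; apply/funext => x; rewrite /= patchE /g0 indicE.
  by case: ifPn; rewrite ?mulr1 ?mulr0.
pose D : set (R * R) := [set p | p.2 <= p.1].
have mD : measurable D.
  rewrite [D](_ : _ = (fun p : R * R => p.1 - p.2) @^-1` `[0, +oo[%classic).
    rewrite -[X in measurable X]setTI; apply: measurable_funB => //.
  by apply/seteqP; split => p; rewrite /D /= in_itv /= andbT subr_ge0.
pose h (p : R * R) := f0 p.1 * g0 p.2 * \1_D p.
have hi : mu2.-integrable setT (EFin \o h).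
  apply: (@integrable_le _ _ _ mu2 setT h (fun p : R * R => `|f0 p.1 * g0 p.2|)) => //.
  - apply: measurable_funM; last exact: measurable_indic.
    exact: (integrable_meas (integrable_prodM f0i g0i)).
  - exact: integrable_norm (integrable_prodM f0i g0i).
  - move=> p _; rewrite /h normrM ler_piMr// indicE.
    by case: (_ \in _); rewrite ?normr1 ?normr0.
have cut_int (k : R -> R) (i : interval R) : mu.-integrable setT (EFin \o k) ->
    mu.-integrable setT (EFin \o (fun y => k y * \1_([set` i]) y)).
  move=> ki; apply: (@integrable_le _ _ _ mu setT _ (fun y => `|k y|)) => //.
  - apply: measurable_funM; [exact: integrable_meas ki|exact: measurable_indic].
  - exact: integrable_norm ki.
  - move=> y _; rewrite normrM ler_piMr// indicE.
    by case: (_ \in _); rewrite ?normr1 ?normr0.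
have hD x y : (\1_D : R * R -> R) (x, y) = (y <= x)%R%:R.
  by rewrite indicE; congr (nat_of_bool _)%:R; apply/idP/idP; rewrite inE.
have hE1 x : (fun y => h (x, y)) = fun y => f0 x * (g0 y * \1_(`]-oo, x]%classic) y).
  by apply/funext => y; rewrite /h /= mulrA hD indicE mem_setE /= in_itv.
have hE2 y : (fun x => h (x, y)) = fun x => g0 y * (f0 x * \1_(`[y, +oo[%classic) x).
  apply/funext => x; rewrite /h /= mulrA (mulrC (f0 x)) hD indicE mem_setE /=.
  by rewrite in_itv /= andbT.
have E1 x : \int[mu]_y h (x, y) = f0 x * \int[mu]_(y in `]a, x]) g y.
  rewrite hE1 RintegralZl//; last exact: cut_int.
  rewrite /f0 indicE mem_setE /= in_itv /=.
  have [/andP[ax xb]|_] := boolP (a < x <= b); last by rewrite mulr0 !mul0r.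
  congr (_ * _); rewrite [RHS]Rintegral_mkcond.
  apply: eq_Rintegral => y _; rewrite patchE /g0 !indicE !mem_setE /= !in_itv /=.
  have [yx|yx] := leP y x; last by rewrite mulr0 andbF.
  rewrite (le_trans yx xb) !andbT mulr1.
  by case: ifPn; rewrite ?mulr1 ?mulr0.
have E2 y : \int[mu]_x h (x, y) = g0 y * \int[mu]_(x in `]y, b]) f x.
  rewrite hE2 RintegralZl//; last exact: cut_int.
  rewrite /g0 indicE mem_setE /= in_itv /=.
  have [/andP[ay yb]|_] := boolP (a < y <= b); last by rewrite mulr0 !mul0r.
  congr (_ * _).
  rewrite Rintegral_itv_obnd_cbnd; last first.
    apply: (integrableS _ _ _ fi) => // x; rewrite /= !in_itv/= => /andP[yx ->].
    by rewrite (lt_trans ay yx).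
  rewrite [RHS]Rintegral_mkcond.
  apply: eq_Rintegral => x _; rewrite patchE /f0 !indicE !mem_setE /= !in_itv /= andbT.
  have [yx|yx] := leP y x; last by rewrite mulr0.
  rewrite (lt_le_trans ay yx) /= mulr1.
  by case: ifPn; rewrite ?mulr1 ?mulr0.
rewrite Rintegral_mkcond [RHS]Rintegral_mkcond.
rewrite (_ : (_ \_ _) = fun x => \int[mu]_y h (x, y)); last first.
  apply/funext => x; rewrite E1 patchE /f0 indicE.
  by case: ifPn; rewrite ?mulr1 ?mulr0 ?mul0r.
rewrite [in RHS](_ : (_ \_ _) = fun y => \int[mu]_x h (x, y)); last first.
  apply/funext => x; rewrite E2 patchE /g0 indicE.
  by case: ifPn; rewrite ?mulr1 ?mulr0 ?mul0r.
by rewrite (RFubini12 hi).2 (RFubini21 hi).2.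
Qed.

(** The densities are only integrable, so Fubini's theorem on a triangle replaces the product rule.
    The zeros of [F] at both ends remove the boundary terms and the contribution of the constant
    [G a]. *)
Lemma primitive_ibp F f G g a b : locally_integrable setT f ->
  locally_integrable setT g -> primitive_of F f -> primitive_of G g ->
  a <= b -> F a = 0 -> F b = 0 ->
  \int[mu]_(x in `]a, b]) (f x * G x) = - \int[mu]_(x in `]a, b]) (g x * F x).
Proof.
move=> lf lg Ff Gg ab Fa Fb.
have iab h : locally_integrable setT h -> mu.-integrable `]a, b] (EFin \o h).
  by move=> lh; apply: (@locint_itv _ h `]a, b] a b) => //; exact: subset_itv_oc_cc.
have cG := primitive_of_continuous lg Gg.
have cF := primitive_of_continuous lf Ff.
have mab : measurable (`]a, b]%classic : set (measurableTypeR R)) by exact: measurable_itv.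
have icont h H : locally_integrable setT h -> continuous H ->
    mu.-integrable `]a, b] (EFin \o (fun x => h x * H x)).
  move=> lh cH.
  have : compact (H @` `[a, b]).
    by apply: continuous_compact; [exact: continuous_subspaceT|exact: segment_compact].
  move=> /compact_itv[C C0 HC].
  have iCh : mu.-integrable `]a, b] (EFin \o (fun x => C * `|h x|)).
    have := @integrableZl _ _ R mu _ mab C _ (integrable_norm (iab _ lh)).
    by congr integrable.
  apply: (integrable_le mab _ iCh).
    apply: measurable_funM; first exact: (integrable_meas (iab _ lh)).
    by apply: measurable_funTS; exact: continuous_measurable_fun.
  move=> x; rewrite /= in_itv /= => /andP[ax xb].
  rewrite normrM mulrC ler_wpM2r// ler_norml.
  by have := HC (H x); rewrite /= in_itv /=; apply; exists x => //=; rewrite in_itv /= (ltW ax).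
have -> : \int[mu]_(x in `]a, b]) (f x * G x) =
    \int[mu]_(x in `]a, b]) (G a * f x + f x * \int[mu]_(y in `]a, x]) g y).
  apply: eq_Rintegral => x; rewrite inE /= in_itv /= => /andP[/ltW ax _].
  by rewrite -(Gg _ _ ax); ring.
have -> : - (\int[mu]_(x in `]a, b]) (g x * F x)) =
    \int[mu]_(y in `]a, b]) (g y * \int[mu]_(x in `]y, b]) f x).
  rewrite -mulN1r -RintegralZl//; last exact: icont.
  apply: eq_Rintegral => x; rewrite inE /= in_itv /= => /andP[_ xb].
  by rewrite -(Ff _ _ xb) Fb; ring.
rewrite -Fubini_triangle//; [|exact: iab|exact: iab].
rewrite RintegralD//.
- rewrite RintegralZl//; last exact: iab.
  by rewrite -(Ff _ _ ab) Fa Fb subrr mulr0 add0r.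
- have := @integrableZl _ _ R mu _ mab (G a) _ (iab _ lf).
  by congr integrable.
- apply: (@eq_integrable _ _ _ mu _ mab (EFin \o (fun x => f x * (G x - G a)))).
    move=> x; rewrite inE /= in_itv /= => /andP[/ltW ax _].
    by rewrite /= (Gg _ _ ax).
  apply: icont => // x; apply: cvgB; [exact: cG|exact: cvg_cst].
Qed.

Lemma smooth_primitive phi : smooth phi -> primitive_of phi (derive1 phi).
Proof.
move=> sp a b; rewrite le_eqVlt => /orP[/eqP ->|ab].
  by rewrite subrr set_itvoc0 Rintegral_set0.
have sd := smooth_derive sp.
rewrite Rintegral_itv_obnd_cbnd; last first.
  apply: (@locint_itv _ _ `]a, b] a b); last exact: subset_itv_oc_cc.
  exact/continuous_locint/smooth_continuous.
rewrite /Rintegral (@continuous_FTC2 _ _ phi)//.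
- exact/continuous_subspaceT/smooth_continuous.
- split; first by move=> x _; exact: smooth_derivable.
  + apply: cvg_at_right_filter; exact: (smooth_continuous sp).
  + apply: cvg_at_left_filter; exact: (smooth_continuous sp).
Qed.

(** Integration by parts against [phi] on an interval larger than its support, so that [phi]
    vanishes at both ends. *)
Lemma primitive_weak_derivative f g : locally_integrable setT g ->
  primitive_of f g -> weak_derivative 1 f g.
Proof.
move=> lg fg; have cf := primitive_of_continuous lg fg.
split => //; first exact: continuous_locint.
move=> phi tp; have /test_funP[sp [M M0 phi0]] := tp.
have /test_funP[sd _] := test_fun_derive tp.
have supp0 (h : R -> R) : (forall x, x < - M \/ M < x -> h x = 0) ->
    \int[mu]_x h x = \int[mu]_(x in `](- M - 1), (M + 1)]) h x.
  move=> h0; apply: Rintegral_supp => // x _ /negP.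
  by rewrite in_itv /= negb_and -leNgt -ltNge => /orP[?|?]; apply: h0; [left|right]; lra.
have dphi0 := derive1_supp phi0.
rewrite expr1 mulN1r [in LHS]supp0; last by move=> x /dphi0 /= ->; rewrite mulr0.
rewrite [in RHS]supp0; last by move=> x /phi0 ->; rewrite mulr0.
rewrite -(@primitive_ibp phi (derive1 phi) f g)//.
- by apply: eq_Rintegral => x _; rewrite mulrC.
- exact/continuous_locint/smooth_continuous.
- exact: smooth_primitive.
- by lra.
- by apply: phi0; left; lra.
- by apply: phi0; right; lra.
Qed.

End FundamentalLemma.

(** * The essential supremum *)

Section LinftyNorm.
Context d {X : measurableType d} {R : realType}.
Variable m : {measure set X -> \bar R}.
Implicit Types (D E : set X) (f g : X -> R).

Lemma Linfty_norm_ae D f :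
  {ae m, forall x, D x -> (`|f x|%:E <= Linfty_norm m D f)%E}.
Proof.
rewrite /Linfty_norm unlock; case: ifPn => [m0|].
  apply: filterS (ess_sup_ge m (abse \o (EFin \o (fun x => \1_D x * f x)))).
  move=> x /= h Dx; apply: le_trans h.
  by rewrite lee_fin indicE mem_set// mul1r.
(* On a space of measure zero the norm is 0 by convention, but every property then holds almost
   everywhere. *)
rewrite -leNgt measure_le0 => /eqP m0.
by exists setT; split => //.
Qed.

Lemma Linfty_norm_le D f (c : \bar R) : (0 <= c)%E ->
  {ae m, forall x, D x -> (`|f x|%:E <= c)%E} -> (Linfty_norm m D f <= c)%E.
Proof.
move=> c0 h; rewrite /Linfty_norm unlock; case: ifPn => // m0.
apply/ess_supP; apply: filterS h => x h /=.
rewrite indicE; case: (boolP (x \in D)) => [|_]; last by rewrite mul0r normr0.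
by rewrite inE => /h; rewrite mul1r.
Qed.

Lemma Linfty_norm_ge0 D f : (0 <= Linfty_norm m D f)%E.
Proof. exact: Lnorm_ge0. Qed.

Lemma Linfty_normS D E f g : D `<=` E ->
  {ae m, forall x, D x -> `|f x| <= `|g x|} ->
  (Linfty_norm m D f <= Linfty_norm m E g)%E.
Proof.
move=> DE fg; apply: Linfty_norm_le; first exact: Linfty_norm_ge0.
apply: filterS2 fg (Linfty_norm_ae E g) => x fg h Dx.
by apply: le_trans (h (DE _ Dx)); rewrite lee_fin fg.
Qed.

Lemma Linfty_norm_fin D f (c : R) : (Linfty_norm m D f <= c%:E)%E ->
  {ae m, forall x, D x -> `|f x| <= c}.
Proof.
move=> h; apply: filterS (Linfty_norm_ae D f) => x h' /h' h''.
by rewrite -lee_fin (le_trans h'').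
Qed.

Lemma le_Linfty_normD D f g (a b : R) : (Linfty_norm m D f <= a%:E)%E ->
  (Linfty_norm m D g <= b%:E)%E ->
  (Linfty_norm m D (fun x => f x + g x)%R <= (a + b)%:E)%E.
Proof.
move=> fa gb; have a0 : 0 <= a.
  by rewrite -lee_fin (le_trans (Linfty_norm_ge0 D f) fa).
have b0 : 0 <= b by rewrite -lee_fin (le_trans (Linfty_norm_ge0 D g) gb).
apply: Linfty_norm_le; first by rewrite lee_fin addr_ge0.
apply: filterS2 (Linfty_norm_fin fa) (Linfty_norm_fin gb) => x h1 h2 Dx.
by rewrite lee_fin (le_trans (ler_normD _ _))// lerD ?h1 ?h2.
Qed.

End LinftyNorm.

(** * Essential bounds on the line and their dependence on time *)

Section LinftyLine.
Context {R : realType}.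
Local Notation mu := (@lebesgue_measure R).
Implicit Types (f g phi : R -> R) (a b c e C M x : R) (I K : set R)
  (u v w : R -> R -> R) (T t : R).

Lemma ae_le0_open f I : open I -> {in I, continuous f} ->
  {ae mu, forall x, I x -> f x <= 0} -> forall x, I x -> f x <= 0.
Proof.
move=> oI cf [N [mN N0 hN]] x Ix; rewrite leNgt; apply/negP => fx.
have /nbhs_ballP[d /= d0 hd] : nbhs x I by exact: open_nbhs_nbhs.
have cfx : {for x, continuous f} by apply: cf; rewrite inE.
have /nbhs_ballP[e /= e0 he] : \forall y \near x, 0 < f y.
  move: cfx => /cvgrPdist_lt/(_ _ fx); apply: filterS => y.
  by rewrite ltr_distl => /andP[_ h]; lra.
have r0 : 0 < Num.min d e by rewrite lt_min d0.
have : (mu (ball x (Num.min d e)) <= mu N)%E.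
  apply: le_measure; rewrite ?inE//; first exact: measurable_ball.
  move=> y yb; apply: hN => /= h.
  have : 0 < f y by apply: he; apply: le_ball yb; rewrite ge_min lexx orbT.
  rewrite ltNge => /negP; apply; apply: h; apply: hd.
  by apply: le_ball yb; rewrite ge_min lexx.
rewrite N0 lebesgue_measure_ball ?(ltW r0)// lee_fin leNgt => /negP; apply.
by rewrite pmulrn_lgt0.
Qed.

Lemma ae_le_open f c I : open I -> continuous f ->
  {ae mu, forall x, I x -> `|f x| <= c} -> forall x, I x -> `|f x| <= c.
Proof.
move=> oI cf h x Ix; rewrite -subr_le0.
apply: (@ae_le0_open (fun y => `|f y| - c) I) => //.
  move=> y _; apply: cvgB; last exact: cvg_cst.
  by apply: cvg_norm; exact: cf.
by apply: aeS h => y h /h; rewrite subr_le0.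
Qed.

Lemma ae_eq_open f g I : open I -> {in I, continuous f} ->
  {in I, continuous g} -> {ae mu, forall x, I x -> f x = g x} ->
  forall x, I x -> f x = g x.
Proof.
move=> oI cf cg h x Ix; apply/eqP; rewrite -subr_eq0 -normr_le0.
apply: (@ae_le0_open (fun y => `|f y - g y|) I) => //.
  move=> y yI; apply: cvg_norm; apply: cvgB; [exact: cf|exact: cg].
by apply: aeS h => y h /h ->; rewrite subrr normr0.
Qed.

(** Near each time [t0] the norm exceeds its value at [t0] by at most 1, and compactness of [[a, b]]
    makes the bound uniform. The exceptional null set still depends on [t]. *)
Lemma C_Linfty_loc_bound J u a b K : C_Linfty_loc J u ->
  `[a, b] `<=` J -> compact K ->
  exists2 L : R, 0 <= L & forall t, a <= t <= b ->
    {ae mu, forall x, K x -> `|u t x| <= L}.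
Proof.
move=> [lu cu] abJ cK.
have /compact_near_coveringP := @segment_compact R a b.
move=> /(_ _ (pinfty_nbhs R) (fun i t => a <= t <= b ->
  (Linfty_norm mu K (u t) <= i%:E)%E)) [].
- move=> t0; rewrite /= in_itv /= => t0ab; have Jt0 : J t0 by apply: abJ; rewrite /= in_itv.
  have near1 : \forall t \near within J (nbhs t0),
      (Linfty_norm mu K (fun x => (u t x - u t0 x)%R) < 1%:E)%E.
    have nb : nbhs (0%E : \bar R) [set y | (y < 1%:E)%E].
      by apply: open_nbhs_nbhs; split; [exact: open_ereal_lt_ereal|rewrite /= lte_fin].
    exact: (cu K cK t0 Jt0 _ nb).
  have [l hl] : exists l : R, (Linfty_norm mu K (u t0) <= l%:E)%E.
    have [_ /(_ K cK)] := lu _ Jt0; have := Linfty_norm_ge0 mu K (u t0).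
    by case: (Linfty_norm _ _ _) => // l _ _; exists l.
  rewrite /prop_near1/= /within /= in near1.
  exists ([set t | J t -> (Linfty_norm mu K (fun x => (u t x - u t0 x)%R) < 1%:E)%E],
    [set i | 1 + l <= i]); first split => //.
    by exists (1 + l); split => [|i]; [exact: num_real|exact: ltW].
  move=> [t i] /= [h li] tab; apply: le_trans (_ : (1 + l)%:E <= _)%E; last by rewrite lee_fin.
  have -> : u t = fun x => (u t x - u t0 x) + u t0 x by apply/funext => x; rewrite subrK.
  apply: le_Linfty_normD hl; apply/ltW/h.
  by apply: abJ; rewrite /= in_itv.
- move=> M [_ hM]; exists (Num.max 0 (M + 1)); first by rewrite le_max lexx.
  move=> t tab; apply: Linfty_norm_fin.
  apply: (le_trans (hM (M + 1) _ t _ tab)); [by rewrite ltrDl|by rewrite /= in_itv|].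
  by rewrite lee_fin le_max lexx orbT.
Qed.

(** For c >= 0 the norm exceeds c exactly when the section at [t] of the set |w| > c has positive
    measure, and the measure of sections is a measurable function of [t]. *)
Lemma Linfty_norm_measurable (J : set R) w : measurable J ->
  measurable_fun (J `*` setT) (fun p : R * R => w p.1 p.2) ->
  measurable_fun J (fun t => Linfty_norm mu setT (w t)).
Proof.
move=> mJ mw; apply: (measurability _ (ErealGenOInfty.measurableE R)) => // _ [_ [c ->] <-].
have [c0|c0] := ltP c 0.
  rewrite (_ : J `&` _ = J)//; apply/seteqP; split => [t []//|t Jt]; split => //=.
  by rewrite in_itv /= andbT (lt_le_trans _ (Linfty_norm_ge0 _ _ _))// lte_fin.
pose A : set (R * R) := (J `*` setT) `&` [set p | c < `|w p.1 p.2|].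
have mA : measurable A.
  have mJT : measurable (J `*` setT : set (R * R)) by exact: measurableX.
  have /(_ mJT `]c, +oo[%classic (measurable_itv _)) :
    measurable_fun (J `*` setT) (fun p : R * R => `|w p.1 p.2|).
    exact: measurableT_comp.
  by congr measurable; apply/seteqP; split => p /= []; rewrite ?in_itv /= ?andbT.
have mxs := @measurable_fun_xsection _ _ _ _ R mu A mA.
rewrite (_ : J `&` _ = J `&` [set t | (0 < (mu \o xsection A) t)%E]).
  by apply: emeasurable_fun_o_infty => //; exact: measurable_funTS.
apply/seteqP; split => t /= [Jt]; rewrite ?in_itv /= ?andbT => h; split => //.
- rewrite lt0e measure_ge0 andbT; apply/negP => /eqP A0.
  move: h; rewrite ltNge => /negP; apply.
  apply: Linfty_norm_le; first by rewrite lee_fin.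
  exists (xsection A t); split => //.
    exact: measurable_xsection.
  move=> x /= hx; rewrite /xsection /= inE /A; split; first by split.
  rewrite /= ltNge; apply/negP => hc; apply: hx => _.
  by rewrite lee_fin.
- rewrite ltNge; apply/negP => h'; move: h; rewrite lt_neqAle eq_sym => /andP[/eqP + _].
  apply; have [N [mN N0 hN]] := Linfty_norm_fin h'.
  apply: (@subset_measure0 _ _ _ mu _ N) => //; first exact: measurable_xsection.
  move=> x; rewrite /xsection /= inE => -[_ /= cx]; apply: hN => /= h.
  by have := h Logic.I; rewrite leNgt cx.
Qed.

End LinftyLine.

(** * Test functions of two variables *)

Section ClassC.
Context {R : realType}.
Implicit Types (f g chi phi eta : R -> R) (psi u v w : R -> R -> R)
  (a b c M x t T : R) (n : nat).

Lemma class_C_continuous n psi : class_C n psi ->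
  continuous (fun p : R * R => psi p.1 p.2).
Proof. by case: n => [|n] []. Qed.

Lemma class_C_mono n psi : class_C n.+1 psi -> class_C n psi.
Proof.
elim: n psi => [|n IH] psi; first by move=> [].
move=> [cpsi [dt dx pt px]]; split; first exact: cpsi.
by split; [exact: dt|exact: dx|exact: IH pt|exact: IH px].
Qed.

Lemma class_C_add n u v : class_C n u -> class_C n v ->
  class_C n (fun t x => u t x + v t x).
Proof.
elim: n u v => [|n IH] u v [cu hu] [cv hv]; split => //;
  try by move=> p; apply: cvgD; [exact: cu|exact: cv].
case: hu => ut ux put pux; case: hv => vt vx pvt pvx.
split.
- by move=> t x; exact: derivableD (ut t x) (vt t x).
- by move=> t x; exact: derivableD (ux t x) (vx t x).
- have -> : partial_t (fun t x => u t x + v t x) =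
      fun t x => partial_t u t x + partial_t v t x.
    apply/funext => t; apply/funext => x; rewrite /partial_t !derive1E.
    exact: deriveD (ut t x) (vt t x).
  exact: IH.
- have -> : partial_x (fun t x => u t x + v t x) =
      fun t x => partial_x u t x + partial_x v t x.
    apply/funext => t; apply/funext => x; rewrite /partial_x !derive1E.
    exact: deriveD (ux t x) (vx t x).
  exact: IH.
Qed.

Lemma class_C_mul n u v : class_C n u -> class_C n v ->
  class_C n (fun t x => u t x * v t x).
Proof.
elim: n u v => [|n IH] u v Cu Cv.
  case: Cu => cu _; case: Cv => cv _; split => // p.
  by apply: cvgM; [exact: cu|exact: cv].
have Cu' := class_C_mono Cu; have Cv' := class_C_mono Cv.
case: Cu => cu [ut ux put pux]; case: Cv => cv [vt vx pvt pvx].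
split; first by move=> p; apply: cvgM; [exact: cu|exact: cv].
split.
- by move=> t x; exact: derivableM (ut t x) (vt t x).
- by move=> t x; exact: derivableM (ux t x) (vx t x).
- have -> : partial_t (fun t x => u t x * v t x) =
      fun t x => u t x * partial_t v t x + v t x * partial_t u t x.
    apply/funext => t; apply/funext => x; rewrite /partial_t !derive1E.
    exact: deriveM (ut t x) (vt t x).
  by apply: class_C_add; exact: IH.
- have -> : partial_x (fun t x => u t x * v t x) =
      fun t x => u t x * partial_x v t x + v t x * partial_x u t x.
    apply/funext => t; apply/funext => x; rewrite /partial_x !derive1E.
    exact: deriveM (ux t x) (vx t x).
  by apply: class_C_add; exact: IH.
Qed.

Lemma class_C_space n chi : smooth chi -> class_C n (fun _ x => chi x).
Proof.
elim: n chi => [|n IH] chi sc; split => //;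
  try by move=> p; apply: continuous_comp; [exact: cvg_snd|exact: smooth_continuous].
split.
- by move=> t x; exact: derivable_cst.
- by move=> t x; exact: smooth_derivable.
- have -> : partial_t (fun _ x => chi x) = fun _ _ => 0.
    by apply/funext => t; apply/funext => x; rewrite /partial_t derive1E derive_cst.
  exact: (IH _ (smooth_cst 0)).
- exact: IH (smooth_derive sc).
Qed.

Lemma class_C_time n eta : smooth eta -> class_C n (fun t _ => eta t).
Proof.
elim: n eta => [|n IH] eta se; split => //;
  try by move=> p; apply: continuous_comp; [exact: cvg_fst|exact: smooth_continuous].
split.
- by move=> t x; exact: smooth_derivable.
- by move=> t x; exact: derivable_cst.
- exact: IH (smooth_derive se).
- have -> : partial_x (fun t _ => eta t) = fun _ _ => 0.
    by apply/funext => t; apply/funext => x; rewrite /partial_x derive1E derive_cst.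
  exact: (IH _ (smooth_cst 0)).
Qed.

Lemma class_C_smooth psi : (forall n, class_C n psi) -> forall t, smooth (psi t).
Proof.
move=> Cpsi t; apply: (@smooth_coind _ (fun f => exists2 v,
  forall n, class_C n v & f = v t)); last by exists psi.
move=> _ [v Cv ->]; split.
  by move=> x; have [_ [_ + _ _]] := Cv 1%N.
by exists (partial_x v) => // n; have [_ [_ _ _]] := Cv n.+1.
Qed.

Lemma test_fun_txM T chi psi : smooth chi -> test_fun_tx T psi ->
  test_fun_tx T (fun t x => chi x * psi t x).
Proof.
move=> sc [Cpsi [K [cK KT K0]]]; split.
  by move=> n; apply: class_C_mul => //; exact: class_C_space.
by exists K; split => // t x tT nK; rewrite K0 ?mulr0.
Qed.

Lemma test_fun_tx_tensor T a eta phi : smooth eta -> test_fun phi -> a < T ->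
  (forall t, a < t -> eta t = 0) ->
  test_fun_tx T (fun t x => eta t * phi x).
Proof.
move=> se tp aT eta0; have /test_funP[sp [M M0 phi0]] := tp; split.
  move=> n; apply: class_C_mul; first exact: class_C_time.
  exact: class_C_space.
exists (`[0, a] `*` `[- M, M]); split.
- by apply: compact_setX; exact: segment_compact.
- move=> [t x] [/=]; rewrite !in_itv /= => /andP[t0 ta] _; split => //.
  by rewrite t0 (le_lt_trans ta).
- move=> t x /andP[t0 tT] nK; have [ta|ta] := leP t a; last by rewrite eta0 ?mul0r.
  rewrite phi0 ?mulr0//; apply: contrapT => /not_orP[/negP xM /negP Mx].
  by apply: nK; split; rewrite /= in_itv /= ?t0// !leNgt xM.
Qed.

(** Compactness leaves a gap between the support and the time [T]. This is why regularity on the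
    strips [[0, a]] with a < T is enough, although the weak identity concerns all of [[0, T[]. *)
Lemma test_fun_tx_supp T psi : 0 < T -> test_fun_tx T psi ->
  exists a M, [/\ 0 < a, a < T, 0 < M & forall t x, 0 <= t < T ->
    a < t \/ x < - M \/ M < x -> psi t x = 0].
Proof.
move=> T0 [_ [K [cK KT K0]]].
have cK2 : compact (snd @` K).
  by apply: continuous_compact => //; apply: continuous_subspaceT => p; exact: cvg_snd.
have [M M0 KM] := compact_itv cK2.
have nearK : \forall a \near T^'-, K `<=` (fun p => p.1 < a).
  have /compact_near_coveringP/(_ _ (T^'-) (fun a p => p.1 < a)) := cK.
  apply => p /KT [/=]; rewrite in_itv /= => /andP[p0 pT] _.
  have pm : p.1 < (p.1 + T) / 2 by lra.
  have mT : (p.1 + T) / 2 < T by lra.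
  exists ([set q | q.1 < (p.1 + T) / 2], [set a | (p.1 + T) / 2 < a]); first split.
  - exact: (@cvg_fst _ _ (nbhs p.1) (nbhs p.2) _ _ (lt_nbhsl pm)).
  - exact: nbhs_left_gt.
  - by move=> [q a] /= [q1 a1]; exact: lt_trans a1.
have [a [a0 aT aK]] : exists a, [/\ 0 < a, a < T & K `<=` (fun p => p.1 < a)].
  have : \forall a \near T^'-, [/\ 0 < a, a < T & K `<=` (fun p => p.1 < a)].
    near=> a; split; near: a; [exact: nbhs_left_gt|exact: nbhs_left_lt|exact: nearK].
  by move=> /filter_ex.
exists a, M; split => // t x tT H; apply: K0 => // Ktx.
case: H => [|]; first by have /= := aK _ Ktx; move=> /lt_trans h /h; rewrite ltxx.
have : `[- M, M]%classic x by apply: KM; exists (t, x).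
by rewrite /= in_itv /= => /andP[h1 h2] [|]; rewrite ltNge ?h1 ?h2.
Unshelve. all: by end_near. Qed.

(* A Caratheodory function is the limit of its discretisations in time. *)
Lemma caratheodory_measurable u : (forall t, measurable_fun setT (u t)) ->
  (forall x, continuous (u ^~ x)) ->
  measurable_fun setT (fun p : R * R => u p.1 p.2).
Proof.
move=> mu_ cu.
pose grid (k : nat) (t : R) : R := (Num.floor (k.+1%:R * t))%:~R / k.+1%:R.
have grid_near (k : nat) (t : R) : `|t - grid k t| <= k.+1%:R^-1.
  have k0 : 0 < k.+1%:R :> R by [].
  have /andP[h1 h2] := floor_itv (k.+1%:R * t).
  rewrite -(ler_pM2l k0) -[X in X * _](gtr0_norm k0) -normrM mulfV ?gt_eqF//.
  rewrite mulrBr /grid mulrCA mulfV ?gt_eqF// mulr1 ger0_norm ?subr_ge0//.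
  by rewrite lerBlDl; move: h2; rewrite intrD => /ltW.
apply: (@measurable_fun_cvg _ _ _ setT (fun k p => u (grid k p.1) p.2)).
- move=> k _ B mB; rewrite setTI.
  rewrite [X in measurable X](_ : _ = \bigcup_(z : int)
    ([set t | Num.floor (k.+1%:R * t) = z] `*`
       (u (z%:~R / k.+1%:R) @^-1` B))); last first.
    apply/seteqP; split=> [[t x] /= Bu|[t x] [z _ [/= <-]]//].
    by exists (Num.floor (k.+1%:R * t)).
  apply: countable_bigcupT_measurable; first exact: countableP.
  move=> z; apply: measurableX; last by rewrite -[X in measurable X]setTI; exact: mu_.
  have -> : [set t : R | Num.floor (k.+1%:R * t) = z] =
      `[z%:~R / k.+1%:R, (z + 1)%:~R / k.+1%:R[%classic.
    apply/seteqP; split => t /=; rewrite in_itv /= ler_pdivrMr// ltr_pdivlMr//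
      [t * _]mulrC.
      by move=> /eqP; rewrite floor_eq.
    by move=> h; apply/eqP; rewrite floor_eq.
  exact: measurable_itv.
- move=> [t x] _ /=.
  apply: (@cvg_comp _ _ _ (fun k => grid k t) (u ^~ x) _ (nbhs t)); last exact: cu.
  apply/cvgrPdist_le => e e0; near=> k.
  apply: le_trans (grid_near k t) _; apply: ltW; near: k.
  exact: near_infty_natSinv_lt (PosNum e0).
Unshelve. all: by end_near. Qed.

Lemma class_C_measurable n psi : class_C n psi ->
  measurable_fun setT (fun p : R * R => psi p.1 p.2).
Proof.
move=> /class_C_continuous cpsi; apply: caratheodory_measurable => [t|x].
  apply: continuous_measurable_fun => x.
  apply: (@continuous_comp _ _ _ (fun x => (t, x)) (fun p => psi p.1 p.2)).
    exact: (cvg_pair (cvg_cst t) (@cvg_id _ (nbhs x))).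
  exact: cpsi.
move=> t; apply: (@continuous_comp _ _ _ (fun t => (t, x)) (fun p => psi p.1 p.2)).
  exact: (cvg_pair (@cvg_id _ (nbhs t)) (cvg_cst x)).
exact: cpsi.
Qed.

Lemma class_C_bounded n psi a M : class_C n psi ->
  exists2 C, 0 <= C & forall t x, 0 <= t <= a -> - M <= x <= M -> `|psi t x| <= C.
Proof.
move=> /class_C_continuous cpsi.
have cK : compact (`[0, a] `*` `[- M, M] : set (R * R)).
  by apply: compact_setX; exact: segment_compact.
have : compact ((fun p : R * R => psi p.1 p.2) @` (`[0, a] `*` `[- M, M])).
  by apply: continuous_compact => //; exact: continuous_subspaceT.
move=> /compact_itv[C C0 hC]; exists C; first exact: ltW.
move=> t x ta xM; rewrite ler_norml; have := hC (psi t x).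
by rewrite /= in_itv /=; apply; exists (t, x).
Qed.

End ClassC.

(** * Integrals over the product, slice by slice *)

Section Slices.
Context d1 d2 {X : measurableType d1} {Y : measurableType d2} {R : realType}.
Variables (m1 : {sigma_finite_measure set X -> \bar R})
  (m2 : {sigma_finite_measure set Y -> \bar R}).
Implicit Types f g : X * Y -> R.

Lemma measurable_slice f x : measurable_fun setT f ->
  measurable_fun setT (fun y => f (x, y)).
Proof. by move=> mf; apply: (measurableT_comp mf). Qed.

(** The bounds at hand hold for almost every slice, almost everywhere on it. Tonelli's theorem uses
    them in that form, so no almost everywhere statement on the product has to be derived. *)
Lemma integrable_slices f g : measurable_fun setT f ->
  (m1 \x m2)%E.-integrable setT (EFin \o g) ->
  {ae m1, forall x, {ae m2, forall y, `|f (x, y)| <= g (x, y)}} ->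
  (m1 \x m2)%E.-integrable setT (EFin \o f).
Proof.
move=> mf gi fg.
have mEf : measurable_fun setT (EFin \o f) by exact/measurable_EFinP.
have mg : measurable_fun setT (EFin \o g) by have /integrableP[] := gi.
have meas_slice (h : X * Y -> \bar R) : measurable_fun setT h ->
    measurable_fun setT (fun x => \int[m2]_y `|h (x, y)|)%E.
  move=> mh; apply: (measurable_fun_fubini_tonelli_F (abse \o h)) => //=.
  exact: measurableT_comp.
apply/(integrable12ltyP m1 m2 mEf); have /(integrable12ltyP m1 m2 mg) := gi.
apply: le_lt_trans; apply: ae_ge0_le_integral => //.
- by move=> x _; exact: integral_ge0.
- exact: meas_slice.
- by move=> x _; exact: integral_ge0.
- exact: meas_slice.
apply: filterS fg => x fgx _; apply: ae_ge0_le_integral => //.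
- by apply: measurableT_comp => //; exact: (measurableT_comp mEf).
- by apply: measurableT_comp => //; exact: (measurableT_comp mg).
by apply: filterS fgx => y h _ /=; rewrite lee_fin (le_trans h)// ler_norm.
Qed.

Lemma eq_slices f g : (m1 \x m2)%E.-integrable setT (EFin \o f) ->
  (m1 \x m2)%E.-integrable setT (EFin \o g) ->
  {ae m1, forall x, \int[m2]_y f (x, y) = \int[m2]_y g (x, y)} ->
  \int[(m1 \x m2)%E]_p f p = \int[(m1 \x m2)%E]_p g p.
Proof.
move=> fi gi fg; have [ifx <-] := RFubini12 fi; have [igx <-] := RFubini12 gi.
apply: ae_eq_Rintegral => //; [exact: integrable_meas ifx|exact: integrable_meas igx|].
by apply: filterS fg => x ->.
Qed.

End Slices.

(** * The weak identity in terms of the second derivative *)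

Section Regularity.
Context {R : realType}.
Local Notation mu := (@lebesgue_measure R).
Local Notation mu2 := (mu \x mu)%E.
Implicit Types (f g chi phi : R -> R) (psi u v w z : R -> R -> R) (k : R -> R)
  (a b c M x t : R).

Lemma smooth_locint_mul chi f : smooth chi -> locally_integrable setT f ->
  locally_integrable setT (fun x => chi x * f x).
Proof.
move=> sc lf; have [mf _ lfK] := lf; split; [|exact: openT|].
  by apply: measurable_funM => //; exact: smooth_measurable.
move=> K _ cK; have [M M0 KM] := compact_itv cK.
have : compact (chi @` K).
  by apply: continuous_compact => //; apply: continuous_subspaceT; exact: smooth_continuous.
move=> /compact_itv[C C0 hC].
have mK : measurable (K : set (measurableTypeR R)) by exact: compact_measurable.
have fK : mu.-integrable K (EFin \o f).
  apply/integrableP; split; last exact: lfK.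
  by apply/measurable_EFinP; exact: measurable_funTS.
have CfK : mu.-integrable K (EFin \o (fun x => C * `|f x|)).
  have := @integrableZl _ _ R mu _ mK C _ (integrable_norm fK).
  by congr integrable.
have /integrableP[_] : mu.-integrable K (EFin \o (fun x => chi x * f x)).
  apply: (integrable_le mK _ CfK).
    apply: measurable_funTS; apply: measurable_funM => //.
    exact: smooth_measurable.
  move=> x Kx; rewrite normrM ler_wpM2r// ler_norml.
  by have := hC (chi x); rewrite /= in_itv /=; apply; exists x.
exact.
Qed.

Lemma test_funM chi phi : smooth chi -> test_fun phi ->
  test_fun (fun x => chi x * phi x).
Proof.
move=> sc /test_funP[sp [M M0 phi0]]; apply/test_funP; split.
  exact: smoothM.
by exists M => // x /phi0 ->; rewrite mulr0.
Qed.

Lemma weak_derivative_smoothM chi f g : smooth chi -> weak_derivative 1 f g ->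
  weak_derivative 1 (fun x => chi x * f x)
    (fun x => derive1 chi x * f x + chi x * g x).
Proof.
move=> sc [lf lg fg]; have sc' := smooth_derive sc.
have l1 := smooth_locint_mul sc' lf; have l2 := smooth_locint_mul sc lg.
split; [exact: smooth_locint_mul|exact: locally_integrableD|].
move=> phi tp; have tcp := test_funM sc tp; have tcp' := test_funM sc' tp.
have /test_funP[sp _] := tp.
have := fg _ tcp; rewrite expr1 !mulN1r /= => H.
have dE x : derive1 (fun x => chi x * phi x) x =
    chi x * derive1 phi x + phi x * derive1 chi x.
  have dm := is_derive_mul (smooth_is_derive sc x) (smooth_is_derive sp x).
  by rewrite derive1E; exact: derive_val.
have -> : \int[mu]_x (chi x * f x * derive1 phi x) =
    \int[mu]_x (f x * derive1 (fun x => chi x * phi x) x -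
       f x * (derive1 chi x * phi x)).
  by apply: eq_Rintegral => x _; rewrite dE; ring.
rewrite RintegralB//; last first.
- exact: locint_test.
- by apply: locint_test => //; exact: test_fun_derive.
rewrite H -opprD -RintegralD//; last first.
- exact: locint_test.
- exact: locint_test.
by congr (- _); apply: eq_Rintegral => x _; ring.
Qed.

(** The first identity, tested with the derivative of [phi], is compared with the second one tested
    with [phi]. *)
Lemma weak_derivative_second f (v w : R -> R) : weak_derivative 1 f v ->
  weak_derivative 2 f w -> weak_derivative 1 v w.
Proof.
move=> [lf lv fv] [_ lw fw]; split => // phi tp.
have := fv _ (test_fun_derive tp); have := fw _ tp.
rewrite expr1 !mulN1r sqrrN expr1n mul1r -!derive1Sn /= => -> H.
by rewrite H opprK.
Qed.

(** The derivative [v] has a continuous version [V] with density [w], and [psi f] is a primitive of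
    [z] that vanishes at the ends of an interval slightly larger than [[-M, M]]. The claim is
    integration by parts between these two; elsewhere [z] is 0 almost everywhere, since [psi] and
    its derivative vanish. *)
Lemma energy_slice M f (v w psi z : R -> R) : smooth psi ->
  (forall x, x < - M \/ M < x -> psi x = 0) -> 0 < M ->
  continuous f -> weak_derivative 1 f v -> weak_derivative 2 f w ->
  weak_derivative 1 (fun x => psi x * f x) z ->
  \int[mu]_x (z x * v x) = - \int[mu]_x (psi x * f x * w x).
Proof.
move=> sp psi0 M0 cf fv fw fz.
have [lf lv _] := fv; have [_ lw _] := fw; have [_ lz _] := fz.
have [V [Vw vV]] := weak_derivative_ae_primitive (weak_derivative_second fv fw).
have cV := primitive_of_continuous lw Vw.
have cpf : continuous (fun x => psi x * f x).
  by move=> x; apply: cvgM; [exact: smooth_continuous|exact: cf].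
have Fz := weak_derivative_primitive cpf fz.
have z_ae := weak_derivative1_unique fz (weak_derivative_smoothM sp fv).
have dpsi0 x : x < - M \/ M < x -> derive1 psi x = 0.
  exact: derive1_supp psi0 x.
pose E : set R := `](- M - 1), (M + 1)]%classic.
have mE : measurable (E : set (measurableTypeR R)) by exact: measurable_itv.
have Enot x : ~ E x -> x < - M \/ M < x.
  move=> /negP; rewrite in_itv /= negb_and -leNgt -ltNge => /orP[?|?]; [left|right]; lra.
have mz : measurable_fun setT z by case: lz.
have mv : measurable_fun setT v by case: lv.
have mV : measurable_fun setT V by exact: continuous_measurable_fun.
transitivity (\int[mu]_x ((z x * V x) * \1_E x)).
  apply: ae_eq_Rintegral => //.
  - exact: measurable_funM.
  - by apply: measurable_funM; [exact: measurable_funM|exact: measurable_indic].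
  - apply: aeS2 vV z_ae => x -> zx _; rewrite indicE.
    have [|/negP] := boolP (x \in E); first by rewrite mulr1.
    rewrite inE => /Enot xM; rewrite zx psi0// dpsi0//.
    by rewrite !(mul0r, addr0).
transitivity (\int[mu]_(x in E) (z x * V x)).
  rewrite [RHS]Rintegral_mkcond; apply: eq_Rintegral => x _.
  by rewrite patchE indicE; case: ifPn; rewrite ?mulr1 ?mulr0.
rewrite (@primitive_ibp _ (fun x => psi x * f x) z V w)//; last first.
- by rewrite psi0 ?mul0r//; right; lra.
- by rewrite psi0 ?mul0r//; left; lra.
- lra.
congr (- _); rewrite [RHS](@Rintegral_supp _ _ _ mu setT E)//; last first.
  by move=> x _ /Enot xM; rewrite psi0// !mul0r.
by apply: eq_Rintegral => x _; rewrite mulrC.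
Qed.

(* What is used of a function with [\partial_x^2 u] in [L^1([0, a]; L^oo)]: [v]
   and [w] represent its first two derivatives, and [k t] bounds [w t]. *)
Record regular a u v w k : Prop := Regular {
  regular_continuous : forall t, 0 <= t <= a -> continuous (u t);
  regular_measurable :
    measurable_fun (`[0, a] `*` setT) (fun p : R * R => u p.1 p.2);
  regular_measurable_dxx :
    measurable_fun (`[0, a] `*` setT) (fun p : R * R => w p.1 p.2);
  regular_dx : forall t, 0 <= t <= a -> weak_derivative 1 (u t) (v t);
  regular_bound : forall M, exists2 C, 0 <= C & forall t, 0 <= t <= a ->
    (forall x, - M <= x <= M -> `|u t x| <= C) /\
    {ae mu, forall x, - M <= x <= M -> `|v t x| <= C};
  regular_integrable : mu.-integrable `[0, a] (EFin \o k);
  regular_ge0 : forall t, 0 <= k t;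
  regular_dxx : {ae mu, forall t, 0 <= t <= a ->
    weak_derivative 2 (u t) (w t) /\ {ae mu, forall x, `|w t x| <= k t}} }.

(** With [u] factored out, the density vanishes wherever [u] does, for any value of [w]. *)
Definition density psi u w (p : R * R) : R :=
  u p.1 p.2 * (partial_t psi p.1 p.2 + 2^-1 * (psi p.1 p.2 * w p.1 p.2)).

(** A dominating function on [[0, a] x [-M, M]]: the 1 accounts for bounded terms, [k] for the term
    containing [w]. Being a product of functions of one variable, it is integrable at once. *)
Definition envelope a M C k (p : R * R) : R :=
  (C * (1 + k p.1) * \1_(`[0, a]%classic) p.1) * \1_(`[- M, M]%classic) p.2.

Lemma envelope_integrable a M C k : mu.-integrable `[0, a] (EFin \o k) ->
  mu2.-integrable setT (EFin \o envelope a M C k).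
Proof.
move=> ki.
have mi b c : measurable (`[b, c]%classic : set (measurableTypeR R)) by exact: measurable_itv.
have itv_fin b c : (mu `[b, c]%classic < +oo)%E.
  by rewrite lebesgue_measure_itv /=; case: ifP => // _; rewrite -EFinD ltry.
apply: (@integrable_prodM _ (fun t => C * (1 + k t) * \1_(`[0, a]%classic) t) \1_(`[- M, M]%classic)).
  have i1 : mu.-integrable `[0, a] (EFin \o (fun t => C * (1 + k t))).
    have i0 : mu.-integrable `[0, a] (EFin \o (fun t => 1 + k t)).
      have c1 : mu.-integrable `[0, a] (EFin \o (cst (1:R))).
        apply: measurable_bounded_integrable => //; first exact: itv_fin.
        by exists 1; split => // x x1 y _ /=; rewrite normr1 ltW.
      have := integrableD (mi _ _) c1 ki; by congr integrable.
    have := @integrableZl _ _ R mu _ (mi 0 a) C _ i0; by congr integrable.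
  have /(@integrable_mkcond _ _ R mu _ _ (mi 0 a)) := i1.
  congr integrable; apply/funext => x; rewrite /= patchE indicE.
  by case: ifPn; rewrite ?mulr1 ?mulr0.
have c1 : mu.-integrable `[- M, M] (EFin \o (cst (1:R))).
  apply: measurable_bounded_integrable => //; first exact: itv_fin.
  by exists 1; split => // x x1 y _ /=; rewrite normr1 ltW.
have /(@integrable_mkcond _ _ R mu _ _ (mi (- M) M)) := c1.
congr integrable; apply/funext => x; rewrite /= patchE indicE /=.
by case: ifPn.
Qed.

End Regularity.

(** * Integration by parts in the weak identity *)

Section Energy.
Context {R : realType}.
Local Notation mu := (@lebesgue_measure R).
Local Notation mu2 := (mu \x mu)%E.
Implicit Types (f : R -> R) (psi u v w z : R -> R -> R) (k : R -> R)
  (a c M x t T : R) (n : nat).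

Lemma ae_neq c : {ae mu, forall t, t != c}.
Proof.
exists [set c]; split => //; first exact: lebesgue_measure_set1.
by move=> t /= /negP; rewrite negbK => /eqP.
Qed.

(** The time derivative is two-sided, while nothing is assumed on [psi] at negative times; hence
    [t = 0] is left out here, and later discarded as a null set by [ae_neq]. *)
Lemma partial_t_supp T psi a M : (forall t x, 0 <= t < T ->
    a < t \/ x < - M \/ M < x -> psi t x = 0) ->
  forall t x, 0 < t < T -> a < t \/ x < - M \/ M < x -> partial_t psi t x = 0.
Proof.
move=> psi0 t x /andP[t0 tT] H; rewrite /partial_t derive1E; apply: derive_val.
have : is_derive t 1 (cst 0 : R -> R) 0 by exact: is_derive_cst.
apply: near_eq_is_derive; have sT : \forall s \near t, 0 <= s < T.
  near=> s; apply/andP; split; first by apply/ltW; near: s; exact: lt_nbhsr.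
  by near: s; exact: lt_nbhsl.
case: H => [at_|H]; last by apply: filterS sT => s sT; rewrite psi0//; right.
have as_ : \forall s \near t, a < s by exact: lt_nbhsr.
by apply: filterS2 sT as_ => s sT as_; rewrite psi0//; left.
Unshelve. all: by end_near. Qed.

Section identity.
Variables (T a M : R) (u v0 w : R -> R -> R) (k : R -> R) (psi : R -> R -> R).
Hypotheses (aT : a < T) (M0 : 0 < M).
Hypothesis reg : regular a u v0 w k.
Hypothesis Cpsi : forall n, class_C n psi.
Hypothesis psi0 : forall t x, 0 <= t < T ->
  a < t \/ x < - M \/ M < x -> psi t x = 0.

Let D1 : set (R * R) := `[0, a] `*` setT.
Let D : set (R * R) := `[0, T[ `*` setT.
Let mD1 : measurable D1.
Proof. by apply: measurableX => //; exact: measurable_itv. Qed.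
Let mD : measurable D.
Proof. by apply: measurableX => //; exact: measurable_itv. Qed.

Let psi_t0 := partial_t_supp psi0.

Lemma density_integrable :
  mu2.-integrable setT (EFin \o (density psi u w \_ D1)).
Proof.
have [C0 C00 hC0] := regular_bound reg M.
have [C1 C10 hC1] := class_C_bounded a M (Cpsi 0).
have [C2 C20 hC2] : exists2 C, 0 <= C & forall t x,
    0 <= t <= a -> - M <= x <= M -> `|partial_t psi t x| <= C.
  by apply: (@class_C_bounded _ 0); have [_ [_ _ + _]] := Cpsi 1.
have ki := regular_integrable reg; have k0 := regular_ge0 reg.
have mpt : measurable_fun setT (fun p : R * R => partial_t psi p.1 p.2).
  by apply: (@class_C_measurable _ 0); have [_ [_ _ + _]] := Cpsi 1.
have mp : measurable_fun setT (fun p : R * R => psi p.1 p.2).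
  exact: class_C_measurable (Cpsi 0).
apply: (integrable_slices _ (envelope_integrable M (C0 * (C1 + C2)) ki)).
  apply/measurable_restrict => //; rewrite setTI.
  apply: measurable_funM; first exact: (regular_measurable reg).
  apply: measurable_funD; first exact: measurable_funTS.
  apply: measurable_funM => //; apply: measurable_funM.
    exact: measurable_funTS.
  exact: (regular_measurable_dxx reg).
apply: aeS2 (regular_dxx reg) (ae_neq 0) => t wt t0.
have env0 x : 0 <= envelope a M (C0 * (C1 + C2)) k (t, x).
  by rewrite /envelope !mulr_ge0// ?addr_ge0.
have [ta|ta] := boolP (0 <= t <= a); last first.
  apply: aeW => x; rewrite patchE memNset ?normr0//.
  by move=> [/=]; rewrite in_itv /= (negbTE ta).
have [_ wk] := wt ta; have [uC _] := hC0 t ta.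
have tt : 0 < t < T.
  by move: ta => /andP[t1 t2]; rewrite lt_neqAle eq_sym t0 t1 (le_lt_trans t2).
apply: aeS wk => x wkx.
rewrite patchE mem_set; last by split => //=; rewrite in_itv.
have [xM|xM] := boolP (- M <= x <= M); last first.
  rewrite /density psi_t0//; last first.
    by move: xM; rewrite negb_and -!ltNge => /orP h; right.
  rewrite psi0; last 2 first.
  - by move: tt => /andP[/ltW -> ->].
  - by move: xM; rewrite negb_and -!ltNge => /orP h; right.
  by rewrite mul0r mulr0 addr0 mulr0 normr0.
rewrite /envelope /= !indicE !mem_set ?mulr1//=; [|by rewrite in_itv..].
rewrite /density normrM -mulrA ler_pM ?uC//.
rewrite (le_trans (ler_normD _ _))// !normrM ger0_norm//.
have h1 := hC1 _ _ ta xM; have h2 := hC2 _ _ ta xM.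
have h3 : `|psi t x| * `|w t x| <= C1 * k t by rewrite ler_pM.
have Ck : 0 <= C2 * k t by rewrite mulr_ge0.
have h4 : 0 <= `|psi t x| * `|w t x| by rewrite mulr_ge0.
move: h2 h3 h4 => /=; lra.
Qed.

Variables (v z : R -> R -> R).
Hypothesis mu_ : measurable_fun D (fun p : R * R => u p.1 p.2).
Hypothesis dv : is_dx `[0, T[ u v.
Hypothesis dz : is_dx `[0, T[ (fun t x => psi t x * u t x) z.

(** For almost every t <= a the two slices agree by [energy_slice]; for t > a both vanish. Since [v]
    and [z] are arbitrary representatives, uniqueness of weak derivatives is what gives them the
    bounds of [v0] and of the product rule, as Fubini's theorem requires. *)
Lemma energy_identity :
  \int[mu2]_(p in D) (u p.1 p.2 * partial_t psi p.1 p.2 -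
     2^-1 * (z p.1 p.2 * v p.1 p.2)) =
  \int[mu2]_(p in D1) density psi u w p.
Proof.
have spsi := class_C_smooth Cpsi.
have itv_tT t : 0 <= t < T -> `[0, T[%classic t by rewrite /= in_itv.
have z_ae t : 0 <= t < T -> {ae mu, forall x,
    z t x = derive1 (psi t) x * u t x + psi t x * v t x}.
  move=> tT; apply: (@weak_derivative1_unique _ (fun x => psi t x * u t x)).
    exact/dz.2/itv_tT.
  by apply: weak_derivative_smoothM => //; exact/dv.2/itv_tT.
have [C0 C00 hC0] := regular_bound reg M.
have [C1 C10 hC1] := class_C_bounded a M (Cpsi 0).
have [C2 C20 hC2] : exists2 C, 0 <= C & forall t x,
    0 <= t <= a -> - M <= x <= M -> `|partial_t psi t x| <= C.
  by apply: (@class_C_bounded _ 0); have [_ [_ _ + _]] := Cpsi 1.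
have [C3 C30 hC3] : exists2 C, 0 <= C & forall t x,
    0 <= t <= a -> - M <= x <= M -> `|partial_x psi t x| <= C.
  by apply: (@class_C_bounded _ 0); have [_ [_ _ _ +]] := Cpsi 1.
have psi_x0 t x : 0 <= t < T -> a < t \/ x < - M \/ M < x ->
    derive1 (psi t) x = 0.
  move=> tT [at_|xM].
    have -> : psi t = cst 0 by apply/funext => y; rewrite psi0//; left.
    by rewrite derive1E derive_cst.
  by apply: derive1_supp xM => y yM; apply: psi0 => //; right.
have ki := regular_integrable reg; have k0 := regular_ge0 reg.
have mpt : measurable_fun setT (fun p : R * R => partial_t psi p.1 p.2).
  by apply: (@class_C_measurable _ 0); have [_ [_ _ + _]] := Cpsi 1.
pose F p := u p.1 p.2 * partial_t psi p.1 p.2 - 2^-1 * (z p.1 p.2 * v p.1 p.2).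
have zv_bound t : 0 <= t <= a -> {ae mu, forall x,
    `|z t x * v t x| <= (C3 * C0 + C1 * C0) * C0 * \1_(`[- M, M]%classic) x}.
  move=> ta; have tT : 0 <= t < T.
    by move: ta => /andP[-> /le_lt_trans]; exact.
  have [uC v0C] := hC0 t ta.
  have vv0 : {ae mu, forall x, v t x = v0 t x}.
    apply: (@weak_derivative1_unique _ (u t)); last exact: (regular_dx reg).
    exact/dv.2/itv_tT.
  have := aeS2 (fun x (e : v t x = v0 t x) h => conj e h) vv0 v0C.
  apply: aeS2 (z_ae t tT) => x -> [vx v0x].
  have [xM|xM] := boolP (- M <= x <= M); last first.
    have xM' : x < - M \/ M < x.
      by move: xM; rewrite negb_and -!ltNge => /orP.
    rewrite psi_x0 ?psi0//; [|by right|by right].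
    by rewrite !mul0r addr0 mul0r normr0 mulr_ge0// !mulr_ge0// addr_ge0// mulr_ge0.
  rewrite indicE mem_set ?mulr1; last by rewrite /= in_itv.
  have hv : `|v t x| <= C0 by rewrite vx v0x.
  rewrite normrM ler_pM//.
  rewrite (le_trans (ler_normD _ _))// lerD// normrM ler_pM//.
  - exact: hC3.
  - exact: uC.
  - exact: hC1.
have F0 t : 0 < t < T -> a < t -> {ae mu, forall x, F (t, x) = 0}.
  move=> tT at_; have tT' : 0 <= t < T by move: tT => /andP[/ltW -> ->].
  apply: aeS (z_ae t tT') => x; rewrite /F /= => ->.
  rewrite psi_t0//; last by left.
  rewrite psi_x0//; last by left.
  by rewrite psi0 ?mulr0 ?mul0r ?addr0 ?mul0r ?mulr0 ?subrr//; left.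
have iF : mu2.-integrable setT (EFin \o (F \_ D)).
  pose C := C0 * C2 + (C3 * C0 + C1 * C0) * C0.
  have CC : 0 <= C by rewrite /C !(addr_ge0, mulr_ge0).
  apply: (integrable_slices _ (envelope_integrable M C ki)).
    apply/measurable_restrict => //; rewrite setTI.
    apply: measurable_funB.
      by apply: measurable_funM => //; exact: measurable_funTS.
    apply: measurable_funM => //; apply: measurable_funM; first exact: dz.1.
    exact: dv.1.
  apply: aeS (ae_neq 0) => t t0.
  have env0 x : 0 <= envelope a M C k (t, x).
    by rewrite /envelope !mulr_ge0// ?addr_ge0.
  have [tT|tT] := boolP (0 <= t < T); last first.
    apply: aeW => x; rewrite patchE memNset ?normr0//.
    by move=> [/=]; rewrite in_itv /= (negbTE tT).
  have tT' : 0 < t < T.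
    by move: tT => /andP[t1 ->]; rewrite lt_neqAle eq_sym t0 t1.
  have [ta|at_] := leP t a; last first.
    apply: aeS (F0 t tT' at_) => x Fx; rewrite patchE.
    by case: ifP; rewrite ?Fx normr0.
  have ta' : 0 <= t <= a by move: tT => /andP[-> _].
  have [uC _] := hC0 t ta'.
  apply: aeS (zv_bound t ta') => x hzv.
  rewrite patchE mem_set; last by split => //=; rewrite in_itv.
  rewrite /envelope /= [\1_(`[0, a]%classic) t]indicE mem_set; last by rewrite /= in_itv.
  rewrite mulr1; have [xM|xM] := boolP (- M <= x <= M); last first.
    move: hzv; rewrite indicE memNset; last by rewrite /= in_itv /= (negbTE xM).
    rewrite !mulr0 /F /= => hzv; rewrite psi_t0//; last first.
      by move: xM; rewrite negb_and -!ltNge => /orP h; right.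
    by rewrite mulr0 add0r normrN normrM mulr_ge0_le0// ?normr_ge0.
  move: hzv; rewrite indicE mem_set ?mulr1; last by rewrite /= in_itv.
  move=> hzv; apply: (@le_trans _ _ C); last by rewrite ler_peMr// lerDl.
  rewrite /F /C (le_trans (ler_normB _ _))// lerD//=.
    by rewrite normrM ler_pM// ?uC ?hC2.
  rewrite normrM gtr0_norm ?invr_gt0//; move: hzv; have := normr_ge0 (z t x * v t x).
  lra.
rewrite Rintegral_mkcond [RHS]Rintegral_mkcond.
apply: eq_slices => //; first exact: density_integrable.
apply: aeS2 (regular_dxx reg) (ae_neq 0) => t wt t0.
have [tT|tT] := boolP (0 <= t < T); last first.
  apply: eq_Rintegral => x _; rewrite !patchE !memNset//.
    move=> [/=]; rewrite in_itv /= => /andP[h1 h2] _.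
    by move: tT; rewrite h1 (le_lt_trans h2 aT).
  by move=> [/=]; rewrite in_itv /= (negbTE tT).
have tT' : 0 < t < T.
  by move: tT => /andP[t1 ->]; rewrite lt_neqAle eq_sym t0 t1.
have Dt x : (t, x) \in D by apply/mem_set; split => //=; rewrite in_itv.
have mFt : measurable_fun setT (fun x => (F \_ D) (t, x)).
  exact: (measurableT_comp (integrable_meas iF)).
have [ta|at_] := leP t a; last first.
  transitivity (\int[mu]_x (0 : R)).
    apply: ae_eq_Rintegral => //.
    by apply: aeS (F0 t tT' at_) => x Fx _; rewrite patchE Dt; exact: Fx.
  apply: eq_Rintegral => x _; rewrite patchE memNset//.
  by move=> [/=]; rewrite in_itv /= => /andP[_]; rewrite leNgt at_.
have ta' : 0 <= t <= a by move: tT => /andP[-> _].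
have [dw _] := wt ta'; have [_ lw _] := dw.
have D1t x : (t, x) \in D1 by apply/mem_set; split => //=; rewrite in_itv.
have cu := regular_continuous reg ta'.
have psi_supp x : x < - M \/ M < x -> psi t x = 0.
  by move=> h; apply: psi0 => //; right.
have tpsi : test_fun (psi t) by apply/test_funP; split => //; exists M.
have i1 : mu.-integrable setT (EFin \o (fun x => u t x * partial_t psi t x)).
  have bt x : `|partial_t psi t x| <= C2.
    have [xM|] := boolP (- M <= x <= M); first exact: hC2.
    by rewrite negb_and -!ltNge => /orP h; rewrite psi_t0 ?normr0//; right.
  apply: (@locint_mulr _ (u t) _ C2 (- M) M (continuous_locint cu) _ bt).
    exact (measurable_slice (f := fun p : R * R => partial_t psi p.1 p.2) t mpt).
  by move=> x h; rewrite psi_t0//; right.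
have i2 : mu.-integrable setT (EFin \o (fun x => psi t x * u t x * w t x)).
  have /(@eq_integrable _ _ _ mu _ measurableT) h : {in setT, EFin \o (fun x =>
      w t x * (psi t x * u t x)) =1 EFin \o (fun x => psi t x * u t x * w t x)}.
    by move=> x _ /=; rewrite mulrC.
  apply: h; apply: (@locint_mulr _ (w t) _ (C1 * C0) (- M) M lw).
  - apply: measurable_funM; first exact: smooth_measurable.
    exact: continuous_measurable_fun.
  - have [uC _] := hC0 t ta' => x.
    have [xM|] := boolP (- M <= x <= M); first by rewrite normrM ler_pM// ?hC1// uC.
    rewrite negb_and -!ltNge => /orP h.
    by rewrite psi_supp// mul0r normr0 mulr_ge0.
  - by move=> x /psi_supp ->; rewrite mul0r.
have i3 : mu.-integrable setT (EFin \o (fun x => z t x * v t x)).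
  have [_ [mz _ _] _] := dz.2 t (itv_tT t tT).
  have [_ [mv _ _] _] := dv.2 t (itv_tT t tT).
  apply: (@ae_integrable_le _ _ _ mu setT _ (fun x : R =>
      (C3 * C0 + C1 * C0) * C0 * \1_(`[- M, M]%classic) x)) => //.
  - exact: measurable_funM.
  - apply: (@locint_mulr _ (fun=> (C3 * C0 + C1 * C0) * C0) _ 1 (- M) M).
    + exact/continuous_locint/cst_continuous.
    + exact: measurable_indic.
    + by move=> x; rewrite indicE; case: (_ \in _); rewrite ?normr0 ?normr1.
    + move=> x h; rewrite indicE memNset// /= in_itv /= => /andP[h1 h2].
      by case: h; rewrite ltNge ?h1 ?h2.
  - by apply: aeS (zv_bound t ta') => x h _.
transitivity (\int[mu]_x (u t x * partial_t psi t x - 2^-1 * (z t x * v t x))).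
  by apply: eq_Rintegral => x _; rewrite patchE Dt.
transitivity (\int[mu]_x (u t x * partial_t psi t x +
    2^-1 * (psi t x * u t x * w t x))); last first.
  by apply: eq_Rintegral => x _; rewrite patchE D1t /density /=; ring.
rewrite RintegralB//; last first.
  have := @integrableZl _ _ R mu setT measurableT 2^-1 _ i3; by congr integrable.
rewrite RintegralD//; last first.
  have := @integrableZl _ _ R mu setT measurableT 2^-1 _ i2; by congr integrable.
rewrite !RintegralZl// (@energy_slice _ M (u t) (v t) (w t) (psi t) (z t))//.
- by rewrite mulrN opprK.
- exact/dv.2/itv_tT.
- exact/dz.2/itv_tT.
Qed.

End identity.
End Energy.

(** * The identity on [[0, a]] and the locality of weak derivatives *)

Section WeakForm.
Context {R : realType}.
Local Notation mu := (@lebesgue_measure R).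
Local Notation mu2 := (mu \x mu)%E.
Implicit Types (f g phi : R -> R) (psi u v w z : R -> R -> R) (k : R -> R)
  (a M x t T : R) (n : nat) (I : set R).

(** Strong solutions come with measurability on the strips below [T] only; those up to T (n+1)/(n+2)
    exhaust [[0, T[]. *)
Lemma measurable_strip T u :
  (forall a, 0 < a < T ->
     measurable_fun (`[0, a] `*` setT) (fun p : R * R => u p.1 p.2)) ->
  0 < T -> measurable_fun (`[0, T[ `*` setT) (fun p : R * R => u p.1 p.2).
Proof.
move=> mu_ T0.
have an n : 0 < T * (n.+1%:R / n.+2%:R) < T.
  rewrite mulr_gt0 ?divr_gt0//= gtr_pMr// ltr_pdivrMr// mul1r ltr_nat.
  exact: ltnSn.
have -> : `[0, T[ `*` [set: R] =
    \bigcup_n (`[0, T * (n.+1%:R / n.+2%:R)] `*` [set: R]).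
  apply/seteqP; split => [[t x] [/=]|[t x] [n _ [/=]]].
    rewrite in_itv /= => /andP[t0 tT] _.
    have d0 : 0 < (T - t) / T by rewrite divr_gt0// subr_gt0.
    have [n nd] : exists n : nat, n.+1%:R^-1 < (T - t) / T.
      have := near_infty_natSinv_lt (PosNum d0).
      by move=> /filter_ex [n]; exists n.
    exists n => //; split => //=; rewrite in_itv /= t0 /=.
    have n2 : n.+2%:R != 0 :> R by [].
    have -> : n.+1%:R / n.+2%:R = 1 - n.+2%:R^-1 :> R.
      by apply: (mulIf n2); rewrite divfK// mulrBl mul1r mulVf// -(natr1 n.+1) addrK.
    have nd2 : n.+2%:R^-1 < (T - t) / T.
      by apply: le_lt_trans nd; rewrite lef_pV2 ?posrE// ler_nat.
    move: nd2; rewrite ltr_pdivlMr// => nd2; rewrite mulrBr mulr1.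
    by move: (n.+2%:R^-1) nd2 => d nd2; lra.
  rewrite !in_itv /= => /andP[-> tn] _; split => //=.
  by apply: le_lt_trans tn _; have /andP[] := an n.
apply/measurable_fun_bigcup => n.
  by apply: measurableX => //; exact: measurable_itv.
exact: mu_.
Qed.

Lemma regular_exists T u a : 0 < a < T -> C_W1infty_loc `[0, T[ u ->
  weighted_Linfty 2 `[0, a] u -> dxx_L1_Linfty `[0, a] u ->
  exists v w k, is_dx `[0, T[ u v /\ regular a u v w k.
Proof.
move=> /andP[a0 aT] [cu Cu [v [dv Cv]]] [mu_ _] [w [mw dw kfin]].
have aJ : `[0, a]%classic `<=` `[0, T[%classic.
  by move=> t; rewrite /= !in_itv /= => /andP[-> /le_lt_trans]; exact.
have mJ : measurable (`[0, a]%classic : set (measurableTypeR R)) by exact: measurable_itv.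
have mk := Linfty_norm_measurable mJ mw.
have ki : mu.-integrable `[0, a] (fun t => Linfty_norm mu setT (w t)).
  apply/integrableP; split => //.
  under eq_integral do rewrite gee0_abs ?Linfty_norm_ge0//.
  exact: kfin.
have [ki' _] := EFin_fine_ae mJ ki.
exists v, w, (fun t => fine (Linfty_norm mu setT (w t))); split => //; split.
- by move=> t ta; apply: cu; apply: aJ; rewrite /= in_itv.
- exact: mu_.
- exact: mw.
- by move=> t ta; apply: dv.2; apply: aJ; rewrite /= in_itv.
(* Enlarging by 1 leaves an open neighbourhood of [[-M, M]], on which continuity turns the essential
   bound of [u t] into a bound at every point. *)
- move=> M; pose K : set R := `[- M - 1, M + 1]%classic.
  have cK : compact K by exact: segment_compact.
  have [Lu Lu0 hu] := C_Linfty_loc_bound Cu aJ cK.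
  have [Lv Lv0 hv] := C_Linfty_loc_bound Cv aJ cK.
  have KM x : - M <= x <= M -> K x.
    by rewrite /K /= in_itv /= => /andP[h1 h2]; apply/andP; split; lra.
  exists (Num.max Lu Lv); first by rewrite le_max Lu0.
  move=> t ta; split.
    move=> x /andP[x1 x2]; rewrite le_max; apply/orP; left.
    apply: (@ae_le_open _ (u t) Lu `](- M - 1), (M + 1)[%classic).
    + exact: interval_open.
    + by apply: cu; apply: aJ; rewrite /= in_itv.
    + apply: aeS (hu t ta) => y hy; rewrite /= in_itv /= => /andP[y1 y2].
      by apply: hy; rewrite /K /= in_itv /= !ltW.
    + by rewrite /= in_itv /=; apply/andP; split; lra.
  apply: aeS (hv t ta) => x hx /KM /hx h.
  by rewrite le_max h orbT.
- exact: ki'.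
- by move=> t; rewrite fine_ge0// Linfty_norm_ge0.
- have kf := integrable_ae mJ ki.
  apply: aeS2 dw kf => t dwt kt ta.
  have Jt : `[0, a]%classic t by rewrite /= in_itv.
  split; first exact: dwt.
  have := @Linfty_norm_fin _ _ _ mu setT (w t) (fine (Linfty_norm mu setT (w t))).
  rewrite fineK; last exact: kt.
  by move=> /(_ (lexx _)); apply: aeS => x; apply.
Qed.

(** The identity in [weak_solution] is conditional on a representative [z] of the derivative of
    [psi u]; the product rule supplies one. *)
Lemma weak_form T u a M psi v w k : a < T -> 0 < M ->
  weak_solution T (u 0) u -> regular a u v w k -> is_dx `[0, T[ u v ->
  measurable_fun (`[0, T[ `*` setT) (fun p : R * R => u p.1 p.2) ->
  test_fun_tx T psi ->
  (forall t x, 0 <= t < T -> a < t \/ x < - M \/ M < x -> psi t x = 0) ->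
  \int[mu]_x (u 0 x * psi 0 x) +
  \int[mu2]_(p in `[0, a] `*` setT) density psi u w p = 0.
Proof.
move=> aT M0 [_ _ wu] reg dv mu_ tpsi psi0.
have [Cpsi _] := tpsi.
pose z t x := derive1 (psi t) x * u t x + psi t x * v t x.
have dz : is_dx `[0, T[ (fun t x => psi t x * u t x) z.
  split; last first.
    move=> t tT; apply: weak_derivative_smoothM; last exact: dv.2.
    exact: class_C_smooth.
  apply: measurable_funD; apply: measurable_funM => //.
  - apply: measurable_funTS; apply: (@class_C_measurable _ 0 (partial_x psi)).
    by have [_ [_ _ _ +]] := Cpsi 1.
  - by apply: measurable_funTS; exact: class_C_measurable (Cpsi 0).
  - exact: dv.1.
by rewrite -(energy_identity aT M0 reg Cpsi psi0 mu_ dv dz); exact: wu.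
Qed.

Lemma near_eq0_derive1 phi x : (\forall y \near x, phi y = 0) ->
  \forall y \near x, derive1 phi y = 0.
Proof.
move=> /near_join; apply: filterS => y phi0.
rewrite derive1E; apply: derive_val.
have : is_derive y 1 (cst 0 : R -> R) 0 by exact: is_derive_cst.
by apply: near_eq_is_derive; apply: filterS phi0 => s ->.
Qed.

(** If [phi] vanishes near every point outside [I], so does its second derivative. Hence [v] and [w]
    have the same pairing with [phi], and the fundamental lemma applies to their difference. *)
Lemma weak_derivative2_local f g (v w : R -> R) I : open I ->
  (forall x, I x -> f x = g x) -> weak_derivative 2 f v ->
  weak_derivative 2 g w -> {ae mu, forall x, I x -> v x = w x}.
Proof.
move=> oI fg [_ lv fv] [_ lw gw].
suff : {ae mu, forall x, I x -> v x - w x = 0}.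
  by apply: aeS => x h Ix; apply/eqP; rewrite -subr_eq0 h.
apply: fundamental_lemma => //; first exact: locally_integrableB.
move=> phi tphi phi0; under eq_Rintegral do rewrite mulrBl.
rewrite RintegralB//; [|exact: locint_test|exact: locint_test].
apply/eqP; rewrite subr_eq0; apply/eqP.
have := fv _ tphi; have := gw _ tphi; rewrite sqrrN expr1n !mul1r => <- <-.
apply: eq_Rintegral => x _ /=; have [Ix|nIx] := pselect (I x); first by rewrite fg.
have dd := near_eq0_derive1 (near_eq0_derive1 (phi0 x nIx)).
by rewrite (nbhs_singleton dd) !mulr0.
Qed.

(** An injection into the naturals numbers the exceptional sets; numbers outside its image receive
    the empty set. *)
Lemma ae_countable (F : set (set R)) (P : set R -> R -> Prop) : countable F ->
  (forall I, F I -> {ae mu, forall x, P I x}) ->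
  {ae mu, forall x, forall I, F I -> P I x}.
Proof.
move=> /countable_injP[g ginj] FP.
pose N n := [set x | exists I, [/\ F I, g I = n & ~ P I x]].
have negN n : mu.-negligible (N n).
  have [[I [FI gI]]|nI] := pselect (exists I, F I /\ g I = n); last first.
    rewrite (_ : N n = set0); first exact: negligible_set0.
    by apply/seteqP; split => // x [I [FI gI _]]; apply: nI; exists I.
  have : mu.-negligible (~` [set x | P I x]) := FP I FI.
  apply: negligibleS => x [J [FJ gJ nPJ]] /= PI; apply: nPJ.
  suff -> : J = I by [].
  by apply: ginj; rewrite ?inE// gJ.
suff : mu.-negligible (~` [set x | forall I, F I -> P I x]) by [].
apply: negligibleS (negligible_bigcup negN) => x /= /existsNP[I /not_implyP[FI nP]].
by exists (g I) => //; exists I.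
Qed.

End WeakForm.

(** * Localisation and gluing *)

Section Glue.
Context {R : realType}.
Local Notation mu := (@lebesgue_measure R).
Local Notation mu2 := (mu \x mu)%E.
Implicit Types (chi : R -> R) (psi u v w z : R -> R -> R) (k : R -> R)
  (a b M x t T : R) (n : nat) (I : set R).

Lemma strong_regular T u a : 0 < a < T -> strong_solution T u ->
  exists v w k, [/\ is_dx `[0, T[ u v, regular a u v w k &
    measurable_fun (`[0, T[ `*` setT) (fun p : R * R => u p.1 p.2)].
Proof.
move=> aT [[CW _ _] su]; have [wu ku] := su a aT.
have [v [w [k [dv reg]]]] := regular_exists aT CW wu ku.
exists v, w, k; split => //; apply: measurable_strip; last first.
  by move: aT => /andP[a0]; exact: lt_trans.
by move=> b bT; have [[mb _] _] := su b bT.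
Qed.

Lemma density_mul psi u w chi : (forall n, class_C n psi) -> forall p : R * R,
  density (fun t x => chi x * psi t x) u w p = chi p.2 * density psi u w p.
Proof.
move=> Cpsi [t x]; rewrite /density /=.
have -> : partial_t (fun t x => chi x * psi t x) t x = chi x * partial_t psi t x.
  have [_ [dpsi _ _ _]] := Cpsi 1%N.
  have d : is_derive t 1 (psi ^~ x) (partial_t psi t x).
    by apply: DeriveDef; [exact: dpsi|rewrite /partial_t derive1E].
  have dM := is_derive_mul (is_derive_cst (chi x) t 1) d.
  rewrite {1}/partial_t derive1E (@derive_val _ _ _ _ _ _ _ dM).
  by rewrite mulr0 addr0.
by ring.
Qed.

Section balance.
Variables (T a M : R) (u v w : R -> R -> R) (k : R -> R) (psi : R -> R -> R).
Hypotheses (aT : 0 < a < T) (M0 : 0 < M).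
Hypothesis reg : regular a u v w k.
Hypothesis tpsi : test_fun_tx T psi.
Hypothesis psi0 : forall t x, 0 <= t < T ->
  a < t \/ x < - M \/ M < x -> psi t x = 0.

Let D1 : set (R * R) := `[0, a] `*` setT.
Let mD1 : measurable D1.
Proof. by apply: measurableX => //; exact: measurable_itv. Qed.

Definition balance x : R :=
  u 0 x * psi 0 x + \int[mu]_t (density psi u w \_ D1) (t, x).

Let iG : mu2.-integrable setT (EFin \o (density psi u w \_ D1)).
Proof.
by move: aT => /andP[_ aT']; apply: (density_integrable aT' reg tpsi.1 psi0).
Qed.

Lemma initial_integrable :
  mu.-integrable setT (EFin \o (fun x => u 0 x * psi 0 x)).
Proof.
move: aT => /andP[a0 aT']; apply: locint_test.
  by apply: continuous_locint; apply: (regular_continuous reg); rewrite lexx ltW.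
apply/test_funP; split; first exact: class_C_smooth tpsi.1 0.
exists M => // x xM; apply: psi0; last by right.
by rewrite lexx (lt_trans a0).
Qed.

Lemma balance_integrable : mu.-integrable setT (EFin \o balance).
Proof.
have [i2 _] := RFubini21 iG.
have := integrableD measurableT initial_integrable i2.
by congr integrable.
Qed.

Lemma integral_balance : \int[mu]_x balance x =
  \int[mu]_x (u 0 x * psi 0 x) + \int[mu2]_(p in D1) density psi u w p.
Proof.
have [i2 e2] := RFubini21 iG.
rewrite RintegralD//; last exact: initial_integrable.
by congr (_ + _); rewrite [RHS]Rintegral_mkcond; exact: e2.
Qed.

(** It is [ub], not [u], that is known to solve the equation. Its identity is tested with [chi psi],
    for [chi] supported in [I], where [u] equals [ub] and the second derivatives agree almost
    everywhere; so [balance] integrates to 0 against every such [chi]. *)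
Lemma balance_local (ub : R -> R -> R) I : strong_solution T ub -> open I ->
  (forall t x, 0 <= t < T -> I x -> u t x = ub t x) ->
  {ae mu, forall x, I x -> balance x = 0}.
Proof.
move=> sub oI uub; have /andP[a0 aT'] := aT.
have [vb [wb [kb [dvb regb mub]]]] := strong_regular aT sub.
apply: fundamental_lemma => //.
  by apply: open_integrable_locally; [exact: openT|exact: balance_integrable].
move=> chi tchi chi0; have /test_funP[sc _] := tchi.
have chi_off x : ~ I x -> chi x = 0 by move=> /chi0/nbhs_singleton.
pose psi' t x := chi x * psi t x.
have tpsi' : test_fun_tx T psi' by exact: test_fun_txM.
have psi0' t x : 0 <= t < T -> a < t \/ x < - M \/ M < x -> psi' t x = 0.
  by move=> h1 h2; rewrite /psi' psi0// mulr0.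
have iG1 : mu2.-integrable setT (EFin \o (density psi' u w \_ D1)).
  exact: (density_integrable aT' reg tpsi'.1 psi0').
have iG2 : mu2.-integrable setT (EFin \o (density psi' ub wb \_ D1)).
  exact: (density_integrable aT' regb tpsi'.1 psi0').
have wf := weak_form aT' M0 sub.1 regb dvb mub tpsi' psi0'.
(* Moving [chi x] into the time integral uses integrability of the slice at [x], which Fubini's
   theorem provides for almost every [x]. *)
have bc x : mu.-integrable setT (EFin \o (fun t => (density psi u w \_ D1) (t, x))) ->
    balance x * chi x = u 0 x * psi 0 x * chi x +
      \int[mu]_t (density psi' u w \_ D1) (t, x).
  move=> ix; rewrite /balance mulrDl; congr (_ + _).
  rewrite mulrC -RintegralZl//; apply: eq_Rintegral => t _.
  rewrite !patchE density_mul; last exact: tpsi.1.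
  by case: ifP; rewrite ?mulr0.
have [i1 e1] := RFubini21 iG1.
have ini : mu.-integrable setT (EFin \o (fun x => u 0 x * psi 0 x * chi x)).
  apply: locint_test tchi; apply: open_integrable_locally; first exact: openT.
  exact: initial_integrable.
transitivity (\int[mu]_x (u 0 x * psi 0 x * chi x +
    \int[mu]_t (density psi' u w \_ D1) (t, x))).
  apply: ae_eq_Rintegral => //.
  - apply: measurable_funM; last exact: smooth_measurable.
    exact: (integrable_meas balance_integrable).
  - by apply: measurable_funD; [exact: integrable_meas ini|exact: integrable_meas i1].
  - by have := ae_integrable2 iG; apply: aeS => x ix _; exact: bc.
rewrite RintegralD// e1 -[RHS]wf; congr (_ + _).
  apply: eq_Rintegral => x _; have [Ix|nIx] := pselect (I x); last first.
    by rewrite /psi' chi_off// mulr0 mul0r mulr0.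
  by rewrite uub ?lexx ?(lt_trans a0)// /psi'; ring.
rewrite [RHS]Rintegral_mkcond; apply: eq_slices => //.
apply: aeS2 (regular_dxx reg) (regular_dxx regb) => t wt wbt.
have [ta|nta] := boolP (0 <= t <= a); last first.
  apply: eq_Rintegral => x _; rewrite !patchE memNset//.
  by move=> [/=]; rewrite in_itv /= (negbTE nta).
have tT : 0 <= t < T by move: ta => /andP[-> /le_lt_trans]; exact.
have ww : {ae mu, forall x, I x -> w t x = wb t x}.
  apply: weak_derivative2_local (wt ta).1 (wbt ta).1 => // x Ix.
  exact: uub.
apply: ae_eq_Rintegral => //.
- exact: measurable_slice (integrable_meas iG1).
- exact: measurable_slice (integrable_meas iG2).
apply: aeS ww => x wx _; rewrite !patchE.
case: ifP => // _; rewrite !density_mul; [|exact: tpsi.1..].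
have [Ix|nIx] := pselect (I x); last by rewrite /= chi_off ?mul0r.
by rewrite /density /= wx// uub.
Qed.

End balance.

(** Countability merges the exceptional sets of the members of [F]. Off their union [u] is 0 at all
    times, so [balance] is exactly 0 there; its integral, which is the weak identity, vanishes. *)
Lemma strong_solution_glue T u (F : set (set R)) : 0 < T -> C_W1infty_loc `[0, T[ u ->
  (forall t x, 0 <= t < T -> 0 <= u t x) ->
  (forall a, 0 < a < T ->
     weighted_Linfty 2 `[0, a] u /\ dxx_L1_Linfty `[0, a] u) ->
  countable F -> (forall I, F I -> open I) ->
  (forall I, F I -> exists2 ub, strong_solution T ub &
     forall t x, 0 <= t < T -> I x -> u t x = ub t x) ->
  (forall t x, 0 <= t < T -> (forall I, F I -> ~ I x) -> u t x = 0) ->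
  strong_solution T u.
Proof.
move=> T0 CW u0 su cF oF sF u_off; split => //; split => //.
move=> psi v z tpsi dv dz.
have [a [M [a0 aT M0 psi0]]] := test_fun_tx_supp T0 tpsi.
have a0T : 0 < a < T by rewrite a0.
have [wu ku] := su a a0T.
have [v1 [w [k [dv1 reg]]]] := regular_exists a0T CW wu ku.
have mu_ : measurable_fun (`[0, T[ `*` setT) (fun p : R * R => u p.1 p.2).
  by apply: measurable_strip => // b bT; have [[mb _] _] := su b bT.
rewrite (energy_identity aT M0 reg tpsi.1 psi0 mu_ dv dz).
rewrite -(integral_balance a0T M0 reg tpsi psi0).
have bal0 : {ae mu, forall x, forall I, F I -> I x -> balance a u w psi x = 0}.
  apply: (@ae_countable _ F (fun I x => I x -> balance a u w psi x = 0)) => // I FI.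
  have [ub sub uub] := sF I FI.
  exact: (balance_local a0T M0 reg tpsi psi0 sub (oF I FI) uub).
transitivity (\int[mu]_x (0 : R)); last by rewrite Rintegral_cst// mul0r.
apply: ae_eq_Rintegral => //.
  exact: (integrable_meas (balance_integrable a0T M0 reg tpsi psi0)).
apply: aeS bal0 => x bx _.
have [[I FI Ix]|nI] := pselect (exists2 I, F I & I x); first exact: bx Ix.
have ux t : 0 <= t < T -> u t x = 0.
  by move=> tT; apply: u_off => // I FI Ix; apply: nI; exists I.
rewrite /balance ux ?lexx// mul0r add0r.
transitivity (\int[mu]_t (0 : R)); last by rewrite Rintegral_cst// mul0r.
apply: eq_Rintegral => t _; rewrite patchE; case: ifPn => //.
rewrite inE => -[/=]; rewrite in_itv /= => /andP[t0 ta] _.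
by rewrite /density /= ux ?mul0r// t0 (le_lt_trans ta).
Qed.

End Glue.

(** * Persistence of zeros *)

Section ZeroPersistence.
Context {R : realType}.
Local Notation mu := (@lebesgue_measure R).
Local Notation mu2 := (mu \x mu)%E.
Implicit Types (f g eta : R -> R) (psi u v w z : R -> R -> R) (k : R -> R)
  (a b c B C M x t T : R) (n : nat).

Lemma integrable_indicM f (D : set R) : measurable (D : set (measurableTypeR R)) ->
  mu.-integrable D (EFin \o f) ->
  mu.-integrable setT (EFin \o (fun x => f x * \1_D x)) /\
  \int[mu]_x (f x * \1_D x) = \int[mu]_(x in D) f x.
Proof.
move=> mD fi; split.
  have /(@integrable_mkcond _ _ R mu _ _ mD) := fi.
  congr integrable; apply/funext => x; rewrite /= patchE indicE.
  by case: ifPn; rewrite ?mulr1 ?mulr0.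
rewrite [RHS]Rintegral_mkcond; apply: eq_Rintegral => x _.
by rewrite patchE indicE; case: ifPn; rewrite ?mulr1 ?mulr0.
Qed.

Lemma primitive_lipschitz f g a b M C : locally_integrable setT g ->
  primitive_of f g -> - M <= a -> a <= b -> b <= M -> 0 <= C ->
  {ae mu, forall x, - M <= x <= M -> `|g x| <= C} ->
  `|f b - f a| <= C * (b - a).
Proof.
move=> lg fg Ma ab bM C0 gC; rewrite (fg _ _ ab).
have mab : measurable (`]a, b]%classic : set (measurableTypeR R)) by exact: measurable_itv.
have gi : mu.-integrable `]a, b] (EFin \o g).
  by apply: (@locint_itv _ g `]a, b] a b) => //; exact: subset_itv_oc_cc.
have ci : mu.-integrable `]a, b] (EFin \o (fun=> C)).
  apply: (@locint_itv _ (fun=> C) `]a, b] a b); last exact: subset_itv_oc_cc.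
  exact/continuous_locint/cst_continuous.
apply: le_trans (le_normr_Rintegral mab gi) _.
have -> : C * (b - a) = \int[mu]_(x in `]a, b]) C.
  rewrite (@Rintegral_cst _ _ _ mu _ mab) [X in _ = _ * fine X](_ : _ = (b - a)%:E)//.
  have := lebesgue_measure_itv `]a, b]; rewrite /= lte_fin.
  move: ab; rewrite le_eqVlt => /orP[/eqP ->|->//].
  by rewrite subrr ltxx.
apply: ae_le_Rintegral => //; first exact: (integrable_norm gi).
apply: aeS gC => x gx; rewrite /= in_itv /= => /andP[ax xb]; apply: gx.
by rewrite (le_trans Ma (ltW ax)) (le_trans xb).
Qed.

Section step.
Variables (T a x0 : R) (u v w : R -> R -> R) (k : R -> R).
Hypotheses (aT : 0 < a < T) (su : strong_solution T u) (dv : is_dx `[0, T[ u v).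
Hypothesis reg : regular a u v w k.
Hypothesis mu_ : measurable_fun (`[0, T[ `*` setT) (fun p : R * R => u p.1 p.2).

(** Large enough for [[-M, M]] to contain [[x0, x0 + 1]], hence the support of every spike at
    [x0]. *)
Let M := `|x0| + 2.

Let M0 : 0 < M. Proof. by rewrite ltr_wpDl. Qed.

Let spike_supp n x : x < - M \/ M < x -> spike n x0 x = 0.
Proof.
move=> xM; apply: spike_eq0.
have n1 : n.+1%:R^-1 <= 1 :> R by rewrite invf_le1// ler1n.
have /andP[a1 a2] : - `|x0| <= x0 <= `|x0| by rewrite -ler_norml.
move: xM; rewrite /M; move: (n.+1%:R^-1) n1 => d d1.
by case=> xM; [left|right]; lra.
Qed.

Let U n t := \int[mu]_x (u t x * spike n x0 x).

(** The bound on [v] is a Lipschitz constant in space valid for all times, so averaging over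
    [[x0, x0 + 1/(n+1)]] costs C/(n+1) uniformly in [t]. *)
Lemma spike_average : exists2 C, 0 <= C & forall n t, 0 <= t <= a ->
  `|U n t - u t x0| <= C / n.+1%:R.
Proof.
have [C C0 hC] := regular_bound reg M; exists C => // n t ta.
have cu := regular_continuous reg ta; have [_ vC] := hC t ta.
have dut := regular_dx reg ta; have [_ lv _] := dut.
apply: spike_mean.
  by apply: measurable_funTS; exact: continuous_measurable_fun.
move=> x /andP[x0x xx0].
have n1 : n.+1%:R^-1 <= 1 :> R by rewrite invf_le1// ler1n.
have /andP[a1 a2] : - `|x0| <= x0 <= `|x0| by rewrite -ler_norml.
apply: le_trans (_ : C * (x - x0) <= _); last first.
  by rewrite ler_wpM2l// lerBlDl.
apply: (primitive_lipschitz lv (weak_derivative_primitive cu dut) _ x0x _ C0 vC).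
  by rewrite /M; lra.
by move: xx0; rewrite /M; move: (n.+1%:R^-1) n1 => d d1; lra.
Qed.

(** The test function is eta(t) times a spike at [x0], where eta falls from 1 to 0 just after [t0].
    Its time derivative averages [u] over times after [t0], which is why the lower bound [c] is
    assumed on an interval. The other term is at most half the integral of [k u], where times before
    [s] contribute only an error. *)
Lemma persistence_step s t0 t1 B c : 0 <= s -> s <= t0 -> t0 < t1 -> t1 < a ->
  (forall t, 0 <= t <= s -> u t x0 = 0) ->
  0 <= B -> (forall t, s <= t <= t1 -> u t x0 <= B) ->
  (forall t, t0 <= t <= t1 -> c <= u t x0) ->
  c <= 2^-1 * (B * \int[mu]_(t in `]s, t1]) k t).
Proof.
move=> s0 st0 t01 t1a us B0 uB cu; have /andP[a0 aT'] := aT.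
have [_ u_ge0 _] := su.1.
have [C C0 hC] := spike_average.
have ki := regular_integrable reg; have k0 := regular_ge0 reg.
have mJ : measurable (`[0, a]%classic : set (measurableTypeR R)) by exact: measurable_itv.
pose kappa := \int[mu]_(t in `[0, a]) k t.
have kappa0 : 0 <= kappa by apply: Rintegral_ge0.
pose S := \int[mu]_(t in `]s, t1]) k t.
(* Three uses of [spike_average] make up the error: C for the lower bound near [t0], C for the
   initial term, and C kappa / 2 for the integral weighted by [k]. *)
suff main n : n.+1%:R^-1 < t1 - t0 ->
    c <= 2^-1 * (B * S) + (2 * C + 2^-1 * (C * kappa)) / n.+1%:R.
  apply/ler_addgt0Pr => e e0.
  pose E := 2 * C + 2^-1 * (C * kappa) + 1.
  have E0 : 0 < E by rewrite /E ltr_wpDl// addr_ge0// mulr_ge0// mulr_ge0.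
  have d1 : 0 < Num.min (t1 - t0) (e / E) by rewrite lt_min subr_gt0 t01 divr_gt0.
  have [n] : exists n : nat, n.+1%:R^-1 < Num.min (t1 - t0) (e / E).
    by have /filter_ex [n] := near_infty_natSinv_lt (PosNum d1); exists n.
  rewrite lt_min => /andP[/main h]; rewrite ltr_pdivlMr// => nE.
  apply: le_trans h _; rewrite lerD2l.
  apply: le_trans (ltW nE); rewrite [leLHS]mulrC ler_wpM2l ?invr_ge0//.
  by rewrite /E lerDl.
move=> nt.
pose eta t := 1 - step (n.+1%:R * (t - t0)).
have seta : smooth eta by exact: smoothB (smooth_cst 1) (smooth_step_scaled n t0).
have deta t : derive1 eta t = - spike n t0 t.
  rewrite derive1E; apply: derive_val.
  have := smooth_is_derive (smooth_step_scaled n t0) t.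
  rewrite derive_step_scaled => d.
  have := is_deriveB (is_derive_cst (1:R) t 1) d.
  by rewrite sub0r.
have eta01 t : 0 <= eta t <= 1.
  by rewrite /eta subr_ge0 step_le1 lerBlDr lerDl step_ge0.
have eta0 t : t0 + n.+1%:R^-1 < t -> eta t = 0.
  move=> h; rewrite /eta step_ge1 ?subrr// -ler_pdivrMl// mulr1 lerBrDl.
  exact: ltW.
have t0n : t0 + n.+1%:R^-1 < t1 by rewrite -ltrBrDl.
pose psi t x := eta t * spike n x0 x.
have tpsi : test_fun_tx T psi.
  apply: (test_fun_tx_tensor seta (test_fun_spike n x0) _ eta0).
  by rewrite (lt_trans t0n)// (lt_trans t1a).
have psi0 t x : 0 <= t < T -> a < t \/ x < - M \/ M < x -> psi t x = 0.
  move=> _ [h|h]; last by rewrite /psi spike_supp ?mulr0.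
  by rewrite /psi eta0 ?mul0r// (lt_trans t0n)// (lt_trans t1a).
have iG := density_integrable aT' reg tpsi.1 psi0.
have [i1 e1] := RFubini12 iG.
have wf := weak_form aT' M0 su.1 reg dv mu_ tpsi psi0.
(* A bound for the time slices: the average of [u] is at least c - C/(n+1) where the time spike
   lives, at most B + C/(n+1) on []s, t1]], and at most C/(n+1) before [s], where [u] is 0 at
   [x0]. *)
pose Bd t := - ((c - C / n.+1%:R) * spike n t0 t) +
  2^-1 * ((C / n.+1%:R) * (k t * \1_(`[0, a]%classic) t) +
     B * (k t * \1_(`]s, t1]%classic) t)).
have scale_int (r : R) f : mu.-integrable setT (EFin \o f) ->
    mu.-integrable setT (EFin \o (fun t => r * f t)).
  by move=> fi; have := @integrableZl _ _ R mu setT measurableT r _ fi; congr integrable.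
have add_int f g : mu.-integrable setT (EFin \o f) ->
    mu.-integrable setT (EFin \o g) ->
    mu.-integrable setT (EFin \o (fun t => f t + g t)).
  by move=> fi gi; have := integrableD measurableT fi gi; congr integrable.
have ms : measurable (`]s, t1]%classic : set (measurableTypeR R)) by exact: measurable_itv.
have kis : mu.-integrable `]s, t1] (EFin \o k).
  apply: (@integrableS _ _ R mu `[0, a]%classic) => // t.
  rewrite /= !in_itv /= => /andP[h1 h2].
  by rewrite (ltW (le_lt_trans s0 h1)) (le_trans h2 (ltW t1a)).
have [ik1 ek1] := integrable_indicM mJ ki; have [ik2 ek2] := integrable_indicM ms kis.
have Bd_int : mu.-integrable setT (EFin \o Bd) /\ \int[mu]_t Bd t =
    - (c - C / n.+1%:R) + 2^-1 * ((C / n.+1%:R) * kappa + B * S).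
  have is1 := spike_integrable n t0.
  have j1 : mu.-integrable setT (EFin \o (fun t => - ((c - C / n.+1%:R) * spike n t0 t))).
    have := scale_int (- (c - C / n.+1%:R)) _ is1.
    by congr integrable; apply/funext => t /=; rewrite mulNr.
  have j2 := add_int _ _ (scale_int (C / n.+1%:R) _ ik1) (scale_int B _ ik2).
  split; first exact: add_int j1 (scale_int _ _ j2).
  rewrite /Bd RintegralD//; last exact: scale_int.
  congr (_ + _).
    under eq_Rintegral do rewrite -mulNr.
    by rewrite RintegralZl// Rintegral_spike mulr1.
  rewrite RintegralZl// RintegralD//; [|exact: scale_int|exact: scale_int].
  by rewrite RintegralZl// RintegralZl// ek1 ek2.
have n0 : 0 <= C / n.+1%:R by rewrite divr_ge0.
have sp t : t0 <= t <= t0 + n.+1%:R^-1 \/ spike n t0 t = 0.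
  have [h|h] := boolP (t0 <= t <= t0 + n.+1%:R^-1); first by left.
  by right; apply: spike_eq0; move: h; rewrite negb_and -!ltNge => /orP.
have U_ge0 t : 0 <= t <= a -> 0 <= U n t.
  move=> /andP[h1 h2]; apply: Rintegral_ge0 => x _.
  by rewrite mulr_ge0 ?spike_ge0// u_ge0// h1 (le_lt_trans h2).
have slice : {ae mu, forall t, setT t ->
    \int[mu]_x (density psi u w \_ (`[0, a] `*` setT)) (t, x) <= Bd t}.
  apply: aeS (regular_dxx reg) => t wt _.
  have [ta|nta] := boolP (0 <= t <= a); last first.
    rewrite (_ : \int[mu]_x _ = 0); last first.
      transitivity (\int[mu]_x (0 : R)); last by rewrite Rintegral_cst// mul0r.
      apply: eq_Rintegral => x _; rewrite patchE memNset//.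
      by move=> [/=]; rewrite in_itv /= (negbTE nta).
    rewrite /Bd; have [/andP[h1 h2]|->] := sp t.
      have ta := le_trans h2 (ltW (lt_trans t0n t1a)).
      by move: nta; rewrite (le_trans s0 (le_trans st0 h1)) ta.
    by rewrite mulr0 oppr0 add0r mulr_ge0// addr_ge0// !mulr_ge0.
  have [dw wk] := wt ta; have [_ lw _] := dw.
  have cut := regular_continuous reg ta.
  have uC := hC n t ta.
  have iU := locint_test (continuous_locint cut) (test_fun_spike n x0).
  have uge0 x : 0 <= u t x.
    by move: ta => /andP[h1 h2]; apply: u_ge0; rewrite h1 (le_lt_trans h2).
  have [D D0 hD] := regular_bound reg M; have [uD _] := hD t ta.
  have [E hE] := test_fun_bounded (test_fun_spike n x0).
  have iw : mu.-integrable setT (EFin \o (fun x => w t x * (u t x * spike n x0 x))).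
    apply: (@locint_mulr _ (w t) _ (D * E) (- M) M lw).
    - apply: measurable_funM; first exact: continuous_measurable_fun.
      exact: smooth_measurable (smooth_spike n x0).
    - move=> x; have [xM|] := boolP (- M <= x <= M); first by rewrite normrM ler_pM// uD.
      rewrite negb_and -!ltNge => /orP /spike_supp ->.
      by rewrite mulr0 normr0 mulr_ge0// (le_trans _ (hE 0)).
    - by move=> x /spike_supp ->; rewrite mulr0.
  (* Here u >= 0 is essential: multiplying [w <= k t] by [u] times the spike preserves the
     inequality. *)
  have Uk : \int[mu]_x (w t x * (u t x * spike n x0 x)) <= k t * U n t.
    rewrite -RintegralZl//; apply: ae_le_Rintegral => //; first exact: scale_int.
    apply: aeS wk => x wkx _; apply: ler_wpM2r.
      exact: mulr_ge0 (uge0 x) (spike_ge0 _ _ _).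
    exact: le_trans (ler_norm _) wkx.
  have -> : \int[mu]_x (density psi u w \_ (`[0, a] `*` setT)) (t, x) =
      - (spike n t0 t * U n t) +
      2^-1 * (eta t * \int[mu]_x (w t x * (u t x * spike n x0 x))).
    transitivity (\int[mu]_x (- spike n t0 t * (u t x * spike n x0 x) +
        2^-1 * eta t * (w t x * (u t x * spike n x0 x)))).
      apply: eq_Rintegral => x _; rewrite patchE mem_set; last first.
        by split => //=; rewrite in_itv.
      rewrite /density /=; have -> : partial_t psi t x = - spike n t0 t * spike n x0 x.
        rewrite /partial_t derive1E; apply: derive_val.
        have := is_derive_mul (smooth_is_derive seta t) (is_derive_cst (spike n x0 x) t 1).
        by rewrite deta mulr0 add0r mulrC.
      by rewrite /psi; ring.
    rewrite RintegralD//; [|exact: scale_int|exact: scale_int].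
    by rewrite RintegralZl// RintegralZl// mulNr mulrA.
  have /andP[e0 e1'] := eta01 t.
  have U0 := U_ge0 t ta.
  rewrite /Bd [\1_(`[0, a]%classic) t]indicE mem_set ?mulr1; last by rewrite /= in_itv.
  move: uC; rewrite ler_norml => /andP[Ulo Uhi].
  apply: lerD.
    rewrite lerN2; have [h|->] := sp t; last by rewrite mulr0 mul0r.
    rewrite mulrC ler_wpM2l ?spike_ge0//.
    have cy : c <= u t x0.
      by apply: cu; move: h => /andP[-> /le_trans]; apply; exact: ltW.
    by move: Ulo cy; move: (C / n.+1%:R) => d; lra.
  rewrite ler_wpM2l ?invr_ge0//.
  have kt := k0 t.
  have I0 : 0 <= \1_(`]s, t1]%classic) t :> R by [].
  apply: (@le_trans _ _ (eta t * (k t * U n t))); first by rewrite ler_wpM2l.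
  have [tt1|t1t] := leP t t1; last first.
    rewrite eta0 ?mul0r; last exact: lt_trans t0n t1t.
    by rewrite addr_ge0// !mulr_ge0.
  apply: (@le_trans _ _ (k t * U n t)).
    by rewrite ler_piMl// mulr_ge0.
  have [ts|st] := leP t s.
    have yt : u t x0 = 0 by apply: us; rewrite ts; move: ta => /andP[->].
    rewrite mulrC; apply: (@le_trans _ _ (C / n.+1%:R * k t)).
      by rewrite ler_wpM2r//; move: Uhi; rewrite yt subr0.
    by rewrite lerDl !mulr_ge0.
  rewrite indicE mem_set ?mulr1; last by rewrite /= in_itv /= st.
  rewrite -mulrDl mulrC ler_wpM2r//.
  have yB : u t x0 <= B by apply: uB; rewrite (ltW st).
  by move: Uhi yB; move: (C / n.+1%:R) => d; lra.
have init : \int[mu]_x (u 0 x * psi 0 x) <= C / n.+1%:R.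
  have a00 : (0 : R) <= 0 <= a by rewrite lexx ltW.
  have -> : \int[mu]_x (u 0 x * psi 0 x) = eta 0 * U n 0.
    rewrite -RintegralZl//; last first.
      by apply: locint_test (test_fun_spike n x0); apply: continuous_locint;
        exact: (regular_continuous reg).
    by apply: eq_Rintegral => x _; rewrite /psi; ring.
  have /andP[e0 e1'] := eta01 0.
  have := hC n 0 a00; rewrite us ?lexx// subr0 ger0_norm ?U_ge0// => h.
  by apply: le_trans h; rewrite ler_piMl// U_ge0.
have := ae_le_Rintegral measurableT i1 Bd_int.1 slice.
rewrite e1 Bd_int.2 => le_Bd.
have wf' : \int[mu]_x (u 0 x * psi 0 x) +
    \int[mu2]_p (density psi u w \_ (`[0, a] `*` setT)) p = 0.
  by rewrite -[RHS]wf; congr (_ + _); rewrite [RHS]Rintegral_mkcond.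
move: le_Bd wf' init; set X := \int[mu]_x _; set Y := \int[mu2]_p _.
move: (n.+1%:R^-1) => d.
move=> h1 h2 h3.
lra.
Qed.

End step.

(** Continuity in time is given for essential suprema; since the slices are continuous in space, the
    bound near [x0] also holds at [x0]. *)
Lemma continuous_in_time (J : set R) u x0 t0 e : C_Linfty_loc J u ->
  (forall t, J t -> continuous (u t)) -> J t0 -> 0 < e ->
  exists2 d, 0 < d & forall t, J t -> `|t - t0| < d ->
    `|u t x0 - u t0 x0| <= e.
Proof.
move=> [_ Cu] cu Jt0 e0.
have cK : compact (`[x0 - 1, x0 + 1]%classic : set R) by exact: segment_compact.
have nb : nbhs (0%E : \bar R) [set y | (y < e%:E)%E].
  by apply: open_nbhs_nbhs; split; [exact: open_ereal_lt_ereal|rewrite /= lte_fin].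
have /nbhs_ballP[d /= d0 hd] := Cu _ cK t0 Jt0 _ nb.
exists d => // t Jt td.
have tb : ball t0 d t by rewrite /ball /= distrC.
have h := Linfty_norm_fin (ltW (hd t tb Jt)).
apply: (@ae_le_open _ (fun x => u t x - u t0 x) e `]x0 - 1, x0 + 1[%classic).
- exact: interval_open.
- by move=> x; apply: cvgB; exact: cu.
- by apply: aeS h => x hx xI; apply: hx; exact: subset_itv_oo_cc xI.
- by rewrite /= in_itv /=; apply/andP; split; lra.
Qed.

(* Testing the equation against an approximate identity at [x0] gives
   [y t <= 1/2 int_0^t k y] for [y t = u t x0]; as in Gronwall's lemma, [y]
   vanishes beyond the last time up to which it is known to vanish. *)
Lemma zero_persistence T u x0 t : strong_solution T u -> u 0 x0 = 0 ->
  0 <= t < T -> u t x0 = 0.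
Proof.
move=> su u00 /andP[tau0 tauT]; set tau := t in tau0 tauT *.
pose a := (tau + T) / 2.
have aT : 0 < a < T by rewrite /a; apply/andP; split; lra.
have taua : tau < a by rewrite /a; lra.
have [v [w [k [dv reg mu_]]]] := strong_regular aT su.
have [[cu Cu _] u_ge0 _] := su.1.
have inJ s : 0 <= s -> s <= tau -> `[0, T[%classic s.
  by move=> s0 st; rewrite /= in_itv /= s0 (le_lt_trans st).
have cont s e : 0 <= s -> s <= tau -> 0 < e -> exists2 d, 0 < d &
    forall r, 0 <= r -> r <= tau -> `|r - s| < d -> `|u r x0 - u s x0| <= e.
  move=> s0 st e0; have [d d0 hd] := continuous_in_time x0 Cu cu (inJ s s0 st) e0.
  by exists d => // r r0 rt; apply: hd; exact: inJ.
pose S := [set s | 0 <= s <= tau /\ forall r, 0 <= r <= s -> u r x0 = 0].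
have S0 : S 0.
  split; first by rewrite lexx.
  by move=> r /andP[r0 r0']; have -> : r = 0 by apply/eqP; rewrite eq_le r0' r0.
have supS : has_sup S.
  by split; [exists 0|exists tau => s [/andP[]]].
pose s := sup S.
have s0 : 0 <= s by exact: (ub_le_sup supS.2).
have st : s <= tau by apply: ge_sup => [|r [/andP[]]]; first by exists 0.
have before r : 0 <= r -> r < s -> u r x0 = 0.
  move=> r0 rs; have sr : 0 < s - r by rewrite subr_gt0.
  have [q [_ hq]] := sup_adherent sr supS.
  by rewrite -/s subKr => rq; apply: hq; rewrite r0 ltW.
have us : u s x0 = 0.
  have [s00|sn0] := eqVneq s 0; first by rewrite s00.
  have sgt0 : 0 < s by rewrite lt_neqAle eq_sym sn0.
  apply/eqP; rewrite eq_le u_ge0 ?s0 ?(le_lt_trans st)// andbT.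
  apply/ler_addgt0Pl => e e0; rewrite addr0.
  have [d d0 hd] := cont s e s0 st e0.
  pose r := Num.max 0 (s - d / 2).
  have rs : r < s by rewrite /r gt_max sgt0 /=; lra.
  have r0 : 0 <= r by rewrite /r le_max lexx.
  have rd : s - d / 2 <= r by rewrite /r le_max lexx orbT.
  have := hd r r0 (le_trans (ltW rs) st); rewrite before// sub0r normrN.
  move=> h; apply: le_trans (ler_norm _) (h _).
  by rewrite ltr_distl; apply/andP; split; lra.
have upto r : 0 <= r <= s -> u r x0 = 0.
  by move=> /andP[r0]; rewrite le_eqVlt => /orP[/eqP ->//|]; exact: before.
have [stau|stau] := eqVneq s tau; first by rewrite -stau.
have {}stau : s < tau by rewrite lt_neqAle stau.
exfalso.
have mJ : measurable (`[0, a]%classic : set (measurableTypeR R)) by exact: measurable_itv.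
have [iK _] := integrable_indicM mJ (regular_integrable reg).
have lK : locally_integrable setT (fun r => k r * \1_(`[0, a]%classic) r).
  by apply: open_integrable_locally iK; exact: openT.
have PK := primitiveP s lK; set P := primitive _ s in PK.
have cP := primitive_of_continuous lK PK.
have /cvgrPdist_le/(_ _ ltr01)/nbhs_ballP[d /= d0 hd] := cP s.
(* So close to [s] that the integral of [k] over []s, t1]] is at most 1, which leaves the factor 1/2
   of [persistence_step] to yield the contradiction. *)
pose t1 := Num.min tau (s + d / 2).
have st1 : s < t1 by rewrite /t1 lt_min stau /=; lra.
have t1tau : t1 <= tau by rewrite /t1 ge_min lexx.
have t1a : t1 < a by exact: le_lt_trans taua.
have t1d : t1 <= s + d / 2 by rewrite /t1 ge_min lexx orbT.
have kint r : s <= r -> r <= t1 -> \int[mu]_(q in `]s, r]) k q <= 1.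
  move=> sr rt1; have -> : \int[mu]_(q in `]s, r]) k q = P r - P s.
    rewrite (PK _ _ sr); apply: eq_Rintegral => q; rewrite inE /= in_itv /= => /andP[sq qr].
    rewrite indicE mem_set ?mulr1//= in_itv /= (ltW (le_lt_trans s0 sq)).
    exact: le_trans qr (le_trans rt1 (ltW t1a)).
  apply: le_trans (ler_norm _) _; rewrite distrC; apply: hd.
  by rewrite /ball /= ltr_distl; apply/andP; split; lra.
pose Y := [set u r x0 | r in `[s, t1]].
have [C C0 hC] := regular_bound reg `|x0|.
have Yub r : s <= r <= t1 -> u r x0 <= C.
  move=> /andP[sr rt1]; have ra : 0 <= r <= a.
    by rewrite (le_trans s0 sr) (le_trans rt1 (ltW t1a)).
  have [uC _] := hC r ra; apply: le_trans (ler_norm _) (uC x0 _).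
  by rewrite -ler_norml.
have supY : has_sup Y.
  split; first by exists (u s x0), s => //=; rewrite in_itv /= lexx ltW.
  by exists C => _ [r /= + <-]; rewrite in_itv /=; exact: Yub.
pose B := sup Y.
have YB r : s <= r <= t1 -> u r x0 <= B.
  by move=> rt; apply: (ub_le_sup supY.2); exists r => //=; rewrite in_itv.
have B0 : 0 < B.
  rewrite ltNge; apply/negP => B0.
  suff : S t1 by move=> /(ub_le_sup supS.2); rewrite leNgt st1.
  split; first by rewrite t1tau (le_trans s0 (ltW st1)).
  move=> r /andP[r0 rt1]; have [rs|/ltW sr] := leP r s; first by rewrite upto ?r0.
  apply/eqP; rewrite eq_le u_ge0 ?andbT; last first.
    by rewrite r0 (le_lt_trans (le_trans rt1 t1tau)).
  by apply: le_trans (YB r _) B0; rewrite sr.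
(* Some value exceeds 3B/4, and by continuity up to B/8 the function stays above 5B/8 on a short
   interval, whereas [persistence_step] allows at most B/2. *)
have B4 : 0 < B / 4 by rewrite divr_gt0.
have [_ [r /= + <-]] := sup_adherent B4 supY.
rewrite in_itv /= -/B => /andP[sr rt1] rB.
have r0 := le_trans s0 sr; have rtau := le_trans rt1 t1tau.
have B8 : 0 < B / 8 by rewrite divr_gt0.
have [d' d'0 hd'] := cont r _ r0 rtau B8.
(* The short interval lies to the right of [r], or to its left when [r] is the end [t1], so as to
   stay inside [[s, t1]]. *)
have [p [q [sp pq qt1 near_r]]] : exists p q, [/\ s <= p, p < q, q <= t1 &
    forall x, p <= x <= q -> `|x - r| < d'].
  have [rt|rt] := ltP r t1.
    exists r, (Num.min t1 (r + d' / 2)); split => //.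
    - by rewrite lt_min rt /=; lra.
    - by rewrite ge_min lexx.
    - move=> x /andP[rx]; rewrite le_min => /andP[_ xr].
      by rewrite ltr_distl; apply/andP; split; lra.
  exists (Num.max s (r - d' / 2)), r; split => //.
  - by rewrite le_max lexx.
  - by rewrite gt_max (lt_le_trans st1 rt) /=; lra.
  - move=> x /andP[]; rewrite ge_max => /andP[_ rx] xr.
    by rewrite ltr_distl; apply/andP; split; lra.
have q0 : s <= q by rewrite (le_trans sp (ltW pq)).
have h : 5 / 8 * B <= 2^-1 * (B * \int[mu]_(t in `]s, q]) k t).
  apply: (persistence_step aT su dv reg mu_ s0 sp pq (le_lt_trans qt1 t1a) upto (ltW B0)).
    by move=> x /andP[sx xq]; apply: YB; rewrite sx (le_trans xq).
  move=> x pxq; have xr := near_r x pxq; move: pxq => /andP[px xq].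
  have x0' : 0 <= x by rewrite (le_trans (le_trans s0 sp)).
  have := hd' x x0' (le_trans xq (le_trans qt1 t1tau)) xr.
  by rewrite ler_distl => /andP[h1 h2]; lra.
have hk := kint q q0 qt1.
have : B * \int[mu]_(t in `]s, q]) k t <= B * 1 by rewrite ler_wpM2l// ltW.
by move: h; move: (B * _) => z; lra.
Qed.

End ZeroPersistence.

(** * Cutting *)

Section Cut.
Context {R : realType}.
Local Notation mu := (@lebesgue_measure R).
Implicit Types (f g : R -> R) (u : R -> R -> R) (a b c d e x t T : R)
  (I J : set R).

Lemma cut_continuous f I : open I -> continuous f ->
  (forall x, boundary I x -> f x = 0) -> continuous (fun x => \1_I x * f x).
Proof.
move=> oI cf f0; suff H (x : R) : \1_I y * f y @[y --> x] --> (\1_I x * f x : R) by exact: H.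
have [Ix|nIx] := pselect (I x).
  have nI : \forall y \near x, I y by exact: open_nbhs_nbhs.
  rewrite [X in _ --> X](_ : _ = f x); last by rewrite indicE mem_set// mul1r.
  apply: cvg_trans (cf x).
  apply: near_eq_cvg; apply: filterS nI => y Iy.
  by rewrite indicE mem_set// mul1r.
have [cIx|ncIx] := pselect (closure I x); last first.
  have nI : \forall y \near x, ~ closure I y.
    by apply: open_nbhs_nbhs; split => //; exact/closed_openC/closed_closure.
  rewrite [X in _ --> X](_ : _ = (0 : R)); last by rewrite indicE memNset// mul0r.
  apply: cvg_trans (@cvg_cst _ (0 : R) _ (nbhs x) _).
  apply: near_eq_cvg; apply: filterS nI => y nIy.
  by rewrite indicE memNset ?mul0r//; move=> Iy; apply: nIy; exact: subset_closure.
have fx : f x = 0 by apply: f0; split => //; move=> /interior_subset.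
rewrite [X in _ --> X](_ : _ = (0 : R)); last by rewrite fx mulr0.
apply/cvgrPdist_le => e e0; have /cvgrPdist_le/(_ e e0) := cf x.
apply: filterS => y; rewrite fx !sub0r !normrN normrM => h.
by apply: le_trans h; rewrite ler_piMl// indicE; case: (_ \in _); rewrite ?normr1 ?normr0.
Qed.

Lemma locint_indicM g I : measurable (I : set (measurableTypeR R)) ->
  locally_integrable setT g -> locally_integrable setT (fun x => \1_I x * g x).
Proof.
move=> mI [mg _ gK]; split; [|exact: openT|].
  by apply: measurable_funM => //; exact: measurable_indic.
move=> K KT cK; apply: le_lt_trans (gK K KT cK).
apply: ge0_le_integral => //.
- exact: compact_measurable.
- apply/measurable_EFinP; apply: measurableT_comp => //; apply: measurable_funTS.
  by apply: measurable_funM => //; exact: measurable_indic.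
- by apply/measurable_EFinP; apply: measurableT_comp => //; exact: measurable_funTS.
- move=> x _; rewrite lee_fin normrM ler_piMl// indicE.
  by case: (_ \in _); rewrite ?normr1 ?normr0.
Qed.

Lemma open_boundary (X : topologicalType) (A : set X) (x : X) :
  open A -> boundary A x -> ~ A x.
Proof. by move=> /interior_id oA [_]; rewrite oA. Qed.

(** The point is the supremum of [I] to the right of [a]: openness keeps it out of [I], convexity
    keeps everything between [a] and it inside. *)
Lemma exit_point I a b : is_interval I -> open I -> a <= b -> I a -> ~ I b ->
  exists e, [/\ a < e, e <= b, boundary I e & forall x, a <= x < e -> I x].
Proof.
move=> iI oI ab Ia nIb.
pose A := [set x | a <= x /\ I x].
have Aa : A a by split.
have Ab x : A x -> x <= b.
  move=> [ax Ix]; rewrite leNgt; apply/negP => bx; apply: nIb.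
  by apply: (iI _ _ Ia Ix); rewrite ab ltW.
have supA : has_sup A by split; [exists a|exists b].
pose e := sup A.
have ae : a <= e by exact: (ub_le_sup supA.2).
have eb : e <= b by apply: ge_sup => //; exists a.
have inI x : a <= x < e -> I x.
  move=> /andP[ax xe]; have ex : 0 < e - x by rewrite subr_gt0.
  have [y [_ Iy]] := sup_adherent ex supA; rewrite -/e subKr => xy.
  by apply: (iI _ _ Ia Iy); rewrite ax ltW.
have nIe : ~ I e.
  move=> Ie; have /nbhs_ballP[d /= d0 hd] : nbhs e I by exact: open_nbhs_nbhs.
  have : e + d / 2 <= e.
    apply: (ub_le_sup supA.2); split; first by rewrite (le_trans ae)// lerDl divr_ge0// ltW.
    by apply: hd; rewrite /ball /= ltr_distl; apply/andP; split; lra.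
  by lra.
have {}ae : a < e by rewrite lt_neqAle ae andbT; apply/eqP => aE; apply: nIe; rewrite -aE.
exists e; split => //; split; last by move=> /interior_subset.
have : closure A e by apply: closure_sup; [exists a|exact: supA.2].
by apply: closureS => x [].
Qed.

Lemma entry_point I a b : is_interval I -> open I -> a <= b -> ~ I a -> I b ->
  exists e, [/\ a <= e, e < b, boundary I e & forall x, e < x <= b -> I x].
Proof.
move=> iI oI ab nIa Ib; pose J := -%R @^-1` I.
have iJ : is_interval J.
  by move=> x y Jx Jy z /andP[xz zy]; apply: (iI _ _ Jy Jx); rewrite !lerN2 zy.
have oJ : open J by apply: open_comp => // x _; exact: opp_continuous.
have [|||e [be ea [cJe nJe] inJ]] := exit_point iJ oJ (a := - b) (b := - a).
- by rewrite lerN2.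
- by rewrite /J /= opprK.
- by rewrite /J /= opprK.
exists (- e); split; [lra|lra|split|].
- by move=> B /(opp_continuous e) /cJe [x [Ix Bx]]; exists (- x).
- by move=> /interior_subset Ie; apply: nJe; move/interior_id: oJ => ->.
- move=> x /andP[ex xb]; rewrite -[x]opprK; apply: inJ.
  by apply/andP; split; lra.
Qed.

Section cut_primitive.
Variables (f g : R -> R) (I : set R).
Hypotheses (lg : locally_integrable setT g) (fg : primitive_of f g).
Hypothesis oI : open I.
Hypothesis iI : is_interval I.
Hypothesis f0 : forall x, boundary I x -> f x = 0.

Let lIg : locally_integrable setT (fun x => \1_I x * g x).
Proof. by apply: locint_indicM => //; exact: open_measurable. Qed.

Let full a b : a <= b -> (forall x, a < x < b -> I x) ->
  \int[mu]_(x in `]a, b]) (\1_I x * g x) = f b - f a.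
Proof.
move=> ab abI; rewrite (fg ab) -Rintegral_itv_bndo_bndc; last first.
  by apply: (locint_itv lIg); exact: subset_itv_oo_cc.
rewrite -[RHS]Rintegral_itv_bndo_bndc; last first.
  by apply: (locint_itv lg); exact: subset_itv_oo_cc.
apply: eq_Rintegral => x; rewrite inE /= in_itv /= => xab.
by rewrite indicE mem_set ?mul1r//; exact: abI.
Qed.

Let void a b : (forall x, a < x <= b -> ~ I x) ->
  \int[mu]_(x in `]a, b]) (\1_I x * g x) = 0.
Proof.
move=> abI; transitivity (\int[mu]_(x in `]a, b]) (0 : R)).
  apply: eq_Rintegral => x; rewrite inE /= in_itv /= => xab.
  by rewrite indicE memNset ?mul0r//; exact: abI.
by rewrite Rintegral_cst ?mul0r.
Qed.

Let leave a b : a <= b -> I a -> ~ I b ->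
  \int[mu]_(x in `]a, b]) (\1_I x * g x) = - f a.
Proof.
move=> ab Ia nIb; have [e [ae eb bIe inI]] := exit_point iI oI ab Ia nIb.
rewrite (Rintegral_itv_split lIg (ltW ae) eb) (full (ltW ae)); last first.
  by move=> x /andP[/ltW ax xe]; apply: inI; rewrite ax.
rewrite (f0 bIe) void ?addr0 ?sub0r// => x /andP[ex _] Ix.
by apply: (open_boundary oI bIe); apply: (iI Ia Ix); rewrite !ltW.
Qed.

Let enter a b : a <= b -> ~ I a -> I b ->
  \int[mu]_(x in `]a, b]) (\1_I x * g x) = f b.
Proof.
move=> ab nIa Ib; have [e [ae eb bIe inI]] := entry_point iI oI ab nIa Ib.
have nIe := open_boundary oI bIe.
rewrite (Rintegral_itv_split lIg ae (ltW eb)) (full (ltW eb)); last first.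
  by move=> x /andP[ex /ltW xb]; apply: inI; rewrite ex.
rewrite (f0 bIe) void ?add0r ?subr0// => x /andP[ax xe] Ix.
by apply: nIe; apply: (iI Ix Ib); rewrite xe ltW.
Qed.

(** The part of []a, b]] inside [I] is an interval whose ends are [a], [b] or boundary points, and
    at the latter [f] is 0. If [I] lies strictly between, an inner point [z] splits the integral
    into f z and - f z. *)
Lemma cut_primitive : primitive_of (fun x => \1_I x * f x) (fun x => \1_I x * g x).
Proof.
move=> a b ab; rewrite !indicE.
have [Ia|nIa] := pselect (I a); have [Ib|nIb] := pselect (I b).
- rewrite (mem_set Ia) (mem_set Ib) !mul1r full// => x /andP[ax xb].
  by apply: (iI Ia Ib); rewrite !ltW.
- by rewrite (memNset nIb) (mem_set Ia) mul1r mul0r sub0r leave.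
- by rewrite (memNset nIa) (mem_set Ib) mul1r mul0r subr0 enter.
rewrite (memNset nIa) (memNset nIb) !mul0r subrr.
have [[z [az zb Iz]]|nz] := pselect (exists z, [/\ a <= z, z <= b & I z]).
  by rewrite (Rintegral_itv_split lIg az zb) enter// leave// subrr.
by rewrite void// => x /andP[ax xb] Ix; apply: nz; exists x; rewrite ltW.
Qed.

End cut_primitive.

Lemma ae_eq_primitive_of f (v w : R -> R) : locally_integrable setT v ->
  measurable_fun setT w -> {ae mu, forall x, v x = w x} -> primitive_of f v ->
  primitive_of f w.
Proof.
move=> [mv _ _] mw vw fv a b ab; rewrite (fv _ _ ab); apply: ae_eq_Rintegral => //.
- exact: measurable_funTS.
- exact: measurable_funTS.
- by apply: aeS vw => x ->.
Qed.

Lemma primitive_ofB f1 f2 g1 g2 : locally_integrable setT g1 ->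
  locally_integrable setT g2 -> primitive_of f1 g1 -> primitive_of f2 g2 ->
  primitive_of (f1 \- f2) (g1 \- g2).
Proof.
move=> lg1 lg2 fg1 fg2 a b ab /=.
rewrite RintegralB//; last 2 first.
  by apply: (locint_itv lg1); exact: subset_itv_oc_cc.
  by apply: (locint_itv lg2); exact: subset_itv_oc_cc.
by rewrite -fg1// -fg2//; ring.
Qed.

Lemma primitive_growth f g a b c : locally_integrable setT g ->
  primitive_of f g -> a <= b -> (forall x, a < x <= b -> c <= g x) ->
  c * (b - a) <= f b - f a.
Proof.
move=> lg fg ab cg; rewrite (fg _ _ ab).
have mab : measurable (`]a, b]%classic : set (measurableTypeR R)) by exact: measurable_itv.
have -> : c * (b - a) = \int[mu]_(x in `]a, b]) c.
  rewrite (@Rintegral_cst _ _ _ mu _ mab) [X in _ = _ * fine X](_ : _ = (b - a)%:E)//.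
  have := lebesgue_measure_itv `]a, b]; rewrite /= lte_fin.
  move: ab; rewrite le_eqVlt => /orP[/eqP ->|->//].
  by rewrite subrr ltxx.
apply: le_Rintegral => //.
- apply: (@locint_itv _ (fun=> c) `]a, b] a b); last exact: subset_itv_oc_cc.
  exact/continuous_locint/cst_continuous.
- by apply: (locint_itv lg); exact: subset_itv_oc_cc.
Qed.

(** A zero of [f] is a minimum. If V e > 0, then V >= V e / 2 just before [e] and [f] would be
    negative there; if V e < 0, the same happens just after [e]. *)
Lemma nonneg_primitive_critical f (V : R -> R) e : continuous V ->
  primitive_of f V -> (forall x, 0 <= f x) -> f e = 0 -> V e = 0.
Proof.
move=> cV fV f_ge0 fe; apply/eqP/negPn/negP => Ve0.
have Ve : 0 < `|V e| / 2 by rewrite divr_gt0// normr_gt0.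
have /cvgrPdist_le/(_ _ Ve)/nbhs_ballP[d /= d0 hd] := cV e.
have lV := continuous_locint cV.
have dV x : `|x - e| < d -> `|V e - V x| <= `|V e| / 2.
  by move=> xe; apply: hd; rewrite /ball /= distrC.
have [Vpos|Vneg|Vz] := ltgtP 0 (V e); last by rewrite -Vz eqxx in Ve0.
- have : V e / 2 * (e - (e - d / 2)) <= f e - f (e - d / 2).
    apply: (primitive_growth lV fV); first by lra.
    move=> x /andP[x1 x2]; have := dV x; rewrite (gtr0_norm Vpos) => H.
    have /H : `|x - e| < d by rewrite ltr_distl; apply/andP; split; lra.
    by rewrite ler_distl => /andP[h1 h2]; lra.
  have := f_ge0 (e - d / 2); rewrite fe.
  have : 0 < V e / 2 * (e - (e - d / 2)) by rewrite mulr_gt0//; lra.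
  lra.
- have cN : continuous (cst 0 \- V : R -> R).
    by move=> x; apply: cvgB; [exact: cvg_cst|exact: cV].
  have fNV : primitive_of (cst 0 \- f : R -> R) (cst 0 \- V).
    apply: primitive_ofB => //; first exact/continuous_locint/cst_continuous.
    by move=> a b ab; rewrite subrr Rintegral_cst// mul0r.
  have : - V e / 2 * (e + d / 2 - e) <= 0 - f (e + d / 2) - (0 - f e).
    apply: (primitive_growth (continuous_locint cN) fNV); first by lra.
    move=> x /andP[x1 x2]; have := dV x; rewrite (ltr0_norm Vneg) => H.
    have /H : `|x - e| < d by rewrite ltr_distl; apply/andP; split; lra.
    by rewrite ler_distl => /andP[h1 h2]; rewrite /=; lra.
  have := f_ge0 (e + d / 2); rewrite fe.
  have : 0 < - V e / 2 * (e + d / 2 - e) by rewrite mulr_gt0//; lra.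
  lra.
Qed.

Lemma cut_le f I x : `|\1_I x * f x| <= `|f x|.
Proof.
by rewrite normrM ler_piMl// indicE; case: (_ \in _); rewrite ?normr1 ?normr0.
Qed.

Lemma cut_C_Linfty_loc J I u : measurable (I : set (measurableTypeR R)) ->
  C_Linfty_loc J u -> C_Linfty_loc J (fun t x => \1_I x * u t x).
Proof.
move=> mI [lu cu]; split.
  move=> t Jt; have [mut utK] := lu t Jt; split.
    by apply: measurable_funM => //; exact: measurable_indic.
  move=> K cK; apply: le_lt_trans (utK K cK); apply: Linfty_normS => //.
  by apply: aeW => x _; exact: cut_le.
move=> K cK t0 Jt0.
apply: (@squeeze_cvge _ _ _ _ (fun=> 0%E)
  _ (fun t => Linfty_norm mu K (fun x => u t x - u t0 x))); last 2 first.
- exact: cvg_cst.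
- exact: cu.
near=> t; rewrite Linfty_norm_ge0/=; apply: Linfty_normS => //.
by apply: aeW => x _; rewrite -mulrBr; exact: (@cut_le (u t \- u t0)).
Unshelve. all: by end_near. Qed.

Lemma cut_measurable J I u : measurable (J : set (measurableTypeR R)) ->
  measurable (I : set (measurableTypeR R)) ->
  measurable_fun (J `*` setT) (fun p : R * R => u p.1 p.2) ->
  measurable_fun (J `*` setT) (fun p : R * R => \1_I p.2 * u p.1 p.2).
Proof.
move=> mJ mI mu_; apply: measurable_funM => //.
apply: measurable_funTS.
by apply: (@measurableT_comp _ _ _ _ _ _ (\1_I : R -> R) _ snd) => //; exact: measurable_indic.
Qed.

Lemma cut_weak_derivative1 f g I : open I -> is_interval I -> continuous f ->
  (forall x, boundary I x -> f x = 0) -> weak_derivative 1 f g ->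
  weak_derivative 1 (fun x => \1_I x * f x) (fun x => \1_I x * g x).
Proof.
move=> oI iI cf f0 fg; have [_ lg _] := fg; apply: primitive_weak_derivative.
  by apply: locint_indicM => //; exact: open_measurable.
by apply: cut_primitive => //; exact: weak_derivative_primitive.
Qed.

(** Cutting is applied twice, to [f] with density [V] and to [V] with density [w]. The second time
    needs V = 0 on the boundary, which makes sense because [V] is the continuous version of [v] and
    holds because f >= 0. *)
Lemma cut_weak_derivative2 f (v w : R -> R) I : open I -> is_interval I -> continuous f ->
  (forall x, 0 <= f x) -> (forall x, boundary I x -> f x = 0) ->
  weak_derivative 1 f v -> weak_derivative 2 f w ->
  weak_derivative 2 (fun x => \1_I x * f x) (fun x => \1_I x * w x).
Proof.
move=> oI iI cf f_ge0 f0 fv fw.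
have vw := weak_derivative_second fv fw.
have [V [Vw vV]] := weak_derivative_ae_primitive vw.
have [lv lw _] := vw.
have cV := primitive_of_continuous lw Vw.
have lV := continuous_locint cV.
have fV : primitive_of f V.
  apply: (ae_eq_primitive_of lv _ vV); first by case: lV.
  exact: weak_derivative_primitive.
have V0 x : boundary I x -> V x = 0.
  by move=> /f0 fx; exact: (nonneg_primitive_critical cV fV f_ge0 fx).
have [lIf lIV IfV] := cut_weak_derivative1 oI iI cf f0 (primitive_weak_derivative lV fV).
have [_ lIw IVw] := cut_weak_derivative1 oI iI cV V0 (primitive_weak_derivative lw Vw).
split => // phi tphi.
have := IfV _ (test_fun_derive tphi); have := IVw _ tphi.
rewrite !derive1n1 /= => -> ->; rewrite !expr1 expr2; ring.
Qed.

Lemma strong_solution_cut T u I : 0 < T -> strong_solution T u -> open_interval I ->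
  (forall x, boundary I x -> u 0 x = 0) ->
  strong_solution T (fun t x => \1_I x * u t x).
Proof.
move=> T0 su [iI oI _] u0.
have mI : measurable (I : set (measurableTypeR R)) by exact: open_measurable.
have [[[cu lu [v [[mv uv] lv]]] u_ge0 _] sT] := su.
have ut0 t x : 0 <= t < T -> boundary I x -> u t x = 0.
  by move=> tT /u0 ux; exact: zero_persistence su ux tT.
have in0T t : `[0, T[%classic t = (0 <= t < T) by rewrite /= in_itv.
have cut_ge0 (t x : R) : 0 <= t < T -> 0 <= \1_I x * u t x.
  by move=> tT; rewrite mulr_ge0// ?indicE ?ler0n// u_ge0.
(* The family has [I] as its only member and [u] as the local solution; what is left is the
   regularity of the cut function. *)
apply: (@strong_solution_glue _ _ _ [set I]) => //.
- split.
  + move=> t; rewrite in0T => tT; apply: cut_continuous => //.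
      by apply: cu; rewrite in0T.
    by move=> x; exact: ut0.
  + exact: cut_C_Linfty_loc.
  + exists (fun t x => \1_I x * v t x); split; last exact: cut_C_Linfty_loc.
    split; first exact: cut_measurable.
    move=> t /[dup]; rewrite {1}in0T => tT Jt; apply: cut_weak_derivative1 => //.
    * exact: cu.
    * by move=> x; exact: ut0.
    * exact: uv.
- move=> a aT; have [[mu_ wu] [w [mw uw w1]]] := sT a aT.
  have aT0 t : `[0, a]%classic t -> 0 <= t < T.
    rewrite /= in_itv /= => /andP[-> ta]; rewrite (le_lt_trans ta)//.
    by case/andP: aT.
  have mJ : measurable (`[0, a]%classic : set (measurableTypeR R)) by exact: measurable_itv.
  split.
    split; first exact: cut_measurable.
    apply: le_lt_trans wu; apply: Linfty_normS => //.
    by apply: aeW => -[t x] _ /=; rewrite mulrCA; exact: (@cut_le (fun x => _ * u t x)).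
  exists (fun t x => \1_I x * w t x); split; first exact: cut_measurable.
    apply: aeS uw => t uwt ta; have tT := aT0 _ ta.
    have Jt : `[0, T[%classic t by rewrite in0T.
    apply: (@cut_weak_derivative2 _ (v t)) => //.
    + exact: cu.
    + by move=> x; exact: u_ge0.
    + by move=> x; exact: ut0.
    + exact: uv.
    + exact: uwt.
  apply: le_lt_trans w1; apply: ge0_le_integral => //.
  + by move=> t _; exact: Linfty_norm_ge0.
  + by apply: Linfty_norm_measurable => //; exact: cut_measurable.
  + exact: Linfty_norm_measurable.
  + move=> t _; apply: Linfty_normS => //.
    by apply: aeW => x _; exact: cut_le.
- by move=> J ->.
- move=> J ->; exists u => // t x tT Ix.
  by rewrite indicE mem_set// mul1r.
- move=> t x tT /(_ I erefl) nIx.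
  by rewrite indicE memNset// mul0r.
Qed.

End Cut.

(** * Pasting *)

Section Paste.
Context {R : realType}.
Local Notation mu := (@lebesgue_measure R).
Implicit Types (f g : R -> R) (u v w : R -> R -> R) (a d e x t T : R)
  (I J : set R).

Lemma cvge0_le (X : Type) (G : set_system X) (h : X -> \bar R) : Filter G ->
  (forall s, (0 <= h s)%E) ->
  (forall e : R, 0 < e -> \forall s \near G, (h s <= e%:E)%E) ->
  h s @[s --> G] --> (0 : \bar R).
Proof.
move=> FG h0 he; apply/fine_cvgP; split.
  by apply: filterS (he 1 ltr01) => s hs; rewrite ge0_fin_numE// (le_lt_trans hs) ?ltry.
apply/cvgrPdist_le => e e0; apply: filterS (he e e0) => s hs.
rewrite sub0r normrN ger0_norm ?fine_ge0//= -lee_fin fineK//.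
by rewrite ge0_fin_numE// (le_lt_trans hs) ?ltry.
Qed.

Lemma continuous_Linfty_loc f : continuous f -> Linfty_loc f.
Proof.
move=> cf; split; first exact: continuous_measurable_fun.
move=> K cK; have cfK : compact (f @` K).
  by apply: continuous_compact => //; exact: continuous_subspaceT.
have [M M0 fM] := compact_itv cfK.
apply: (@le_lt_trans _ _ M%:E); last by rewrite ltry.
apply: Linfty_norm_le; first by rewrite lee_fin ltW.
apply: aeW => x Kx; rewrite lee_fin ler_norml.
have := fM (f x); rewrite /= in_itv /=; apply.
by exists x.
Qed.

(** On [[-M, M]] the increment in time of [u] is that at x = 0 plus the integral of the increment of
    [v], so continuity in time at a single point suffices. Half of [e] goes to each part. *)
Lemma primitive_C_Linfty_loc J u v : (forall t, J t -> continuous (u t)) ->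
  (forall t, J t -> weak_derivative 1 (u t) (v t)) -> C_Linfty_loc J v ->
  (forall t0 e, J t0 -> 0 < e -> exists2 d, 0 < d & forall t, J t ->
     `|t - t0| < d -> `|u t 0 - u t0 0| <= e) ->
  C_Linfty_loc J u.
Proof.
move=> cu uv [_ Cv] u0; split=> [t Jt|K cK t0 Jt0].
  by apply: continuous_Linfty_loc; exact: cu.
have [M M0 KM] := compact_itv cK.
apply: cvge0_le; first by move=> t; exact: Linfty_norm_ge0.
move=> e e0; have e2 : 0 < e / 2 by rewrite divr_gt0.
pose C := e / 2 / M; have C0 : 0 < C by rewrite divr_gt0.
have CM : C * M = e / 2 by rewrite divfK// gt_eqF.
pose KM' : set R := `[- M, M]%classic.
have nb : nbhs (0%E : \bar R) [set y | (y < C%:E)%E].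
  by apply: open_nbhs_nbhs; split; [exact: open_ereal_lt_ereal|rewrite /= lte_fin].
have cM : compact KM' by exact: segment_compact.
have [d d0 hd] := u0 t0 _ Jt0 e2.
have Ct : \forall t \near within J (nbhs t0),
    (Linfty_norm mu KM' (fun x => v t x - v t0 x)%R < C%:E)%E.
  exact: Cv _ cM t0 Jt0 _ nb.
near=> t.
have Jt : J t by near: t; exact: withinT.
have {hd}ud : `|u t 0 - u t0 0| <= e / 2.
  apply: hd => //; near: t; apply: cvg_within.
  by apply/nbhs_ballP; exists d => // y; rewrite /ball /= distrC.
have vd : (Linfty_norm mu KM' (fun x => v t x - v t0 x)%R < C%:E)%E by near: t.
have [_ lv _] := uv t Jt; have [_ lv0 _] := uv t0 Jt0.
have pt := weak_derivative_primitive (cu t Jt) (uv t Jt).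
have pt0 := weak_derivative_primitive (cu t0 Jt0) (uv t0 Jt0).
have p := primitive_ofB lv lv0 pt pt0.
have lB : locally_integrable setT (v t \- v t0) by exact: locally_integrableB.
have vC : {ae mu, forall x, - M <= x <= M -> `|(v t \- v t0) x| <= C}.
  apply: aeS (Linfty_norm_fin (ltW vd)) => x h xM; apply: h.
  by rewrite /KM' /= in_itv.
apply: Linfty_norm_le; first by rewrite lee_fin ltW.
apply: aeW => x /KM; rewrite /= in_itv /= => /andP[Mx xM]; rewrite lee_fin.
have NM : - M <= 0 by rewrite oppr_le0 ltW.
suff : `|(u t \- u t0) x - (u t \- u t0) 0| <= e / 2.
  move=> /= h; have -> : e = e / 2 + e / 2 by lra.
  rewrite -[u t x - _](subrK (u t 0 - u t0 0)).
  by rewrite (le_trans (ler_normD _ _))// lerD.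
have [x0|/ltW x0] := leP 0 x.
  apply: le_trans (primitive_lipschitz lB p NM x0 xM (ltW C0) vC) _.
  by rewrite subr0 -CM ler_pM2l.
rewrite distrC; apply: le_trans (primitive_lipschitz lB p Mx x0 (ltW M0) (ltW C0) vC) _.
by rewrite sub0r -CM ler_pM2l// lerNl.
Unshelve. all: by end_near. Qed.

Section paste.
Variables (T : R) (F : set (set R)) (u_ : set R -> R -> R -> R).
Hypotheses (T0 : 0 < T) (cF : countable F).
Hypothesis FI : forall I, F I -> open_interval I.
Hypothesis tF : trivIset F id.
Hypothesis su : forall I, F I -> strong_solution T (u_ I).
Hypothesis u0 : forall I, F I -> forall x, (~` I) x -> u_ I 0 x = 0.

Let u := family_sum F u_.

Let in0T t : `[0, T[%classic t = (0 <= t < T). Proof. by rewrite /= in_itv. Qed.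

Let u_I0 I t x : F I -> 0 <= t < T -> ~ I x -> u_ I t x = 0.
Proof. by move=> FI' tT nIx; apply: zero_persistence (su FI') _ tT; exact: u0. Qed.

Let u_ge0 I t x : F I -> 0 <= t < T -> 0 <= u_ I t x.
Proof. by move=> /su[[_ + _] _]; exact. Qed.

(** By disjointness [x] lies outside every other interval, where persistence of zeros makes the
    corresponding terms 0 at all times. *)
Let u_in I t x : F I -> 0 <= t < T -> I x -> u t x = u_ I t x.
Proof.
move=> fI tT Ix; rewrite /u /family_sum.
rewrite (@esumID _ _ [set I]); last by move=> J FJ; rewrite lee_fin u_ge0.
rewrite (_ : F `&` [set I] = [set I]); last by apply: setIidr => J ->.
rewrite esum_set1 ?lee_fin ?u_ge0// esum1 ?adde0// => J [FJ JI].
rewrite u_I0// => Jx; apply: JI; apply: (tF FJ fI); by exists x.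
Qed.

Let u_out t x : 0 <= t < T -> (forall I, F I -> ~ I x) -> u t x = 0.
Proof.
by move=> tT nF; rewrite /u /family_sum esum1// => J FJ; rewrite u_I0//; exact: nF.
Qed.

Let u_cases t x : 0 <= t < T ->
  u t x = 0 \/ exists2 I, F I & I x.
Proof.
move=> tT; have [|nI] := pselect (exists2 I, F I & I x); first by right.
by left; apply: u_out => // I fI Ix; apply: nI; exists I.
Qed.

Let cu_ I t : F I -> 0 <= t < T -> continuous (u_ I t).
Proof. by move=> /su[[[+ _ _] _ _] _] tT; apply; rewrite in0T. Qed.

Let paste_ge0 t x : 0 <= t < T -> 0 <= u t x.
Proof.
move=> tT; have [->//|[I fI Ix]] := u_cases x tT.
by rewrite (u_in fI)// u_ge0.
Qed.

(** On each interval, and then on its closure, continuity upgrades equality. Suppose g <> 0 near a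
    point outside all intervals. If some interval meets the neighbourhood, it has a boundary point
    there, at which [g] equals its solution and so is 0; if none does, u = 0 on the neighbourhood
    and hence g = 0. *)
Let paste_eq t g : 0 <= t < T -> continuous g ->
  {ae mu, forall x, u t x = g x} -> u t = g.
Proof.
move=> tT cg ug.
have ugI I x : F I -> I x -> u_ I t x = g x.
  move=> fI; apply: ae_eq_open; first by case: (FI fI).
  - by move=> y _; exact: cu_.
  - by move=> y _; exact: cg.
  - by apply: aeS ug => y <- Iy; rewrite (u_in fI).
have ugcI I x : F I -> closure I x -> u_ I t x = g x.
  move=> fI cIx; apply/eqP; rewrite -subr_eq0.
  have cl : closed [set y | u_ I t y - g y = 0].
    apply: (@closed_comp _ _ (u_ I t \- g) [set 0]); last exact: closed_eq.
    by move=> y _; apply: cvgB; [exact: cu_|exact: cg].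
  apply/eqP; move: x cIx; change (closure I `<=` [set y | u_ I t y - g y = 0]).
  rewrite ((closure_id _).1 cl); apply: closureS => y Iy /=.
  by rewrite ugI// subrr.
apply/funext => x.
have [[I fI Ix]|nI] := pselect (exists2 I, F I & I x).
  by rewrite (u_in fI)// ugI.
rewrite u_out//; last by move=> I fI Ix; apply: nI; exists I.
apply/esym/eqP/negPn/negP => gx0.
have : \forall y \near x, g y != 0 by exact: cvgr_neq0 (cg x) gx0.
move=> /nbhs_ballP[d /= d0 gd].
have [[y [I [xy fI Iy]]]|nB] := pselect (exists y I, [/\ ball x d y, F I & I y]).
  have nIx : ~ I x by move=> Ix; apply: nI; exists I.
  have [iI oI _] := FI fI.
  have [e [bIe xe]] : exists e, boundary I e /\ ball x d e.
    move: xy; rewrite /ball /= => xy; have [xley|/ltW ylex] := leP x y.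
      have [e [xe ey bIe _]] := entry_point iI oI xley nIx Iy.
      exists e; split => //; move: xy; rewrite distrC ger0_norm ?subr_ge0// => xy.
      by rewrite distrC ger0_norm ?subr_ge0//; lra.
    have [e [ye ex bIe _]] := exit_point iI oI ylex Iy nIx.
    exists e; split => //; move: xy; rewrite ger0_norm ?subr_ge0// => xy.
    by rewrite ger0_norm ?subr_ge0//; lra.
  have := gd e xe; rewrite -(ugcI I e fI bIe.1).
  by rewrite u_I0 ?eqxx//; exact: open_boundary.
have : 0 = g x.
  apply: (@ae_eq_open _ (fun=> 0) g (ball x d)).
  - exact: ball_open.
  - by move=> y _; exact: cvg_cst.
  - by move=> y _; exact: cg.
  - apply: aeS ug => y <- xy; rewrite u_out// => I fI Iy.
    by apply: nB; exists y, I.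
  - exact: ballxx.
by move/esym/eqP; rewrite (negbTE gx0).
Qed.

Let paste_continuous v t : is_dx `[0, T[ u v -> 0 <= t < T -> continuous (u t).
Proof.
move=> [_ uv] tT; have uvt : weak_derivative 1 (u t) (v t) by apply: uv; rewrite in0T.
have [g [gv ug]] := weak_derivative_ae_primitive uvt.
have [_ lv _] := uvt; have cg := primitive_of_continuous lv gv.
by rewrite (paste_eq tT cg ug).
Qed.

(** At a fixed point the same interval, or none, is responsible at all times, so that continuity in
    time is inherited from one solution or trivial. *)
Let paste_in_time t0 e : 0 <= t0 < T -> 0 < e -> exists2 d, 0 < d &
  forall t, 0 <= t < T -> `|t - t0| < d -> `|u t 0 - u t0 0| <= e.
Proof.
move=> t0T e0; have [[I fI I0]|nI] := pselect (exists2 I, F I & I 0); last first.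
  have u00 t : 0 <= t < T -> u t 0 = 0.
    by move=> tT; rewrite u_out// => I fI Ix; apply: nI; exists I.
  by exists 1 => // t tT _; rewrite !u00// subrr normr0 ltW.
have [[[cI lI _] _ _] _] := su fI.
have [|d d0 hd] := @continuous_in_time _ `[0, T[ (u_ I) 0 t0 e lI cI _ e0.
  by rewrite in0T.
by exists d => // t tT td; rewrite !(u_in fI)//; apply: hd => //; rewrite in0T.
Qed.

Lemma strong_solution_paste : dxx_L1_Linfty `[0, T[ u -> dx_C_Linfty_loc `[0, T[ u ->
  weighted_Linfty 2 `[0, T[ u -> strong_solution T u.
Proof.
move=> [w [mw uw w1]] [v [uv lv]] [mu_ wu].
have cu t : `[0, T[%classic t -> continuous (u t).
  by move=> Jt; apply: (paste_continuous uv); rewrite -in0T.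
apply: (@strong_solution_glue _ _ _ F) => //.
- split => //; last by exists v.
  apply: (primitive_C_Linfty_loc cu uv.2 lv) => t0 e; rewrite in0T => t0T e0.
  have [d d0 hd] := paste_in_time t0T e0.
  by exists d => // t; rewrite in0T; exact: hd.
- move=> a /andP[a0 aT].
  have J0 : `[0, a]%classic `<=` (`[0, T[%classic : set R).
    by move=> t; rewrite /= !in_itv /= => /andP[-> /le_lt_trans]; exact.
  have JS : `[0, a]%classic `*` setT `<=` (`[0, T[%classic `*` setT : set (R * R)).
    by move=> [t x] [/= /J0].
  have mJ : measurable (`[0, T[%classic : set (measurableTypeR R)) by exact: measurable_itv.
  have mJa : measurable (`[0, a]%classic : set (measurableTypeR R)) by exact: measurable_itv.
  have mJT : measurable ((`[0, T[%classic : set (measurableTypeR R)) `*` (setT : set (measurableTypeR R))).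
    exact: measurableX.
  split.
    split; first exact: measurable_funS mu_.
    by apply: le_lt_trans wu; apply: Linfty_normS => //; exact: aeW.
  exists w; split; first exact: measurable_funS mw.
    by apply: aeS uw => t uwt /J0.
  apply: le_lt_trans w1; apply: ge0_subset_integral => //.
    exact: Linfty_norm_measurable.
  by move=> t _; exact: Linfty_norm_ge0.
- by move=> I /FI[].
- by move=> I fI; exists (u_ I); [exact: su|move=> t x tT Ix; exact: u_in].
Qed.

End paste.

End Paste.

Theorem corollary2p9 (R : realType) (T : R) (hT : 0 < T) :
  (* Cut *)
  (forall (u : R -> R -> R) (I : set R),
     strong_solution T u -> open_interval I ->
     (forall x : R, boundary I x -> u 0 x = 0) ->
     strong_solution T (fun t x => \1_I x * u t x))
  /\
  (* Paste *)
  (forall (F : set (set R)) (u_ : set R -> R -> R -> R),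
     countable F ->
     (forall I, F I -> open_interval I) ->
     trivIset F id ->
     (forall I, F I -> strong_solution T (u_ I)) ->
     (forall I, F I -> forall x, (~` I) x -> u_ I 0 x = 0) ->
     dxx_L1_Linfty `[0, T[ (family_sum F u_) ->
     dx_C_Linfty_loc `[0, T[ (family_sum F u_) ->
     weighted_Linfty 2 `[0, T[ (family_sum F u_) ->
     strong_solution T (family_sum F u_)).
Proof.
split=> [u I|F u_ cF FI tF su u0 dxxu dxu wu]; first exact: strong_solution_cut.
exact: strong_solution_paste.
Qed.
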